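(* Let $\mu$ be an infinite, translation invariant and semi scale invariant measure on $(\mathfrak{G},\mathcal{F})$, where $\mathfrak{G}$ is the collection of subsets of $\mathbb{R}^d$ of diameter strictly smaller than $1$. Assume that: (1) for every bounded $A\subset\mathbb{R}^d$ and every $\delta>0$, $\mu(\{G\in\mathfrak{G}: G\cap A\neq\emptyset,\ \mathrm{diam}(G)\geq\delta\})<\infty$; (2) $\mu(\{G\in\mathfrak{G}:\mathcal{L}(\partial G)>0\})=0$; (3) $\mu(\{G\in\mathfrak{G}:\mathcal{L}(G)>0\})>0$; and in addition that $$\int_{\mathcal{A}_1}\int_0^1\frac1r\,\frac{\mathcal{L}([\partial G]^r)}{\mathcal{L}(G)}\,dr\,d\mu_p(G)<\infty .$$ Then $\mathcal{C}(\lambda_e)=\emptyset$ almost surely.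
   Context: $\mathcal{L}$ is Lebesgue measure on $\mathbb{R}^d$, $\partial G$ is the topological boundary of $G$, $o$ is the origin. $\mathfrak{G}=\{G\subset\mathbb{R}^d:\mathrm{diam}(G)<1\}$ is equipped with a suitable $\sigma$-algebra $\mathcal{F}$ (one for which all the subsets of $\mathfrak{G}$, functions and events considered are measurable). Translation invariance of $\mu$: $\mu(x+\mathcal{D})=\mu(\mathcal{D})$ for all $\mathcal{D}\in\mathcal{F}$, $x\in\mathbb{R}^d$, where $x+\mathcal{D}=\{L\subset\mathbb{R}^d: L=x+G\text{ for some }G\in\mathcal{D}\}$. Semi scale invariance of $\mu$: whenever $\mathcal{D}\in\mathcal{F}$ has $\mu(\mathcal{D})<\infty$ and $0<s<\infty$ is such that $\mathcal{D}_s:=\{G\subset\mathbb{R}^d: G/s\in\mathcal{D}\}$ contains only sets of diameter strictly smaller than $1$, then $\mu(\mathcal{D}_s)=\mu(\mathcal{D})$. For $0<\lambda<\infty$, $\Phi_\lambda(\mu)$ is a Poisson process on $\mathfrak{G}$ with intensity measure $\lambda\mu$, and the random fractal is $\mathcal{C}(\lambda)=\mathbb{R}^d\setminus\bigcup_{G\in\Phi_\lambda(\mu)}G$. The critical value is $\lambda_e=\inf\{\lambda>0:\mathbb{P}(\mathcal{C}(\lambda)=\emptyset)=1\}$. $\mathcal{A}_1=\{G\in\mathfrak{G}: o\in G,\ 2^{-1}\leq\mathrm{diam}(G)<1\}$. The measure $\mu_p$ is the part of $\mu$ on sets of positive volume: $\mu_p(\mathcal{A})=\mu(\{G\in\mathcal{A}:\mathcal{L}(G)>0\})$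 for $\mathcal{A}\in\mathcal{F}$. For $r>0$, $[\partial G]^r=\{x\in G: d(x,\partial G)<r\}\subset G$ is the inner $r$-neighbourhood of $\partial G$. *)

(* Defs.v *)
From HB Require Import structures.
From mathcomp Require Import all_boot all_order all_algebra.
From mathcomp Require Import all_classical all_reals all_analysis measurable_realfun.
Set Implicit Arguments.
Unset Strict Implicit.
Unset Printing Implicit Defensive.
Import Order.TTheory GRing.Theory Num.Theory.
Import numFieldNormedType.Exports.
Local Open Scope classical_set_scope.
Local Open Scope ring_scope.

Section euclidean.
Context {R : realType} {d : nat}.
Local Notation V := 'rV[R]_d.
Implicit Types (x y : V) (A : set V).

(* The library norm on row vectors is the sup norm: it is used below only
   through the topology and boundedness, which do not depend on this choice. *)
Definition enorm x : R := Num.sqrt (\sum_(i < d) x ord0 i ^+ 2).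

(* The maximum with 0 only serves to give the empty set diameter 0. *)
Definition diam A : \bar R :=
  maxe 0%E (ereal_sup [set (enorm (x - y))%:E | x in A & y in A]).

Definition edist_to x A : \bar R :=
  ereal_inf [set (enorm (x - y))%:E | y in A].

Definition frontier A : set V := closure A `\` interior A.

Definition inner_nbhd (r : R) A : set V :=
  [set x | A x /\ (edist_to x (frontier A) < r%:E)%E].

Definition box (a b : V) : set V :=
  [set x | forall i, a ord0 i < x ord0 i <= b ord0 i].

(* Lebesgue measure on R^d, as the Lebesgue outer measure so that it is a total
   function on sets (as lebesgue_measure is on the real line). *)
Definition Leb A : \bar R :=
  ereal_inf [set (\sum_(k <oo) (\prod_(i < d) ((q k).2 ord0 i - (q k).1 ord0 i))%:E)%E
    | q in [set q : nat -> V * V |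
        (forall k i, (q k).1 ord0 i <= (q k).2 ord0 i) /\
        A `<=` \bigcup_k box (q k).1 (q k).2]].

Definition borel_set A : Prop := <<s [set U : set V | open U] >> A.

End euclidean.

Section small_sets.
Context (R : realType) (d : nat).

Definition gset : Type := {G : set 'rV[R]_d | (diam G < 1)%E}.

HB.instance Definition _ := Choice.on gset.

Lemma diam_set0 : (diam (set0 : set 'rV[R]_d) < 1)%E.
Proof.
suff -> : diam (set0 : set 'rV[R]_d) = 0%E by rewrite lte01.
rewrite /diam (_ : image2 _ _ _ = set0) ?ereal_sup0 ?maxeNy //.
by apply/seteqP; split=> // z [].
Qed.

HB.instance Definition _ :=
  isPointed.Build gset (exist (fun G => (diam G < 1)%E) set0 diam_set0).

End small_sets.

Section set_families.
Context {R : realType} {d : nat}.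
Local Notation V := 'rV[R]_d.
Local Notation gset := (gset R d).
Implicit Types (D : set gset) (G : gset) (A : set V) (x : V).

Definition translate x D : set gset :=
  [set L | exists2 G, D G & sval L = [set x + y | y in sval G]].

(* All the subsets L of R^d, of any diameter, with L/s in D. *)
Definition dilate (s : R) D : set (set V) :=
  [set L | exists2 G, D G & [set s^-1 *: y | y in L] = sval G].

Definition small_family (s : R) D : Prop :=
  forall L, dilate s D L -> (diam L < 1)%E.

Definition dilate_gset (s : R) D : set gset :=
  [set G | dilate s D (sval G)].

Definition hits A (delta : R) : set gset :=
  [set G | sval G `&` A !=set0 /\ (delta%:E <= diam (sval G))%E].

Definition pos_boundary : set gset :=
  [set G | (0 < Leb (frontier (sval G)))%E].

Definition pos_volume : set gset := [set G | (0 < Leb (sval G))%E].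

Definition A1 : set gset :=
  [set G | sval G 0 /\ ((2^-1)%:E <= diam (sval G) < 1)%E].

End set_families.

Section sigma_algebra_on_sets.
Context {R : realType} {d : nat}.
Variable F : set (set (gset R d)).
Local Notation GF := (g_sigma_algebraType F).
Local Open Scope ereal_scope.

(* What makes the sigma-algebra F suitable: the families of sets and the
   functions of sets which are considered below are measurable. Measurability of
   the families [hits A delta] is only required for Borel sets A. The set A1 is
   [hits [set 0] 2^-1]. *)
Record suitable : Prop := Suitable {
  suitable_sigma_algebra : sigma_algebra setT F ;
  suitable_translate : forall x (D : set GF),
    measurable D -> measurable (translate x D : set GF) ;
  suitable_dilate : forall (s : R) (D : set GF), (0 < s)%R ->
    measurable D -> small_family s D -> measurable (dilate_gset s D : set GF) ;
  suitable_hits : forall A (delta : R), borel_set A -> bounded_set A ->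
    (0 < delta)%R -> measurable (hits A delta : set GF) ;
  suitable_pos_boundary : measurable (pos_boundary : set GF) ;
  suitable_Leb :
    measurable_fun [set: GF] (fun G : GF => Leb (sval G)) ;
  suitable_Leb_inner : forall r : R, (0 < r)%R ->
    measurable_fun [set: GF] (fun G : GF => Leb (inner_nbhd r (sval G))) ;
  suitable_inner : forall r : R, (0 < r)%R ->
    measurable ([set G | inner_nbhd r (sval G) 0%R] : set GF) }.

Variable mu : {measure set GF -> \bar R}.

Definition translation_invariant : Prop :=
  forall x (D : set GF), measurable D -> mu (translate x D) = mu D.

Definition semi_scale_invariant : Prop :=
  forall (s : R) (D : set GF), measurable D -> mu D < +oo -> (0 < s)%R ->
    small_family s D -> mu (dilate_gset s D) = mu D.

(* For sets A such that [hits A delta] is not in F the measure is undefined. *)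
Definition locally_finite_hits : Prop :=
  forall A (delta : R), bounded_set A -> (0 < delta)%R ->
    measurable (hits A delta : set GF) -> mu (hits A delta) < +oo.

Definition mu_p (D : set GF) : \bar R := mu (D `&` pos_volume).

Definition boundary_integral : \bar R :=
  \int[mu_p]_(G in A1) \int[lebesgue_measure]_(r in `]0%R, 1%R[)
    (r^-1 * (fine (Leb (inner_nbhd r (sval G))) / fine (Leb (sval G))))%:E.

End sigma_algebra_on_sets.

Section poisson_process.
Context {R : realType} {d : nat}.
Local Open Scope ereal_scope.

(* A point process is a random countable multiset of small sets, given by an
   enumeration (None when there is no such point). No measurability of the
   enumeration is required, only that of the counting variables. *)
Definition configuration : Type := nat -> option (gset R d).

Definition count (c : configuration) (D : set (gset R d)) : \bar R :=
  \sum_(n <oo) (if c n is Some G then (\1_D G)%:E else 0).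

Variables (F : set (set (gset R d))) (dO : measure_display).
Local Notation GF := (g_sigma_algebraType F).
Variables (Omega : measurableType dO) (P : probability Omega R).

(* The second argument of poisson_prob in the library is not used. *)
Record poisson_process (Phi : Omega -> configuration)
    (nu : set GF -> \bar R) : Prop := PoissonProcess {
  pp_measurable : forall D : set GF, measurable D ->
    measurable_fun [set: Omega] (fun w => count (Phi w) D) ;
  pp_finite : forall D : set GF, measurable D -> nu D < +oo -> forall k : nat,
    P [set w | count (Phi w) D = k%:R%:E] =
      poisson_prob (fine (nu D)) 0%N [set k] ;
  pp_infinite : forall D : set GF, measurable D -> nu D = +oo ->
    P [set w | count (Phi w) D = +oo] = 1 ;
  pp_independent : forall (n : nat) (D : 'I_n -> set GF)
      (B : 'I_n -> set (\bar R)),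
    (forall i, measurable (D i)) -> trivIset setT D ->
    (forall i, measurable (B i)) ->
    P [set w | forall i, B i (count (Phi w) (D i))] =
      \prod_(i < n) P [set w | B i (count (Phi w) (D i))] }.

Definition fractal (c : configuration) : set 'rV[R]_d :=
  ~` [set x | exists n G, c n = Some G /\ sval G x].

Definition empty_event (Phi : Omega -> configuration) : set Omega :=
  [set w | fractal (Phi w) = set0].

Definition lambda_e (Phi : R -> Omega -> configuration) : R :=
  inf [set lambda : R | (0 < lambda)%R /\ P (empty_event (Phi lambda)) = 1].

End poisson_process.

(* Main.v *)
(** Write [c] for the [mu]-mass of the sets of positive volume that contain the
    origin and have diameter in [1/2, 1[. By semi scale invariance every dyadic
    range of diameters contributes the same, so a given point survives the sets of
    diameter at least 2^-n with probability about exp(- lambda c n), against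
    2^(d n) cubes of side 2^-n: the threshold is lambda_c = d ln 2 / c.

    Below lambda_c, in a grid of separated subcubes of side 2^-m of a cube, the
    mean number of subcubes hit by no set of the corresponding range of diameters
    exceeds 2 for m large (as the frontiers are null sets, hitting a tiny cube costs
    no more than hitting a point). Iterating yields a supercritical branching
    structure, and a surviving line of closed cubes shrinks to an uncovered point.
    Sets of diameter 0 need not be locally finite, nor be independent of
    anything; to avoid countably many of them, every (T+1)-st generation is
    required to have two surviving children.

    At lambda_c, the integral condition becomes, by mass transport along the
    lattices Z^d / M, the summability over n of the mass of the sets having the
    origin within 2^-n of their frontier. Hence the mean number of cubes of side
    2^-n contained in no single set of diameter at least 2^-n stays bounded. While
    this number is between 1 and J, the next ranges of diameters kill all these cubes with
    a probability bounded below (Harris inequality), so it vanishes eventually.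

    [Leb] is an outer measure defined by box covers, so volumes enter only through
    numbers of lattice cubes. *)
Require Import Defs.
From HB Require Import structures.
From mathcomp Require Import all_boot all_order all_algebra.
From mathcomp Require Import all_classical all_reals all_analysis measurable_realfun.
From mathcomp Require Import finmap ring lra zify.
Import Order.TTheory GRing.Theory Num.Theory.
Import numFieldNormedType.Exports.
Local Open Scope classical_set_scope.
Local Open Scope ring_scope.
Set Implicit Arguments.
Unset Strict Implicit.
Unset Printing Implicit Defensive.

(** * Independence and void events *)

Section independence.
Context d {T : measurableType d} {R : realType} (P : probability T R).
Implicit Types (G : set (set T)) (A B : set T).

(** A [poisson_process] controls only counting variables, and the zones met in the branching need
    not be measurable. All events are therefore built from void events of families of finite mass,
    and independence is used for the sigma-algebras that such events generate inside disjoint zones.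

    Covering and survival use different families. A cube counts as covered only if a single set of
    positive volume contains a whole ball around its corner, which leaves finitely many cubes to
    watch; a surviving cube is met by no set of the range at all, null sets included. For each
    dyadic range both families have mass c up to an error. Strictly below lambda_c it is enough that
    the error tends to 0 as the cube shrinks. At lambda_c the sum of the errors, times lambda, is
    the exponent in the bound on the mean number of uncovered cubes, so it has to be finite.

    Fubini's theorem would turn the integral condition into a statement about the origin at once,
    but joint measurability in the set and the point is not assumed. A finite sum over a lattice
    replaces the integral over space, and the mesh then tends to 0. *)

Definition prob A : R := fine (P A).

Lemma probE A : measurable A -> P A = (prob A)%:E.
Proof. by move=> mA; rewrite fineK// fin_num_measure. Qed.

Lemma prob_ge0 A : 0 <= prob A.
Proof. by rewrite fine_ge0. Qed.

Lemma prob_le1 A : measurable A -> prob A <= 1.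
Proof. by move=> mA; rewrite -lee_fin -probE// probability_le1. Qed.

Lemma le_prob A B : measurable A -> measurable B -> A `<=` B -> prob A <= prob B.
Proof. by move=> mA mB AB; rewrite -lee_fin -!probE// le_measure// mem_set. Qed.

Lemma probC A : measurable A -> prob (~` A) = 1 - prob A.
Proof.
move=> mA; apply: EFin_inj.
by rewrite -probE ?EFinB -?probE ?probability_setC//; exact: measurableC.
Qed.

Lemma probT : prob setT = 1.
Proof. by rewrite /prob probability_setT. Qed.

Lemma probU A B : measurable A -> measurable B -> A `&` B = set0 ->
  prob (A `|` B) = prob A + prob B.
Proof.
move=> mA mB AB; apply: EFin_inj; rewrite EFinD -!probE//; last exact: measurableU.
by rewrite measureU.
Qed.

Lemma probUl A B : measurable A -> measurable B ->
  prob (A `|` B) = prob A + prob (B `\` A).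
Proof.
move=> mA mB; rewrite -probU//; [congr prob|exact: measurableD|].
  by apply/seteqP; split=> x /=; have := EM (A x); tauto.
by apply/seteqP; split=> x //= -[? []].
Qed.

Lemma probD A B : measurable A -> measurable B ->
  prob (A `\` B) = prob A - prob (A `&` B).
Proof.
move=> mA mB; apply/eqP; rewrite eq_sym subr_eq -probU.
- by apply/eqP; congr prob; apply/seteqP; split=> x /=; have := EM (B x); tauto.
- exact: measurableD.
- exact: measurableI.
- by apply/seteqP; split=> x //= -[[? ?] []].
Qed.

Lemma prob_setU_le A B : measurable A -> measurable B ->
  prob (A `|` B) <= prob A + prob B.
Proof.
move=> mA mB; rewrite probUl// lerD2l le_prob//; exact: measurableD.
Qed.

Definition indep A B : Prop := prob (A `&` B) = prob A * prob B.

(* Dynkin's argument, in one of the two variables. *)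
Lemma indep_sigma_l G B : setI_closed G -> G `<=` measurable -> measurable B ->
  (forall A, G A -> indep A B) -> forall A, <<s G >> A -> indep A B.
Proof.
move=> GI Gm mB GB.
have sm A : <<s G >> A -> measurable A.
  by apply: smallest_sub => //; exact: sigma_algebra_measurable.
have [s0 sC sU] := smallest_sigma_algebra [set: T] G.
pose H := [set A | <<s G >> A /\ indep A B].
suff : <<s G >> `<=` H by move=> h A /h [].
apply: (@lambda_system_subset _ _ GI setT) => //; last first.
  by move=> C GC; split; [exact: sub_gen_smallest|exact: GB].
apply/dynkin_lambda_system; split.
- split; first by have := sC _ s0; rewrite setD0.
  by rewrite /indep setTI probT mul1r.
- move=> A [sA iA]; split; first by have := sC _ sA; rewrite setTD.
  have mA := sm _ sA.
  rewrite /indep probC// setIC -setDE probD// [B `&` A]setIC iA; ring.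
- move=> A tA AH; split; first by apply: sU => i; exact: (AH i).1.
  have mA i : measurable (A i) by apply: sm; exact: (AH i).1.
  apply: EFin_inj; rewrite EFinM -!probE//; last 2 first.
  + exact: bigcup_measurable.
  + by apply: measurableI => //; exact: bigcup_measurable.
  rewrite setI_bigcupl measure_bigcup//; last 2 first.
  + by move=> i _; exact: measurableI.
  + by apply: trivIset_setIr.
  rewrite measure_bigcup// muleC probE// -nneseriesZl//.
  apply: eq_eseriesr => i _.
  transitivity (prob (A i `&` B))%:E; first by apply: probE; exact: measurableI.
  by rewrite (AH i).2 EFinM muleC; congr (_ * _)%E; apply/esym; exact: probE.
Qed.

Lemma indepC A B : indep A B -> indep B A.
Proof. by rewrite /indep setIC mulrC. Qed.

Lemma indep_sigma G H : setI_closed G -> setI_closed H ->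
  G `<=` measurable -> H `<=` measurable ->
  (forall A B, G A -> H B -> indep A B) ->
  forall A B, <<s G >> A -> <<s H >> B -> indep A B.
Proof.
move=> GI HI Gm Hm GH A B sA sB.
have mA : measurable A.
  by move: sA; apply: smallest_sub => //; exact: sigma_algebra_measurable.
apply/indepC; move: B sB; apply: indep_sigma_l => // B HB.
apply/indepC; move: A sA {mA}; apply: indep_sigma_l => //; first exact: Hm.
by move=> A GA; exact: GH.
Qed.

End independence.

(** * Void events of a Poisson process *)

Section voids.
Context {R : realType} {d : nat} {F : set (set (gset R d))}.
Local Notation GF := (g_sigma_algebraType F).
Context {dO : measure_display} {Omega : measurableType dO}.
Context (P : probability Omega R) (Phi : Omega -> configuration (R := R) (d := d)).
Context (nu : {measure set GF -> \bar R}).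
Implicit Types (D : set GF) (A B : set GF).

Definition void D : set Omega :=
  [set w | forall n G, Phi w n = Some G -> ~ D G].

(** Links the void event, defined on the enumeration, to a counting variable, for which
    measurability and law are given. *)
Lemma void_count D : void D = [set w | Defs.count (Phi w) D = 0%E].
Proof.
apply/seteqP; split => w /=.
  move=> vD; apply: eseries0 => n _ _.
  case E : (Phi w n) => [G|//].
  by rewrite indicE memNset//; exact: vD E.
move=> cD n G E DG.
have h k : (0 <= if Phi w k is Some G then (\1_D G)%:E else 0 :> \bar R)%E.
  by case: (Phi w k) => [H|//]; rewrite lee_fin.
move: cD; rewrite /Defs.count (@nneseriesD1 _ _ n)// E indicE mem_set//.
by move/eqP; rewrite padde_eq0 ?lee01 ?nneseries_ge0// onee_eq0.
Qed.

Lemma voidU A B : void (A `|` B) = void A `&` void B.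
Proof.
apply/seteqP; split=> w /=.
  by move=> h; split=> n G /h AB ?; apply: AB; [left|right].
by move=> [hA hB] n G E [/(hA _ _ E)|/(hB _ _ E)].
Qed.

Lemma void_sub A B : A `<=` B -> void B `<=` void A.
Proof. by move=> AB w vB n G /vB + /AB. Qed.

Hypothesis pp : poisson_process P Phi nu.

Lemma measurable_void D : measurable D -> measurable (void D).
Proof.
move=> mD; rewrite void_count.
rewrite (_ : [set w | _] = setT `&` (fun w => Defs.count (Phi w) D) @^-1` [set 0%E]).
  exact: (pp_measurable pp mD).
by rewrite setTI.
Qed.

Definition finite_mass D : Prop := measurable D /\ (nu D < +oo)%E.

Lemma finite_mass0 : finite_mass set0.
Proof. by split=> //; rewrite measure0. Qed.

Lemma finite_massU A B : finite_mass A -> finite_mass B -> finite_mass (A `|` B).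
Proof.
move=> [mA fA] [mB fB]; split; first exact: measurableU.
by apply: (le_lt_trans (measureU2 _ mA mB)); exact: lte_add_pinfty.
Qed.

Lemma finite_massS A B : measurable A -> A `<=` B -> finite_mass B -> finite_mass A.
Proof.
move=> mA AB [mB fB]; split=> //; apply: le_lt_trans fB.
by rewrite le_measure// mem_set.
Qed.

Lemma finite_massD A B : measurable B -> finite_mass A -> finite_mass (A `\` B).
Proof.
move=> mB fA; apply: (finite_massS _ _ fA); first by apply: measurableD => //; exact: fA.1.
exact: subDsetl.
Qed.

Lemma prob_void D : finite_mass D -> prob P (void D) = expR (- fine (nu D)).
Proof.
move=> [mD fD]; rewrite /prob void_count (pp_finite pp mD fD 0%N) /poisson_prob.
(* For parameter 0 the measure [poisson_prob] is the Dirac mass at 0. *)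
case: ifPn => [h|].
  by rewrite esum_set1 ?lee_fin ?poisson_pmf_ge0//= /poisson_pmf h expr0 fact0 invr1 !mul1r.
rewrite -leNgt => h; have -> : fine (nu D) = 0.
  by apply/eqP; rewrite eq_le h fine_ge0.
by rewrite oppr0 expR0 diracE mem_set.
Qed.

Definition voids A : set (set Omega) :=
  [set E | exists D, [/\ finite_mass D, D `<=` A & E = void D]].

(** The information on the points of the process that lie in [A]. The family [A] need not be
    measurable: it only limits which void events generate. *)
Definition sigma_void A : set (set Omega) := <<s voids A >>.

Lemma voids_measurable A : voids A `<=` measurable.
Proof. by move=> _ [D [[mD _] _ ->]]; exact: measurable_void. Qed.

Lemma sigma_void_measurable A : sigma_void A `<=` measurable.
Proof.
apply: smallest_sub; last exact: voids_measurable.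
exact: sigma_algebra_measurable.
Qed.

Lemma voids_setI A : setI_closed (voids A).
Proof.
move=> _ _ [D [fD DA ->]] [D' [fD' DA' ->]]; exists (D `|` D').
by split; [exact: finite_massU|rewrite subUset|rewrite voidU].
Qed.

(** Void events inside [A] are closed under intersection, and for disjoint families of finite mass
    their probabilities multiply because [nu] is additive. *)
Lemma indep_sigma_void A B : A `&` B = set0 ->
  forall E E', sigma_void A E -> sigma_void B E' -> indep P E E'.
Proof.
move=> AB; apply: indep_sigma; try exact: voids_setI; try exact: voids_measurable.
move=> _ _ [D [fD DA ->]] [D' [fD' DA' ->]].
rewrite /indep -voidU !prob_void//; last exact: finite_massU.
have [mD fD1] := fD; have [mD' fD2] := fD'.
rewrite measureU//; last first.
  by apply/seteqP; split => // x [/DA Ax /DA' Bx]; rewrite -AB.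
by rewrite -expRD fineD ?opprD// ge0_fin_numE.
Qed.

Lemma sigma_voidS A B : A `<=` B -> sigma_void A `<=` sigma_void B.
Proof.
move=> AB; apply: smallest_sub; first exact: smallest_sigma_algebra.
by move=> _ [D [fD DA ->]]; apply: sub_gen_smallest; exists D; split=> //; apply: subset_trans AB.
Qed.

Lemma sigma_void_void A D : finite_mass D -> D `<=` A -> sigma_void A (void D).
Proof. by move=> fD DA; apply: sub_gen_smallest; exists D. Qed.

Lemma sigma_voidC A E : sigma_void A E -> sigma_void A (~` E).
Proof.
have [s0 sC sU] := smallest_sigma_algebra [set: Omega] (voids A).
by move=> sE; have := sC _ sE; rewrite setTD.
Qed.

Lemma sigma_void0 A : sigma_void A set0.
Proof. by have [] := smallest_sigma_algebra [set: Omega] (voids A). Qed.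

Lemma sigma_voidT A : sigma_void A setT.
Proof. by rewrite -setC0; apply: sigma_voidC; exact: sigma_void0. Qed.

Lemma sigma_voidU A E E' :
  sigma_void A E -> sigma_void A E' -> sigma_void A (E `|` E').
Proof.
have [s0 sC sU] := smallest_sigma_algebra [set: Omega] (voids A).
by move=> sE sE'; rewrite -bigcup2E; apply: sU => -[|[|i]].
Qed.

Lemma sigma_voidI A E E' :
  sigma_void A E -> sigma_void A E' -> sigma_void A (E `&` E').
Proof.
move=> sE sE'; rewrite -[E `&` E']setCK setCI.
by apply: sigma_voidC; apply: sigma_voidU; apply: sigma_voidC.
Qed.

Lemma sigma_void_bigU A (I : Type) (s : seq I) (Q : pred I) (E : I -> set Omega) :
  (forall i, Q i -> sigma_void A (E i)) -> sigma_void A (\big[setU/set0]_(i <- s | Q i) E i).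
Proof.
by move=> h; elim/big_rec: _ => [|i x Qi]; [exact: sigma_void0|apply: sigma_voidU; exact: h].
Qed.

Lemma sigma_void_bigI A (I : Type) (s : seq I) (Q : pred I) (E : I -> set Omega) :
  (forall i, Q i -> sigma_void A (E i)) -> sigma_void A (\big[setI/setT]_(i <- s | Q i) E i).
Proof.
by move=> h; elim/big_rec: _ => [|i x Qi]; [exact: sigma_voidT|apply: sigma_voidI; exact: h].
Qed.

(* Given [void D], the events [~` void (D i)] become [~` void (D i `\` D)],
   which are smaller and independent of [void D]. *)
Lemma harris (I : Type) (s : seq I) (D : I -> set GF) :
  (forall i, finite_mass (D i)) ->
  \prod_(i <- s) (1 - prob P (void (D i))) <=
  prob P (\big[setI/setT]_(i <- s) ~` void (D i)).
Proof.
move=> fD; elim: s => [|i s IH]; first by rewrite !big_nil probT.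
rewrite !big_cons.
set A := \big[setI/setT]_(j <- s) _ in IH *.
have mv D' : finite_mass D' -> measurable (void D').
  by move=> [mD' _]; exact: measurable_void.
have mA : measurable A.
  by apply: bigsetI_measurable => j _; apply: measurableC; exact: mv.
have mV := mv _ (fD i).
pose A' := \big[setI/setT]_(j <- s) ~` void (D j `\` D i).
have fDD j : finite_mass (D j `\` D i).
  by apply: finite_massD => //; exact: (fD i).1.
have mA' : measurable A'.
  by apply: bigsetI_measurable => j _; apply: measurableC; exact: mv.
have AA' : void (D i) `&` A = void (D i) `&` A'.
  rewrite /A /A'; elim/big_rec2: _ => // j x y _ h.
  rewrite setICA h [RHS]setICA !setIA; congr (_ `&` _).
  apply/seteqP; split=> w /= [+ vi]; (move=> a; split=> // b; apply: a).
    by move=> n G E DG; apply: (b _ _ E); split=> //; exact: vi E.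
  by apply: void_sub b; exact: subDsetl.
have A'A : A' `<=` A.
  rewrite /A /A'; elim/big_rec2: _ => // j x y _ h.
  by apply: setISS => //; apply: subsetC; apply: void_sub; exact: subDsetl.
have iVA' : indep P (void (D i)) A'.
  apply: (@indep_sigma_void (D i) (~` D i)); first by rewrite setICr.
    exact: sigma_void_void.
  apply: sigma_void_bigI => j _; apply: sigma_voidC; exact: sigma_void_void.
rewrite setIC -setDE probD// setIC AA' iVA'.
have : prob P A' <= prob P A by exact: le_prob.
have := prob_ge0 P (void (D i)); have := prob_le1 P mV.
set p := prob P (void _); set a := prob P A; set a' := prob P A'.
move=> p1 p0 aa'; apply: (@le_trans _ _ ((1 - p) * a)).
  by apply: ler_wpM2l => //; rewrite subr_ge0.
by rewrite mulrBl mul1r lerD2l lerN2 ler_wpM2l.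
Qed.

End voids.

(** * Euclidean geometry *)

Section enorm.
Context {R : realType} {d : nat}.
Local Notation V := 'rV[R]_d.
Implicit Types (x y z : V) (A B : set V) (s r : R).

Lemma sumsq_ge0 x : 0 <= \sum_(i < d) x ord0 i ^+ 2.
Proof. by apply: sumr_ge0 => i _; rewrite sqr_ge0. Qed.

Lemma enorm_ge0 x : 0 <= enorm x.
Proof. exact: sqrtr_ge0. Qed.

Lemma sqr_enorm x : enorm x ^+ 2 = \sum_(i < d) x ord0 i ^+ 2.
Proof. by rewrite sqr_sqrtr// sumsq_ge0. Qed.

Lemma enorm0 : enorm (0 : V) = 0.
Proof. by rewrite /enorm big1 ?sqrtr0// => i _; rewrite mxE expr0n. Qed.

Lemma enormZ s x : enorm (s *: x) = `|s| * enorm x.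
Proof.
rewrite /enorm -sqrtr_sqr -sqrtrM ?sqr_ge0// mulr_sumr; congr Num.sqrt.
by apply: eq_bigr => i _; rewrite mxE exprMn.
Qed.

Lemma enormN x : enorm (- x) = enorm x.
Proof. by rewrite -scaleN1r enormZ normrN1 mul1r. Qed.

Lemma enormB x y : enorm (x - y) = enorm (y - x).
Proof. by rewrite -enormN opprB. Qed.

Lemma coord_le_enorm x i : `|x ord0 i| <= enorm x.
Proof.
rewrite -(@ler_pXn2r _ 2%N)// ?nnegrE ?enorm_ge0//.
rewrite sqr_enorm real_normK ?num_real// (bigD1 i)//= lerDl.
by apply: sumr_ge0 => j _; rewrite sqr_ge0.
Qed.

Lemma enorm_le_coord x s : (0 < d)%N -> 0 <= s -> (forall i, `|x ord0 i| <= s) ->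
  enorm x <= d%:R * s.
Proof.
move=> d0 s0 xs; rewrite -(@ler_pXn2r _ 2%N)// ?nnegrE ?enorm_ge0//; last exact: mulr_ge0.
rewrite sqr_enorm; apply: (@le_trans _ _ (\sum_(i < d) s ^+ 2)).
  by apply: ler_sum => i _; rewrite -real_normK ?num_real// ler_pXn2r// nnegrE.
rewrite sumr_const card_ord exprMn -[leLHS]mulr_natl ler_wpM2r ?sqr_ge0//.
by rewrite -natrX ler_nat -{1}(expn1 d) leq_pexp2l.
Qed.

(** Cauchy-Schwarz: sum 2 a b <= a^2 + b^2 over the coordinates, scaled so that each square
    contributes half of the product of the norms. *)
Lemma dot_le_enorm x y : \sum_(i < d) x ord0 i * y ord0 i <= enorm x * enorm y.
Proof.
have [x0|x0] := eqVneq (enorm x) 0.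
  rewrite x0 mul0r big1// => i _.
  by have := coord_le_enorm x i; rewrite x0 normr_le0 => /eqP ->; rewrite mul0r.
have [y0|y0] := eqVneq (enorm y) 0.
  rewrite y0 mulr0 big1// => i _.
  by have := coord_le_enorm y i; rewrite y0 normr_le0 => /eqP ->; rewrite mulr0.
have xp : 0 < enorm x by rewrite lt_neqAle eq_sym x0 enorm_ge0.
have yp : 0 < enorm y by rewrite lt_neqAle eq_sym y0 enorm_ge0.
have h i : x ord0 i * y ord0 i <=
    (enorm y / enorm x / 2) * x ord0 i ^+ 2 + (enorm x / enorm y / 2) * y ord0 i ^+ 2.
  rewrite -subr_ge0.
  have -> : enorm y / enorm x / 2 * x ord0 i ^+ 2 +
      enorm x / enorm y / 2 * y ord0 i ^+ 2 - x ord0 i * y ord0 i =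
    (enorm y * x ord0 i - enorm x * y ord0 i) ^+ 2 / (2 * enorm x * enorm y).
    by field; rewrite x0 y0.
  by rewrite divr_ge0 ?sqr_ge0// !mulr_ge0// enorm_ge0.
apply: le_trans (ler_sum _ (fun i _ => h i)) _.
rewrite big_split/= -!mulr_sumr -!sqr_enorm.
by rewrite le_eqVlt; apply/orP; left; apply/eqP; field; rewrite x0 y0.
Qed.

Lemma ler_enormD x y : enorm (x + y) <= enorm x + enorm y.
Proof.
rewrite -(@ler_pXn2r _ 2%N)// ?nnegrE ?addr_ge0 ?enorm_ge0//.
rewrite sqrrD !sqr_enorm.
rewrite (eq_bigr (fun i => x ord0 i ^+ 2 + (x ord0 i * y ord0 i) *+ 2 + y ord0 i ^+ 2)).
  rewrite !big_split/= lerD2r lerD2l.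
  by rewrite mulr2n lerD// dot_le_enorm.
by move=> i _; rewrite mxE sqrrD.
Qed.

Lemma ler_enormB x y z : enorm (x - z) <= enorm (x - y) + enorm (y - z).
Proof. by have := ler_enormD (x - y) (y - z); rewrite addrA subrK. Qed.

(** Neighbourhoods come from the sup norm; the sup ball of radius e / (d + 1) lies in the Euclidean
    ball of radius e. *)
Lemma nbhs_enorm x A : (0 < d)%N ->
  nbhs x A <-> exists2 e : R, 0 < e & forall y, enorm (x - y) < e -> A y.
Proof.
move=> d0; split.
  move=> /nbhs_ballP[e /= e0 eA]; exists e => // y xy; apply: eA.
  split=> // i j; rewrite ord1 /ball/=; apply: le_lt_trans xy.
  by have := coord_le_enorm (x - y) j; rewrite !mxE.
move=> [e e0 eA]; apply/nbhs_ballP; exists (e / d.+1%:R) => /=.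
  by rewrite divr_gt0.
move=> y [_ xy]; apply: eA.
apply: (@le_lt_trans _ _ (d%:R * (e / d.+1%:R))).
  apply: enorm_le_coord => //; first by rewrite divr_ge0// ltW.
  by move=> i; rewrite !mxE; apply/ltW; exact: (xy ord0 i).
by rewrite mulrCA gtr_pMr// ltr_pdivrMr// mul1r ltr_nat.
Qed.

Lemma closure_enorm A x : (0 < d)%N ->
  closure A x <-> forall e : R, 0 < e -> exists2 y, A y & enorm (x - y) < e.
Proof.
move=> d0; split=> [cA e e0|h B /(nbhs_enorm _ _ d0)[e e0 eB]].
  have /cA[y [Ay xy]] : nbhs x [set y | enorm (x - y) < e].
    by apply/nbhs_enorm => //; exists e.
  by exists y.
by have [y Ay xy] := h _ e0; exists y; split=> //; exact: eB.
Qed.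

Lemma frontier_enorm A x : (0 < d)%N ->
  frontier A x <-> forall e : R, 0 < e ->
    (exists2 y, A y & enorm (x - y) < e) /\ (exists2 y, ~ A y & enorm (x - y) < e).
Proof.
move=> d0; split=> [[/(closure_enorm _ _ d0) cA iA] e e0|h].
  split; first exact: cA.
  apply: contrapT => he; apply: iA; apply/(nbhs_enorm _ _ d0).
  by exists e => // y xy; apply: contrapT => nAy; apply: he; exists y.
split; first by apply/closure_enorm => // e e0; exact: (h e e0).1.
move=> /(nbhs_enorm _ _ d0)[e e0 eA].
by have [_ [y nAy xy]] := h e e0; apply: nAy; exact: eA.
Qed.

(** The point sits at the supremum of the parameters for which the segment is in [A]: points of [A]
    approach it from below, and if it is itself in [A] then the points just beyond it are not. *)
Lemma frontier_segment A x y : (0 < d)%N -> A x -> ~ A y ->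
  exists t : R, 0 <= t <= 1 /\ frontier A (x + t *: (y - x)).
Proof.
move=> d0 Ax nAy.
pose T := [set t : R | 0 <= t <= 1 /\ A (x + t *: (y - x))].
have T0 : T 0 by split; rewrite ?lexx ?ler01// scale0r addr0.
have supT : has_sup T by split; [exists 0|exists 1 => t [/andP[]]].
have t0 : 0 <= sup T by apply: ub_le_sup => //; exact: supT.2.
have t1 : sup T <= 1 by apply: ge_sup; [exists 0|move=> t [/andP[]]].
exists (sup T); split; first by rewrite t0.
have nx0 : 0 < enorm (y - x) + 1 by rewrite ltr_wpDl ?enorm_ge0.
have dist s : enorm (x + sup T *: (y - x) - (x + s *: (y - x))) = `|sup T - s| * enorm (y - x).
  by rewrite opprD addrACA subrr add0r -scalerBl enormZ.
have small s e : 0 < e -> `|sup T - s| < e / (enorm (y - x) + 1) ->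
    enorm (x + sup T *: (y - x) - (x + s *: (y - x))) < e.
  move=> e0 h; rewrite dist.
  apply: (@le_lt_trans _ _ (`|sup T - s| * (enorm (y - x) + 1))).
    by rewrite ler_wpM2l// lerDl.
  by rewrite -ltr_pdivlMr.
apply/frontier_enorm => // e e0.
have e'0 : 0 < e / (enorm (y - x) + 1) by rewrite divr_gt0.
split.
  have [s Ts hs] := sup_adherent e'0 supT.
  exists (x + s *: (y - x)); first exact: Ts.2.
  apply: small => //; rewrite ger0_norm; first by rewrite ltrBlDr addrC -ltrBlDr.
  by rewrite subr_ge0; apply: ub_le_sup => //; exact: supT.2.
have [Ts|nTs] := pselect (A (x + sup T *: (y - x))); last first.
  by exists (x + sup T *: (y - x)) => //; rewrite subrr enorm0.
have tlt1 : sup T < 1.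
  rewrite lt_neqAle t1 andbT; apply/eqP => h; apply: nAy.
  by move: Ts; rewrite h scale1r addrCA subrr addr0.
pose s := Num.min 1 (sup T + e / (enorm (y - x) + 1) / 2).
have s1 : sup T < s by rewrite /s lt_min tlt1 ltrDl divr_gt0.
exists (x + s *: (y - x)).
  move=> As; have : s <= sup T.
    apply: ub_le_sup; first exact: supT.2.
    by split=> //; rewrite (le_trans t0 (ltW s1))/= ge_min lexx.
  by rewrite leNgt s1.
apply: small => //; rewrite distrC gtr0_norm ?subr_gt0// ltrBlDl.
rewrite (@le_lt_trans _ _ (sup T + e / (enorm (y - x) + 1) / 2))//.
  by rewrite ge_min lexx orbT.
by rewrite ltrD2l gtr_pMr// invf_lt1// ltr1n.
Qed.

End enorm.

Section affine.
Context {R : realType} {d : nat}.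
Hypothesis d0 : (0 < d)%N.
Local Notation V := 'rV[R]_d.
Implicit Types (x y z : V) (A B : set V) (s r : R).

Definition aff x s y : V := x + s *: y.

Lemma affK x s : s != 0 -> cancel (aff x s) (aff (- (s^-1 *: x)) s^-1).
Proof. by move=> s0 y; rewrite /aff scalerDr scalerA mulVf// scale1r addKr. Qed.

Lemma aff_inj x s : s != 0 -> injective (aff x s).
Proof. by move=> s0; exact: can_inj (affK x s0). Qed.

Lemma affVK x s : s != 0 -> cancel (aff (- (s^-1 *: x)) s^-1) (aff x s).
Proof.
by move=> s0 y; rewrite /aff scalerDr scalerN !scalerA mulfV// !scale1r addNKr.
Qed.

Lemma image_aff x s A y : s != 0 ->
  (aff x s @` A) y = A (aff (- (s^-1 *: x)) s^-1 y).
Proof.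
move=> s0; apply/propext; split=> [[z Az <-]|Ay]; first by rewrite affK.
by exists (aff (- (s^-1 *: x)) s^-1 y) => //; exact: affVK.
Qed.

Lemma image_aff_aff x s A y : s != 0 -> (aff x s @` A) (aff x s y) = A y.
Proof. by move=> s0; rewrite image_aff// affK. Qed.

Lemma enorm_aff x s y z : 0 <= s -> enorm (aff x s y - aff x s z) = s * enorm (y - z).
Proof.
by move=> s0; rewrite /aff opprD addrACA subrr add0r -scalerBr enormZ ger0_norm.
Qed.

Lemma frontier_aff x s A : 0 < s -> frontier (aff x s @` A) = aff x s @` frontier A.
Proof.
move=> s0; have s0' : s != 0 by rewrite gt_eqF.
apply/seteqP; split => y.
  move=> /(frontier_enorm _ _ d0) h; rewrite image_aff//.
  apply/(frontier_enorm _ _ d0) => e e0.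
  have [[z1 Az1 h1] [z2 Az2 h2]] := h _ (mulr_gt0 s0 e0).
  split.
    exists (aff (- (s^-1 *: x)) s^-1 z1); first by rewrite -image_aff.
    by rewrite enorm_aff ?invr_ge0 ?ltW// ltr_pdivrMl.
  exists (aff (- (s^-1 *: x)) s^-1 z2); first by rewrite -image_aff.
  by rewrite enorm_aff ?invr_ge0 ?ltW// ltr_pdivrMl.
move=> [z /(frontier_enorm _ _ d0) h <-]; apply/(frontier_enorm _ _ d0) => e e0.
have [[z1 Az1 h1] [z2 Az2 h2]] := h _ (divr_gt0 e0 s0).
split.
  exists (aff x s z1); first by rewrite image_aff_aff.
  by rewrite enorm_aff ?ltW// mulrC -ltr_pdivlMr.
exists (aff x s z2); first by rewrite image_aff_aff.
by rewrite enorm_aff ?ltW// mulrC -ltr_pdivlMr.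
Qed.

Lemma edist_lt x A r :
  (edist_to x A < r%:E)%E <-> exists2 y, A y & enorm (x - y) < r.
Proof.
split=> [/ereal_inf_lt[_ [y Ay <-]]|[y Ay xy]]; first by rewrite lte_fin; exists y.
by apply: (@le_lt_trans _ _ (enorm (x - y))%:E) => //; apply: ereal_inf_lbound; exists y.
Qed.

Lemma inner_nbhdP r A x :
  inner_nbhd r A x <-> A x /\ exists2 y, frontier A y & enorm (x - y) < r.
Proof. by rewrite /inner_nbhd /=; split=> -[Ax /edist_lt]. Qed.

Lemma inner_nbhd_aff r A x s y : 0 < s ->
  inner_nbhd (s * r) (aff x s @` A) (aff x s y) <-> inner_nbhd r A y.
Proof.
move=> s0; have s0' : s != 0 by rewrite gt_eqF.
rewrite !inner_nbhdP image_aff_aff// frontier_aff//.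
split=> -[Ay [z Az yz]]; split=> //.
  by move: Az yz => [z' Az' <-]; rewrite enorm_aff ?ltW// ltr_pM2l//; exists z'.
by exists (aff x s z); [exists z|rewrite enorm_aff ?ltW// ltr_pM2l].
Qed.

Lemma diam_ge0 A : (0 <= diam A)%E.
Proof. by rewrite le_max lexx. Qed.

Lemma le_diam A x y : A x -> A y -> ((enorm (x - y))%:E <= diam A)%E.
Proof.
move=> Ax Ay; rewrite le_max; apply/orP; right.
by apply: ereal_sup_ubound; exists x => //; exists y.
Qed.

Lemma diam_le A (M : \bar R) : (0 <= M)%E ->
  (forall x y, A x -> A y -> ((enorm (x - y))%:E <= M)%E) -> (diam A <= M)%E.
Proof.
move=> M0 h; rewrite ge_max M0/=; apply: ge_ereal_sup => _ [x Ax [y Ay <-]].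
exact: h.
Qed.

Lemma diam_aff_le x s A : 0 <= s -> (diam (aff x s @` A) <= s%:E * diam A)%E.
Proof.
move=> s0; apply: diam_le; first by rewrite mule_ge0// diam_ge0.
move=> _ _ [y Ay <-] [z Az <-]; rewrite enorm_aff// EFinM.
by apply: lee_wpmul2l => //; exact: le_diam.
Qed.

Lemma diam_aff x s A : 0 < s -> diam (aff x s @` A) = (s%:E * diam A)%E.
Proof.
move=> s0; apply/eqP; rewrite eq_le; apply/andP; split.
  by apply: diam_aff_le; exact: ltW.
have s0' : s != 0 by rewrite gt_eqF.
have : (diam A <= s^-1%:E * diam (aff x s @` A))%E.
  have := @diam_aff_le (- (s^-1 *: x)) s^-1 (aff x s @` A) _.
  rewrite image_comp (_ : (_ \o _) @` A = A); last first.
    apply/seteqP; split=> [_ [y Ay <-]|y Ay]; first by rewrite /= affK.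
    by exists y => //=; rewrite affK.
  by apply; rewrite invr_ge0 ltW.
move=> h; have s0e : (0 <= s%:E)%E by rewrite lee_fin ltW.
apply: le_trans (lee_wpmul2l s0e h) _.
by rewrite muleA -EFinM mulfV// mul1e.
Qed.

End affine.

(** * Box covers, cubes and deep points *)

Section lebesgue.
Context {R : realType} {d : nat}.
Local Notation V := 'rV[R]_d.
Implicit Types (x y z : V) (A B : set V) (s r : R).

Definition box_cover A (q : nat -> V * V) : Prop :=
  (forall k i, (q k).1 ord0 i <= (q k).2 ord0 i) /\ A `<=` \bigcup_k box (q k).1 (q k).2.

Definition box_vol (p : V * V) : R := \prod_(i < d) (p.2 ord0 i - p.1 ord0 i).

Lemma box_vol_ge0 (p : V * V) : (forall i, p.1 ord0 i <= p.2 ord0 i) -> 0 <= box_vol p.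
Proof. by move=> h; apply: prodr_ge0 => i _; rewrite subr_ge0. Qed.

Lemma Leb_le A q : box_cover A q -> (Leb A <= \sum_(k <oo) (box_vol (q k))%:E)%E.
Proof. by move=> qA; apply: ereal_inf_lbound; exists q. Qed.

Lemma Leb_lt A (v : \bar R) : (Leb A < v)%E ->
  exists2 q, box_cover A q & (\sum_(k <oo) (box_vol (q k))%:E < v)%E.
Proof. by move=> /ereal_inf_lt[_ [q qA <-]] h; exists q. Qed.

Lemma le_Leb A B : A `<=` B -> (Leb A <= Leb B)%E.
Proof.
move=> AB; apply: le_ereal_inf_tmp => _ [q [qle qB] <-].
by apply: Leb_le; split=> //; exact: subset_trans qB.
Qed.

Lemma Leb_ge0 A : (0 <= Leb A)%E.
Proof.
apply: le_ereal_inf_tmp => _ [q [qle qB] <-].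
by apply: nneseries_ge0 => k _ _; rewrite lee_fin box_vol_ge0.
Qed.

(** The image of a box cover has s^d times its volume, so null sets have null images. *)
Lemma Leb_aff_gt0 A x s : 0 < s -> (0 < Leb (aff x s @` A))%E -> (0 < Leb A)%E.
Proof.
move=> s0 h; rewrite lt_neqAle Leb_ge0 andbT; apply/eqP => A0.
have sd0 : (0 < s ^+ d) by rewrite exprn_gt0.
suff : (Leb (aff x s @` A) <= 0)%E by rewrite leNgt h.
apply/lee_addgt0Pr => e e0; rewrite add0e.
have /Leb_lt[q [qle qA] hq] : (Leb A < (e / s ^+ d)%:E)%E.
  by rewrite -A0 lte_fin divr_gt0.
pose q' k := (aff x s (q k).1, aff x s (q k).2).
have vol k : (box_vol (q' k))%:E = ((s ^+ d)%:E * (box_vol (q k))%:E)%E.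
  rewrite -EFinM; congr EFin; rewrite /box_vol /q' /aff.
  have -> : s ^+ d = \prod_(i < d) s by rewrite prodr_const card_ord.
  by rewrite -big_split/=; apply: eq_bigr => i _; rewrite !mxE; ring.
apply: (@le_trans _ _ (\sum_(k <oo) (box_vol (q' k))%:E)%E).
  apply: Leb_le; split=> [k i|_ [y /qA[k _ yk] <-]].
    by rewrite /q' /aff !mxE lerD2l ler_pM2l.
  by exists k => // i; rewrite /q' /aff !mxE ltrD2l lerD2l ltr_pM2l// ler_pM2l.
under eq_eseriesr do rewrite vol.
rewrite nneseriesZl; last by move=> k _; rewrite lee_fin box_vol_ge0.
apply: (@le_trans _ _ ((s ^+ d)%:E * (e / s ^+ d)%:E)%E).
  by apply: lee_wpmul2l; [rewrite lee_fin ltW|exact: ltW].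
by rewrite -EFinM mulrC divfK// gt_eqF.
Qed.

Definition cube x s : set V :=
  [set y | forall i, x ord0 i <= y ord0 i <= x ord0 i + s].

(** Phrased through [inner_nbhd], which [suitable] controls; it makes the ball of radius r about the
    point lie in [A] ([deep_ball]). *)
Definition deep r A x : Prop := A x /\ ~ inner_nbhd r A x.

Lemma cube_segment x s y z (t : R) : cube x s y -> cube x s z -> 0 <= t <= 1 ->
  cube x s (y + t *: (z - y)).
Proof.
move=> xy xz /andP[t0 t1] i; rewrite !mxE.
have /andP[] := xy i; have /andP[] := xz i.
set a := y _ _; set b := z _ _; set c := x _ _ => *; apply/andP; split; nra.
Qed.

Lemma cube_base x s : 0 <= s -> cube x s x.
Proof. by move=> s0 i; rewrite lexx lerDl. Qed.

Lemma cube_aff x s y r : 0 < r -> aff x r @` cube y s = cube (aff x r y) (r * s).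
Proof.
move=> r0; have r0' : r != 0 by rewrite gt_eqF.
apply/seteqP; split=> [_ [z yz <-] i|z yz].
  rewrite /aff !mxE -addrA -mulrDr !lerD2l !ler_pM2l//; exact: yz.
rewrite image_aff// => i; have := yz i; rewrite /aff !mxE.
move=> /andP[].
have e : r * (- (r^-1 * x ord0 i) + r^-1 * z ord0 i) = - x ord0 i + z ord0 i by field.
move=> h1 h2; rewrite -(ler_pM2l r0) e -[X in _ && X](ler_pM2l r0) e mulrDr.
by apply/andP; split; lra.
Qed.

Lemma cube_enorm x s y z : (0 < d)%N -> 0 <= s -> cube x s y -> cube x s z ->
  enorm (y - z) <= d%:R * s.
Proof.
move=> d0 s0 xy xz; apply: enorm_le_coord => // i; rewrite !mxE ler_norml.
by have /andP[? ?] := xy i; have /andP[? ?] := xz i; apply/andP; split; lra.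
Qed.

Hypothesis d0 : (0 < d)%N.

(** A cube is convex, so it contains the segment from a point of [A] to a point outside [A]. *)
Lemma cube_frontier A x s : cube x s `&` A !=set0 -> ~ (cube x s `<=` A) ->
  cube x s `&` frontier A !=set0.
Proof.
move=> [y [xy Ay]] /existsNP[z /not_implyP[xz nAz]].
have [t [t01 h]] := frontier_segment d0 Ay nAz.
by exists (y + t *: (z - y)); split=> //; exact: cube_segment.
Qed.

Lemma deep_ball r A x y : deep r A x -> enorm (x - y) < r -> A y.
Proof.
move=> [Ax dx] xy; apply: contrapT => nAy; apply: dx; apply/inner_nbhdP; split=> //.
have [t [/andP[t0 t1] h]] := frontier_segment d0 Ax nAy.
exists (x + t *: (y - x)) => //; apply: le_lt_trans xy.
rewrite opprD addrA subrr add0r enormN enormZ ger0_norm// enormB.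
by rewrite ler_piMl// enorm_ge0.
Qed.

(** Serves to pass from the corner of a cube to the corners of its subcubes, at the price of a
    smaller radius. *)
Lemma deep_shift r r' A x y : 0 < r' -> deep r A x -> enorm (x - y) <= r - r' ->
  deep r' A y.
Proof.
move=> r'0 dx xy; split; first by apply: deep_ball dx _; lra.
move=> /inner_nbhdP[Ay [z Az yz]]; apply: dx.2; apply/inner_nbhdP; split; first exact: dx.1.
by exists z => //; apply: le_lt_trans (ler_enormB x y z) _; lra.
Qed.

Lemma deep_aff r A x s y : 0 < s ->
  deep (s * r) (aff x s @` A) (aff x s y) <-> deep r A y.
Proof. by move=> s0; rewrite /deep inner_nbhd_aff// image_aff_aff// gt_eqF. Qed.

End lebesgue.

(** * Counting lattice cubes *)

Section ncard.
Context {T U : choiceType}.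
Implicit Types (A B : set T).

(** The value is 0 on infinite sets, hence the finiteness statements that accompany every count. *)
Definition ncard {W : choiceType} (A : set W) : nat := size (finmap.enum_fset (fset_set A)).

Lemma ncard_sub A B : finite_set B -> A `<=` B -> (ncard A <= ncard B)%N.
Proof.
move=> fB AB; have fA := sub_finite_set AB fB.
apply: uniq_leq_size; first exact: fset_uniq.
by move=> x; rewrite !in_fset_set// => /set_mem /AB; exact: mem_set.
Qed.

Lemma ncardU A B : finite_set A -> finite_set B ->
  (ncard (A `|` B) <= ncard A + ncard B)%N.
Proof.
move=> fA fB; rewrite /ncard -size_cat; apply: uniq_leq_size; first exact: fset_uniq.
by move=> x; rewrite mem_cat !in_fset_set ?finite_setU// in_setU.

Qed.

Lemma ncard0 : ncard (set0 : set T) = 0%N.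
Proof. by rewrite /ncard fset_set0. Qed.

Lemma ncard_gt0 A x : finite_set A -> A x -> (0 < ncard A)%N.
Proof.
move=> fA Ax; have : x \in finmap.enum_fset (fset_set A) by rewrite in_fset_set// mem_set.
by rewrite /ncard; case: (finmap.enum_fset _).
Qed.

Lemma ncard_image A (f : T -> U) : finite_set A -> injective f ->
  ncard (f @` A) = ncard A.
Proof.
move=> fA fi; rewrite /ncard fset_set_image// card_imfset//.
Qed.

Lemma finite_range (S : finType) (g : S -> T) A : A `<=` range g ->
  finite_set A /\ (ncard A <= #|S|)%N.
Proof.
move=> Ag; have fA : finite_set A.
  by apply: (sub_finite_set Ag); apply: finite_image; exact: finite_finset.
split=> //; rewrite cardE -(size_map g); apply: uniq_leq_size; first exact: fset_uniq.
move=> x; rewrite in_fset_set// => /set_mem /Ag[s _ <-].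
by apply: map_f; rewrite mem_enum.
Qed.

Lemma ncard_ge (S : finType) (Q : pred S) (g : S -> T) A : finite_set A -> injective g ->
  (forall s, Q s -> A (g s)) -> (#|Q| <= ncard A)%N.
Proof.
move=> fA gi gA; rewrite cardE -(size_map g); apply: uniq_leq_size.
  by rewrite map_inj_uniq// enum_uniq.
by move=> x /mapP[s + ->]; rewrite mem_enum in_fset_set// => /gA; exact: mem_set.
Qed.

End ncard.

Lemma ncard_bigU (T : choiceType) n (S : nat -> set T) :
  (forall k, (k < n)%N -> finite_set (S k)) ->
  finite_set (\big[setU/set0]_(k < n) S k) /\
  (ncard (\big[setU/set0]_(k < n) S k) <= \sum_(k < n) ncard (S k))%N.
Proof.
elim: n => [|n IH] fS; first by rewrite !big_ord0 ncard0.
have [|fn IHn] := IH; first by move=> k kn; apply: fS; exact: ltnW.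
rewrite !big_ord_recr/=; split; first by rewrite finite_setU; split=> //; exact: fS.
by apply: leq_trans (ncardU fn (fS _ (ltnSn n))) _; rewrite leq_add2r.
Qed.

(** * Volumes and numbers of lattice cubes *)

Section lattice.
Context {R : realType} {d : nat}.
Local Notation V := 'rV[R]_d.
Local Notation Zd := 'rV[int]_d.
Implicit Types (x y : V) (u : Zd) (A K : set V).

Definition lat (M : nat) u : V := \row_i ((u ord0 i)%:~R / M%:R).

Lemma int_box (a b : 'I_d -> R) : (forall i, a i <= b i) ->
  let S := [set u : Zd | forall i, a i < (u ord0 i)%:~R < b i] in
  finite_set S /\ (ncard S)%:R <= \prod_(i < d) (b i - a i + 1).
Proof.
move=> ab S.
(* The number of integers in []a i, b i[], or 1 instead of 0 when both ends are the same integer. *)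
pose n i := absz (Num.ceil (b i) - Num.floor (a i) - 1)%R.
have nP i : (n i)%:R <= b i - a i + 1.
  rewrite natr_absz intr_norm ler_norml.
  have /andP[a1 a2] := floor_itv (a i); have /andP[b1 b2] := ceil_itv (b i).
  have := ab i; move: a2 b1; rewrite !rmorphB/= rmorphD/= => *; apply/andP; split; lra.
pose g (f : {dffun forall i : 'I_d, 'I_(n i)}) : Zd :=
  \row_i (Num.floor (a i) + 1 + (f i : nat)%:Z).
have Sg : S `<=` range g.
  move=> u Su.
  have h i : (absz (u ord0 i - Num.floor (a i) - 1)%R < n i)%N.
    have /andP[] := Su i.
    rewrite -floor_lt_int -ceil_gt_int /n.
    move: (Num.floor (a i)) (Num.ceil (b i)) (u ord0 i) => A B C.
    by lia.
  exists (finfun (fun i => Ordinal (h i))) => //.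
  apply/rowP => i; rewrite !mxE ffunE/=.
  have /andP[+ _] := Su i; rewrite -floor_lt_int.
  move: (Num.floor (a i)) (u ord0 i) => A C.
  by lia.
have [fS cS] := finite_range Sg; split=> //.
apply: (@le_trans _ _ (\prod_(i < d) (n i)%:R)); last by apply: ler_prod => i _; rewrite ler0n nP.
rewrite -natr_prod ler_nat; apply: leq_trans cS _.
rewrite card_dep_ffun.
by rewrite foldrE big_image/=; under eq_bigr do rewrite card_ord.
Qed.

Lemma lat_cubeP M u y : (0 < M)%N -> cube (lat M u) M%:R^-1 y <->
  forall i, (u ord0 i)%:~R <= M%:R * y ord0 i <= (u ord0 i)%:~R + 1.
Proof.
move=> M0; have M0' : 0 < M%:R :> R by rewrite ltr0n.
have h i : (lat M u ord0 i <= y ord0 i <= lat M u ord0 i + M%:R^-1) =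
    ((u ord0 i)%:~R <= M%:R * y ord0 i <= (u ord0 i)%:~R + 1).
  rewrite mxE -[X in _ <= _ <= _ + X]div1r -mulrDl.
  by rewrite ler_pdivrMr// ler_pdivlMr// [y _ _ * _]mulrC.
by split=> H i; have := H i; rewrite h.
Qed.

Lemma finite_lat_hits M (b : R) A : (0 < M)%N ->
  (forall x, A x -> forall i, `|x ord0 i| <= b) ->
  finite_set [set u : Zd | cube (lat M u) M%:R^-1 `&` A !=set0].
Proof.
move=> M0 Ab.
(* A negative bound leaves no point in [A], except in dimension 0, where the lattice has a single
   point. *)
have [b0|b0] := ltP b 0.
  have [d0|d0] := eqVneq d 0%N.
    apply: (sub_finite_set (B := [set 0])); last exact: finite_set1.
    by move=> u _; apply/rowP => i; have := ltn_ord i; rewrite {2}d0.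
  rewrite (_ : [set _ | _] = set0)//; apply/seteqP; split=> // u [x [_ /Ab xb]].
  have i : 'I_d by case: (d) d0 => // d' _; exact: ord0.
  by have := le_lt_trans (le_trans (normr_ge0 _) (xb i)) b0; rewrite ltxx.
have [|+ _] := @int_box (fun _ => - (M%:R * b) - 2) (fun _ => M%:R * b + 1).
  by move=> i; have : 0 <= M%:R * b by [rewrite mulr_ge0]; lra.
apply: sub_finite_set => u [x [/(lat_cubeP _ _ M0) ux /Ab xb]] i /=.
have : `|M%:R * x ord0 i| <= M%:R * b.
  by rewrite normrM ger0_norm// ler_wpM2l.
rewrite ler_norml => /andP[x1 x2]; have /andP[u1 u2] := ux i.
by apply/andP; split; lra.
Qed.

Lemma cvg_prodD (I : Type) (s : seq I) (l : I -> R) :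
  (fun t : R => \prod_(i <- s) (l i + t)) @ (0 : R) --> \prod_(i <- s) l i.
Proof.
elim: s => [|i s IH].
  by rewrite big_nil; under eq_fun do rewrite big_nil; exact: cvg_cst.
rewrite big_cons; under eq_fun do rewrite big_cons.
apply: cvgM => //; rewrite -[X in _ --> X]addr0.
by apply: cvgD; [exact: cvg_cst|exact: cvg_id].
Qed.

Lemma prodD_lt (l : 'I_d -> R) (e : R) : 0 < e ->
  exists2 t : R, 0 < t & \prod_(i < d) (l i + t) < \prod_(i < d) l i + e.
Proof.
move=> e0; have /cvgrPdist_lt/(_ _ e0) := @cvg_prodD _ (index_enum 'I_d) l.
move=> /nbhs_ballP[t /= t0 h]; exists (t / 2); first by rewrite divr_gt0.
have := h (t / 2); rewrite /ball/= sub0r normrN ger0_norm ?divr_ge0 ?ltW//.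
rewrite ltr_norml => /(_ _)/andP[|+ _]; last by lra.
by rewrite ltr_pdivrMr// mulr_natr mulr2n ltrDl.
Qed.

(** The boxes of a cover are enlarged to open ones, spending at most half of the slack v - w in
    total volume, and finitely many of them cover K. Once 1 / M is small against these enlargements,
    the cubes meeting a box number at most M^d times its enlarged volume. *)
Lemma compact_lat_hits K (v : R) : compact K -> (Leb K < v%:E)%E ->
  exists M0 : nat, forall M, (M0 <= M)%N ->
    (0 < M)%N -> let S := [set u : Zd | cube (lat M u) M%:R^-1 `&` K !=set0] in
    finite_set S /\ (ncard S)%:R < v * M%:R ^+ d.
Proof.
move=> cK /Leb_lt[q [qle qK] qv].
pose vol k := box_vol (q k).
have vol0 k : 0 <= vol k by apply: box_vol_ge0.
have sumle n : (\sum_(k < n) (vol k)%:E <= \sum_(k <oo) (box_vol (q k))%:E)%E.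
  rewrite -(big_mkord xpredT (fun k => (vol k)%:E)).
  by apply: nneseries_lim_ge => k _ _; rewrite lee_fin vol0.
have [w wE] : exists w, (\sum_(k <oo) (box_vol (q k))%:E)%E = w%:E.
  exists (fine (\sum_(k <oo) (box_vol (q k))%:E)%E); rewrite fineK// ge0_fin_numE.
    by apply: lt_trans qv _; rewrite ltry.
  by apply: nneseries_ge0 => k _ _; rewrite lee_fin vol0.
rewrite wE lte_fin in qv.
have {}sumle n : \sum_(k < n) vol k <= w by rewrite -lee_fin -sumEFin -wE.
pose e k := (v - w) / 2 * (2^-1) ^+ k.+1.
have e0 k : 0 < e k by rewrite !mulr_gt0 ?subr_gt0// exprn_gt0.
have sume n : \sum_(k < n) e k <= (v - w) / 2.
  rewrite -mulr_sumr ler_piMr//; first by rewrite divr_ge0// subr_ge0 ltW.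
  have -> : \sum_(k < n) (2^-1 : R) ^+ k.+1 = 1 - (2^-1) ^+ n.
    elim: n => [|n IH]; first by rewrite big_ord0 expr0 subrr.
    rewrite big_ord_recr/= IH exprSr; lra.
  by rewrite gerBl exprn_ge0.
have /choice[t tP] k : exists t : R, 0 < t /\
    \prod_(i < d) ((q k).2 ord0 i - (q k).1 ord0 i + t) < vol k + e k.
  by have [t t0 h] := prodD_lt (fun i => (q k).2 ord0 i - (q k).1 ord0 i) (e0 k); exists t.
(* The open box takes only t k / 4 on each side; the remaining t k / 2 pays for the cubes that stick
   out and for the rounding in [int_box], because M t k >= 8. *)
pose O k : set V := [set y | forall i,
  (q k).1 ord0 i - t k / 4 < y ord0 i < (q k).2 ord0 i + t k / 4].
have oO k : open (O k).
  rewrite openE => y Oy; apply: (@filter_forall _ _ (fun i (z : V) =>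
    (q k).1 ord0 i - t k / 4 < z ord0 i < (q k).2 ord0 i + t k / 4) (nbhs y) _) => i.
  have yi : y ord0 i \in `](q k).1 ord0 i - t k / 4, (q k).2 ord0 i + t k / 4[.
    by rewrite in_itv/=; exact: Oy.
  have h := @coord_continuous R 1 d ord0 i y _ (near_in_itvoo yi).
  apply: (@filterS _ (nbhs y) _ _ _ _ h) => z /=.
  by rewrite in_itv.
have KO : K `<=` cover setT O.
  move=> y /qK[k _ yk]; exists k => // i; have /andP[y1 y2] := yk i.
  have [t0 _] := tP k; have t4 : 0 < t k / 4 by rewrite divr_gt0.
  by apply/andP; split; lra.
have := cK; rewrite compact_cover => /(_ _ setT O (fun k _ => oO k) KO)[D _ KD].
have [n Dn] : exists n, forall k, k \in D -> (k < n)%N.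
  exists (\max_(k <- D) k).+1 => k kD; rewrite ltnS.
  by apply: (@leq_bigmax_seq _ (enum_fset D) xpredT id k).
have [M0 M0P] : exists M0 : nat, forall k, (k < n)%N -> 8 / t k <= M0%:R.
  exists (\max_(k < n) `|Num.ceil (8 / t k)|)%N => k kn.
  apply: (@le_trans _ _ (`|Num.ceil (8 / t k)|%N%:R)).
    rewrite natr_absz ger0_norm ?ceil_ge//.
    by rewrite ceil_ge0 (lt_le_trans (_ : -1 < 0))// divr_ge0// ltW//; exact: (tP k).1.
  by rewrite ler_nat (@leq_bigmax _ (fun k : 'I_n => `|Num.ceil (8 / t k)|%N) (Ordinal kn)).
exists M0 => M M0M Mgt0 S.
have MR : 0 < M%:R :> R by rewrite ltr0n.
pose Sk k := [set u : Zd | forall i,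
  M%:R * ((q k).1 ord0 i - t k / 4) - 1 < (u ord0 i)%:~R <
  M%:R * ((q k).2 ord0 i + t k / 4)].
have SkP k : (k < n)%N -> finite_set (Sk k) /\ (ncard (Sk k))%:R <= M%:R ^+ d * (vol k + e k).
  move=> kn; have [t0 tk] := tP k.
  have Mt : 8 <= M%:R * t k.
    by rewrite -ler_pdivrMr// (le_trans (M0P _ kn))// ler_nat.
  have [|fS cS] := @int_box (fun i => M%:R * ((q k).1 ord0 i - t k / 4) - 1)
    (fun i => M%:R * ((q k).2 ord0 i + t k / 4)).
    move=> i; have : M%:R * (q k).1 ord0 i <= M%:R * (q k).2 ord0 i by rewrite ler_pM2l.
    by lra.
  split=> //; apply: le_trans cS _.
  apply: (@le_trans _ _ (M%:R ^+ d *
      \prod_(i < d) ((q k).2 ord0 i - (q k).1 ord0 i + t k))); last first.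
    by rewrite ler_pM2l ?exprn_gt0// ltW.
  rewrite -[X in X ^+ d]/(M%:R) -[X in _ ^+ X]card_ord -prodr_const -big_split/=.
  apply: ler_prod => i _; have : M%:R * (q k).1 ord0 i <= M%:R * (q k).2 ord0 i by rewrite ler_pM2l.
  by move=> h; apply/andP; split; lra.
have SS : S `<=` \big[setU/set0]_(k < n) Sk k.
  move=> u [y [/(lat_cubeP _ _ Mgt0) uy /KD[k /= kD yk]]].
  rewrite -bigcup_mkord; exists k; first exact: Dn.
  move=> i; have /andP[u1 u2] := uy i; have /andP[y1 y2] := yk i.
  by apply/andP; split; [rewrite ltrBlDr; apply: lt_le_trans u2|apply: le_lt_trans u1 _];
    rewrite ltr_pM2l.
have [fU cU] := @ncard_bigU _ n Sk (fun k kn => (SkP k kn).1).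
split; first exact: sub_finite_set fU.
apply: (@le_lt_trans _ _ (\sum_(k < n) ncard (Sk k))%N%:R).
  by rewrite ler_nat (leq_trans _ cU)// ncard_sub.
rewrite natr_sum; apply: (@le_lt_trans _ _ (\sum_(k < n) M%:R ^+ d * (vol k + e k))).
  by apply: ler_sum => k _; exact: (SkP k (ltn_ord k)).2.
rewrite -mulr_sumr mulrC ltr_pM2r ?exprn_gt0// big_split/=.
by have := sume n; have := sumle n; lra.
Qed.

Lemma closed_cube x (s : R) : closed (cube x s).
Proof.
rewrite (_ : cube x s = \bigcap_(i in [set: 'I_d])
  ((fun y : V => y ord0 i) @^-1` `[x ord0 i, x ord0 i + s])).
  apply: closed_bigI => i _; apply: (continuous_closedP _).1; last exact: itv_closed.
  exact: coord_continuous.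
by apply/seteqP; split=> [y h i _|y h i]; [rewrite /= in_itv/=|have := h i I; rewrite /= in_itv].
Qed.

Lemma bounded_coord A (b : R) : (forall x, A x -> forall i, `|x ord0 i| <= b) -> bounded_set A.
Proof.
move=> Ab; exists (Num.max b 0); split; first exact: num_real.
move=> r br x /Ab xb; rewrite /Num.norm/= mx_normrE; apply: bigmax_le => [|[i j] _].
  by apply: ltW; apply: le_lt_trans br; rewrite le_max lexx orbT.
rewrite ord1/=; apply: le_trans (xb j) _; apply: ltW; apply: le_lt_trans br.
by rewrite le_max lexx.
Qed.

Lemma compact_cube x (s : R) : compact (cube x s).
Proof.
apply: bounded_closed_compact; last exact: closed_cube.
apply: (@bounded_coord _ (enorm x + `|s|)) => y xy i.
have := coord_le_enorm x i; rewrite !ler_norml => /andP[x1 x2].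
have /andP[y1 y2] := xy i; have := ler_norm s; have := normr_ge0 s => *.
by apply/andP; split; lra.
Qed.

Hypothesis d0 : (0 < d)%N.

(** If the outer measure were smaller, [compact_lat_hits] on a finer lattice of mesh 1 / (k M) would
    leave fewer than k^d cubes per element of [U]; but each cube of [U] contains k^d points of the
    finer lattice, different for different elements of [U]. *)
Lemma lat_inner M (U : set Zd) A : (0 < M)%N -> finite_set U ->
  (forall u, U u -> cube (lat M u) M%:R^-1 `<=` A) ->
  (((ncard U)%:R / M%:R ^+ d)%:E <= Leb A)%E.
Proof.
move=> M0 fU UA; rewrite leNgt; apply/negP => LA.
pose K := \big[setU/set0]_(u <- fset_set U) cube (lat M u) M%:R^-1.
have cK : compact K.
  rewrite /K; elim/big_ind: _ => [|B C cB cC|u _]; first exact: compact0.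
    exact: compactU.
  exact: compact_cube.
have KE : K = \bigcup_(u in U) cube (lat M u) M%:R^-1 by rewrite /K bigsetU_fset_set.
have KA : K `<=` A by rewrite KE => y [u /UA]; exact.
have [N NP] := compact_lat_hits cK (le_lt_trans (le_Leb KA) LA).
pose k := N.+1.
have kM0 : (0 < k * M)%N by rewrite muln_gt0.
have [|fS] := NP (k * M)%N _ kM0.
  by rewrite (leq_trans (leqnSn N))// leq_pmulr.
set S := [set u | _] in fS *.
have MR : M%:R != 0 :> R by rewrite pnatr_eq0 -lt0n.
rewrite natrM exprMn mulrCA divfK ?expf_neq0// -natrX -natrM ltr_nat.
apply/negP; rewrite -leqNgt.
pose g (p : fset_set U * {ffun 'I_d -> 'I_k}) : Zd :=
  \row_i (val p.1 ord0 i * k%:Z + (p.2 i : nat)%:Z).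
have gi : injective g.
  move=> [u j] [u' j'] /rowP h.
  have h' i : val u ord0 i = val u' ord0 i /\ j i = j' i.
    have := h i; rewrite !mxE/=.
    move: (val u ord0 i) (val u' ord0 i) => a b e.
    have jk := ltn_ord (j i); have jk' := ltn_ord (j' i).
    have ab : a = b.
      move: (nat_of_ord (j i)) (nat_of_ord (j' i)) jk jk' e => m m' mk mk'; nia.
    split=> //; apply: val_inj => /=; move: e; rewrite ab => /addrI.
    by move=> [].
  congr pair; last by apply/ffunP => i; exact: (h' i).2.
  by apply: val_inj; apply/rowP => i; exact: (h' i).1.
have := ncard_ge (Q := predT) fS gi.
rewrite cardT -cardE card_prod card_ffun !card_ord -cardfE mulnC; apply.
move=> [u j] _; exists (lat (k * M) (g (u, j))); split.
  by apply: cube_base; rewrite invr_ge0.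
rewrite KE; exists (val u).
  by have := valP u; rewrite in_fset_set// => /set_mem.
apply/lat_cubeP => // i; rewrite !mxE/= natrM.
rewrite rmorphD rmorphM/= -!pmulrn.
have kR : k%:R != 0 :> R by rewrite pnatr_eq0.
have e (a b m r : R) : m != 0 -> r != 0 -> m * ((a * r + b) / (r * m)) = a + b / r.
  by move=> m0 r0; field; rewrite m0 r0.
rewrite e//.
rewrite lerDl lerD2l divr_ge0//= ler_pdivrMr ?ltr0n// mul1r ler_nat.
by apply: ltnW.
Qed.

Lemma lat_outer M A : (0 < M)%N ->
  let S := [set u : Zd | cube (lat M u) M%:R^-1 `&` A !=set0] in
  finite_set S -> (Leb A <= ((ncard S)%:R / M%:R ^+ d)%:E)%E.
Proof.
move=> M0 S fS.
have MR : 0 < M%:R :> R by rewrite ltr0n.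
have sz : size (enum_fset (fset_set S)) = ncard S by [].
pose bx u : V * V := (lat M u, \row_i (lat M u ord0 i + M%:R^-1)).
(* The finite cover is continued by the degenerate box at 0, of volume 0 as d > 0. *)
pose q (k : nat) : V * V := nth (0, 0) [seq bx u | u <- enum_fset (fset_set S)] k.
have qS k : (ncard S <= k)%N -> q k = (0, 0).
  by move=> kS; rewrite /q nth_default// size_map sz.
have qs k : (k < ncard S)%N -> exists u, q k = bx u.
  move=> kS; rewrite /q; exists (nth 0 (enum_fset (fset_set S)) k).
  by rewrite (nth_map 0)// sz.
have volq k : box_vol (q k) = if (k < ncard S)%N then M%:R ^- d else 0.
  case: ltnP => [/qs[u ->]|/qS ->].
    rewrite /box_vol /= (eq_bigr (fun _ => M%:R^-1)) ?prodr_const ?card_ord ?exprVn//.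
    by move=> i _; rewrite mxE addrAC subrr add0r.
  rewrite /box_vol (eq_bigr (fun _ => 0)).
    by rewrite prodr_const card_ord expr0n gtn_eqF.
  by move=> i _; rewrite /= subrr.
have qle k i : (q k).1 ord0 i <= (q k).2 ord0 i.
  have [/qs[u ->]|/qS -> //] := ltnP k (ncard S).
  by rewrite /= mxE lerDl invr_ge0 ltW.
apply: (@le_trans _ _ (\sum_(k <oo) (box_vol (q k))%:E)%E).
  apply: Leb_le; split=> // x Ax.
  (* Boxes are open on the left, hence the ceiling minus one and not the floor. *)
  pose u : Zd := \row_i (Num.ceil (M%:R * x ord0 i) - 1).
  have xb i : (u ord0 i)%:~R < M%:R * x ord0 i <= (u ord0 i)%:~R + 1.
    rewrite mxE; have /andP[h1 h2] := ceil_itv (M%:R * x ord0 i).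
    by rewrite h1/= -[X in _ + X]/((1 : int)%:~R) -rmorphD/= subrK.
  have Su : u \in fset_set S.
    rewrite in_fset_set//; apply: mem_set; exists x; split=> //.
    by apply/lat_cubeP => // i; have /andP[h1 h2] := xb i; rewrite ltW.
  exists (index u (enum_fset (fset_set S))) => // i.
  have -> : q (index u (enum_fset (fset_set S))) = bx u.
    by rewrite /q (nth_map 0) ?index_mem// nth_index.
  rewrite /bx /= mxE -[X in _ < _ <= _ + X]div1r.
  rewrite [X in _ < _ <= X + _]mxE [X in X < _]mxE -mulrDl.
  by rewrite ltr_pdivrMr// ler_pdivlMr// [x _ _ * _]mulrC; exact: xb.
rewrite (nneseries_split 0 (ncard S)); last by move=> k _; rewrite lee_fin box_vol_ge0.
rewrite add0n eseries0 ?adde0; last first.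
  by move=> k kS _; rewrite volq ltnNge kS.
rewrite big_mkord (eq_bigr (fun _ => (M%:R ^- d)%:E)); last first.
  by move=> k _; rewrite volq ltn_ord.
by rewrite sumEFin sumr_const card_ord lee_fin mulr_natl lexx.
Qed.

End lattice.

(** * Invariant families of sets *)

Section families.
Context {R : realType} {d : nat} (d0 : (0 < d)%N).
Local Notation V := 'rV[R]_d.
Local Notation gset := (gset R d).
Context {F : set (set gset)} (hF : suitable F).
Local Notation GF := (g_sigma_algebraType F).
Context (mu : {measure set GF -> \bar R}).
Hypotheses (mu_translation : translation_invariant mu)
  (mu_scale : semi_scale_invariant mu) (h1 : locally_finite_hits mu).
Implicit Types (x y : V) (s r : R) (D : set GF) (G : gset).

Definition afam x s D : set GF := [set L | exists2 G, D G & sval L = aff x s @` sval G].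

Lemma afamE x s D D' : 0 < s ->
  (forall G L : gset, sval L = aff x s @` sval G -> (D G <-> D' L)) ->
  (forall L, D' L -> (diam (sval L) < s%:E)%E) -> afam x s D = D'.
Proof.
move=> s0 DD' D's; have s0' : s != 0 by rewrite gt_eqF.
apply/seteqP; split=> [L [G DG e]|L D'L]; first exact/(DD' _ _ e).
have LE : sval L = aff x s @` (aff (- (s^-1 *: x)) s^-1 @` sval L).
  rewrite image_comp; apply/seteqP; split=> [y Ly|_ [y Ly <-]].
    by exists y => //=; rewrite affVK.
  by rewrite /= affVK.
have h : (diam (aff (- (s^-1 *: x)) s^-1 @` sval L) < 1)%E.
  have := D's _ D'L; rewrite {1}LE diam_aff// -[X in (_ < X)%E -> _]mule1.
  by rewrite lte_pmul2l// lte_fin.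
by exists (exist (fun A => (diam A < 1)%E) _ h) => //; exact/(DD' _ L).
Qed.

(** Contractions keep all diameters below 1, which is the condition in semi scale invariance. *)
Lemma afam_measure x s D : 0 < s -> s <= 1 -> finite_mass mu D ->
  finite_mass mu (afam x s D) /\ mu (afam x s D) = mu D.
Proof.
move=> s0 s1 [mD fD]; have s0' : s != 0 by rewrite gt_eqF.
have dE : dilate_gset s D = afam 0 s D.
  apply/seteqP; split=> L [G DG e]; exists G => //.
    rewrite -e image_comp; apply/seteqP; split=> [y Ly|_ [y Ly <-]].
      by exists y => //=; rewrite /aff add0r scalerA mulfV// scale1r.
    by rewrite /= /aff add0r scalerA mulfV// scale1r.
  rewrite e image_comp; apply/seteqP; split=> [_ [y Ly <-]|y Gy].
    by rewrite /= /aff add0r scalerA mulVf// scale1r.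
  by exists y => //=; rewrite /aff add0r scalerA mulVf// scale1r.
have sf : small_family s D.
  move=> L [G DG e].
  have LE : L = aff 0 s @` sval G.
    rewrite -e image_comp; apply/seteqP; split=> [y Ly|_ [y Ly <-]].
      by exists y => //=; rewrite /aff add0r scalerA mulfV// scale1r.
    by rewrite /= /aff add0r scalerA mulfV// scale1r.
  rewrite LE diam_aff//; apply: (@le_lt_trans _ _ (1%:E * diam (sval G))%E).
    by apply: lee_wpmul2r; rewrite ?diam_ge0// lee_fin.
  by rewrite mul1e; exact: (svalP G).
have tE : afam x s D = translate x (afam 0 s D).
  apply/seteqP; split=> [L [G DG e]|L [G [H DH e'] e]].
    have h : (diam (aff 0 s @` sval G) < 1)%E.
      apply: sf; exists G => //.
      rewrite image_comp; apply/seteqP; split=> [_ [y Ly <-]|y Gy].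
        by rewrite /= /aff add0r scalerA mulVf// scale1r.
      by exists y => //=; rewrite /aff add0r scalerA mulVf// scale1r.
    exists (exist (fun A => (diam A < 1)%E) _ h); first by exists G.
    by rewrite e /= image_comp; apply: eq_imagel => y _; rewrite /= /aff add0r.
  exists H => //; rewrite e e' image_comp.
  by apply: eq_imagel => y _; rewrite /= /aff add0r.
have m1 : measurable (afam 0 s D) by rewrite -dE; exact: (suitable_dilate hF).
have e1 : mu (afam 0 s D) = mu D by rewrite -dE; exact: mu_scale.
have e2 : mu (afam x s D) = mu D by rewrite tE mu_translation.
split=> //; split; last by rewrite e2.
by rewrite tE; exact: (suitable_translate hF).
Qed.

Lemma borel_closed (A : set V) : closed A -> borel_set A.
Proof.
move=> cA; rewrite -(setCK A).
have [_ sC _] := smallest_sigma_algebra [set: V] [set U : set V | open U].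
by rewrite -setTD; apply: sC; apply: sub_gen_smallest; exact: closed_openC.
Qed.

Definition hitr (A : set V) (a b : R) : set GF :=
  [set G | sval G `&` A !=set0 /\ (a%:E <= diam (sval G) < b%:E)%E].

Lemma hitr_finite (A : set V) a b : closed A -> bounded_set A -> 0 < a -> 0 < b ->
  finite_mass mu (hitr A a b).
Proof.
move=> cA bA a0 b0.
have m t : 0 < t -> measurable (hits A t : set GF).
  by move=> t0; apply: (suitable_hits hF) => //; exact: borel_closed.
have -> : hitr A a b = hits A a `\` hits A b.
  apply/seteqP; split=> G /=.
    by move=> [GA /andP[Ga Gb]]; split=> // -[_]; rewrite leNgt Gb.
  move=> [[GA Ga] nb]; split=> //; rewrite Ga ltNge; apply/negP => h.
  by apply: nb.
by apply: finite_massD; [exact: m|split; [exact: m|apply: h1 => //; exact: m]].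
Qed.

Lemma closed_set1 x : closed [set x].
Proof.
rewrite (_ : [set x] = cube x 0); first exact: closed_cube.
apply/seteqP; split=> [_ -> i|y h]; first by rewrite addr0 lexx.
by apply/rowP => i; have := h i; rewrite addr0 => /le_anti.
Qed.

Lemma bounded_set1 x : bounded_set [set x].
Proof. by apply: (@bounded_coord _ _ _ (enorm x)) => _ -> i; exact: coord_le_enorm. Qed.

Lemma cube_bounded x s : bounded_set (cube x s).
Proof. by apply: compact_bounded; exact: compact_cube. Qed.

Lemma measurable_pos_volume : measurable (pos_volume : set GF).
Proof.
rewrite (_ : pos_volume = setT `&` (fun G : GF => Leb (sval G)) @^-1` `]0%E, +oo[%classic).
  by apply: (suitable_Leb hF) => //; exact: emeasurable_itv.
rewrite setTI; apply/seteqP; split=> G /=; rewrite in_itv/=.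
  by move=> ->.
by move=> /andP[].
Qed.

Definition expsize n : R := (2^-1) ^+ n.

Lemma expsize_gt0 n : 0 < expsize n. Proof. by rewrite exprn_gt0. Qed.

Lemma expsize_le1 n : expsize n <= 1.
Proof. by rewrite exprn_ile1// ?invr_ge0// invf_le1// ler1n. Qed.

Definition hit x s n : set GF := hitr (cube x s) (expsize n.+1) (expsize n).

Lemma hit_finite x s n : finite_mass mu (hit x s n).
Proof.
by apply: hitr_finite; [exact: closed_cube|exact: cube_bounded|exact: expsize_gt0..].
Qed.

Lemma shell_aff (n m : nat) x (G L : gset) : sval L = aff x (expsize n) @` sval G ->
  ((expsize m.+1)%:E <= diam (sval G) < (expsize m)%:E)%E =
  ((expsize (n + m).+1)%:E <= diam (sval L) < (expsize (n + m))%:E)%E.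
Proof.
move=> ->; have s0 := expsize_gt0 n; rewrite diam_aff// -addnS /expsize !exprD !EFinM.
by rewrite lte_pmul2l ?lee_pmul2l// lte_fin.
Qed.

Lemma hit_scale x s n : mu (hit x (expsize n * s) n) = mu (hit 0 s 0).
Proof.
have s0 := expsize_gt0 n.
have [_ <-] := @afam_measure x (expsize n) (hit 0 s 0) s0 (expsize_le1 n) (hit_finite 0 s 0).
congr (mu _); apply/esym; apply: afamE => // [G L e|L [_ /andP[]]//].
rewrite /hit /hitr /= (shell_aff 0 e) addn0 e.
have -> : cube x (expsize n * s) = aff x (expsize n) @` cube 0 s.
  by rewrite cube_aff// /aff scaler0 addr0.
split=> -[[y [Gy Cy]] ->]; split=> //.
  by exists (aff x (expsize n) y); split; [exists y|exists y].
case: Gy Cy => z Gz zy [z' Cz' z'y].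
exists z; split=> //; rewrite (@aff_inj R d x (expsize n) _ z z') ?gt_eqF//.
by rewrite zy z'y.
Qed.

(** Within one dyadic range of diameters, [full] gathers the sets that contain x, [rim] those with
    moreover a frontier point within r of x, and [core] the rest, which contain the ball of radius r
    about x. Positive volume is required so that volume ratios make sense. *)
Definition core x r n : set GF :=
  [set G | [/\ deep r (sval G) x,
    ((expsize n.+1)%:E <= diam (sval G) < (expsize n)%:E)%E & pos_volume G]].

Definition rim x r n : set GF :=
  [set G | [/\ inner_nbhd r (sval G) x,
    ((expsize n.+1)%:E <= diam (sval G) < (expsize n)%:E)%E & pos_volume G]].

Definition full x n : set GF :=
  [set G | [/\ sval G x,
    ((expsize n.+1)%:E <= diam (sval G) < (expsize n)%:E)%E & pos_volume G]].

Lemma full_finite x n : finite_mass mu (full x n).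
Proof.
have fh := @hitr_finite [set x] (expsize n.+1) (expsize n) (@closed_set1 x)
  (@bounded_set1 x) (expsize_gt0 _) (expsize_gt0 _).
apply: finite_massS (fh); last first.
  by move=> G [Gx hG _]; split=> //; exists x.
rewrite (_ : full x n = hitr [set x] (expsize n.+1) (expsize n) `&` pos_volume).
  by apply: measurableI; [exact: fh.1|exact: measurable_pos_volume].
apply/seteqP; split=> [G [Gx hG pG]|G [[[y [Gy /= yx]] hG] pG]].
  by split=> //; split=> //; exists x.
by split=> //; rewrite -yx.
Qed.

Lemma measurable_inner x r : 0 < r ->
  measurable ([set G : gset | inner_nbhd r (sval G) x] : set GF).
Proof.
move=> r0.
rewrite (_ : [set G | _] = translate x [set G : gset | inner_nbhd r (sval G) 0]).
  by apply: (suitable_translate hF); exact: (suitable_inner hF).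
have aE G : [set x + y | y in sval G] = aff x 1 @` sval G.
  by apply: eq_imagel => y _; rewrite /aff scale1r.
apply/seteqP; split=> [L Lx|L [G G0 e]]; last first.
  have := (@inner_nbhd_aff R d d0 r (sval G) x 1 0 ltr01).2 G0.
  by rewrite mul1r /aff scaler0 addr0 /= e aE.
have LE : sval L = aff x 1 @` (aff (- x) 1 @` sval L).
  rewrite image_comp; apply/seteqP; split=> [y Ly|_ [y Ly <-]].
    by exists y => //=; rewrite /aff !scale1r addNKr.
  by rewrite /= /aff !scale1r addNKr.
have h : (diam (aff (- x) 1 @` sval L) < 1)%E.
  by rewrite diam_aff// mul1e; exact: (svalP L).
exists (exist (fun A => (diam A < 1)%E) _ h); last by rewrite aE.
have := (@inner_nbhd_aff R d d0 r (aff (- x) 1 @` sval L) x 1 0 ltr01).1.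
by apply; rewrite mul1r /aff scaler0 addr0 -LE.
Qed.

Lemma rim_finite x r n : 0 < r -> finite_mass mu (rim x r n).
Proof.
move=> r0; apply: finite_massS (full_finite x n); last first.
  by move=> G [[Gx _] hG pG].
rewrite (_ : rim x r n = full x n `&` [set G : gset | inner_nbhd r (sval G) x]).
  by apply: measurableI; [exact: (full_finite x n).1|exact: measurable_inner].
by apply/seteqP; split=> [G [[Gx h] hG pG]|G [[Gx hG pG] h]].
Qed.

Lemma core_fullD x r n : core x r n = full x n `\` rim x r n.
Proof.
apply/seteqP; split=> [G [[Gx h] hG pG]|G [[Gx hG pG] h]].
  by split=> // -[].
by split=> //; split=> // h'; apply: h.
Qed.

Lemma core_finite x r n : 0 < r -> finite_mass mu (core x r n).
Proof.
move=> r0; rewrite core_fullD; apply: finite_massD (full_finite x n).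
exact: (rim_finite x n r0).1.
Qed.

Lemma pos_volume_aff x s (G L : gset) : 0 < s -> sval L = aff x s @` sval G ->
  pos_volume G <-> pos_volume L.
Proof.
move=> s0 e; rewrite /pos_volume /= e; split; last exact: Leb_aff_gt0.
move=> G0; apply: (@Leb_aff_gt0 _ _ _ (- (s^-1 *: x)) s^-1); first by rewrite invr_gt0.
rewrite image_comp (_ : (_ \o _) @` sval G = sval G)//.
apply/seteqP; split=> [_ [y Gy <-]|y Gy]; first by rewrite /= affK// gt_eqF.
by exists y => //=; rewrite affK// gt_eqF.
Qed.

Lemma core_scale x r n : 0 < r -> mu (core x (expsize n * r) n) = mu (core 0 r 0).
Proof.
move=> r0; have s0 := expsize_gt0 n.
have [_ <-] := @afam_measure x (expsize n) (core 0 r 0) s0 (expsize_le1 n) (core_finite 0 0 r0).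
congr (mu _); apply/esym; apply: afamE => // [G L e|L [_ /andP[]]//].
rewrite /core /= (shell_aff 0 e) addn0.
have := @deep_aff R d d0 r (sval G) x (expsize n) 0 s0.
rewrite -e /aff scaler0 addr0 => dE; have pE := pos_volume_aff s0 e.
by split=> -[]; [move=> /dE ? ? /pE ?|move=> /dE ? ? /pE ?].
Qed.

Lemma full_scale x n : mu (full x n) = mu (full 0 0).
Proof.
have s0 := expsize_gt0 n.
have [_ <-] := @afam_measure x (expsize n) (full 0 0) s0 (expsize_le1 n) (full_finite 0 0).
congr (mu _); apply/esym; apply: afamE => // [G L e|L [_ /andP[]]//].
rewrite /full /= (shell_aff 0 e) addn0.
have := @image_aff_aff R d x (expsize n) (sval G) 0 (lt0r_neq0 s0).
rewrite -e /aff scaler0 addr0 => dE; have pE := pos_volume_aff s0 e.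
by rewrite dE; split=> -[? ? /pE ?].
Qed.

(** The constant c of the threshold; [rim_mass] and [hit_mass] measure the errors for covering and
    for survival. *)
Definition mass : R := fine (mu (full 0 0)).
Definition rim_mass r : R := fine (mu (rim 0 r 0)).
Definition hit_mass s : R := fine (mu (hit 0 s 0)).

Lemma core_mass r : 0 < r -> fine (mu (core 0 r 0)) = mass - rim_mass r.
Proof.
move=> r0; have [mr fr] := rim_finite 0 0 r0; have [mf ff] := full_finite 0 0.
rewrite core_fullD measureD// setIidr; last by move=> G [[]].
by rewrite fineB// ge0_fin_numE.
Qed.

End families.

(** Measurability does not enter, the integral of a nonnegative function being a supremum over
    simple functions below it. This form applies to the inner integral of [boundary_integral] as a
    function of G. *)
Lemma le_ge0_integral d (T : measurableType d) (R : realType)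
    (mu : {measure set T -> \bar R}) (D : set T) (f g : T -> \bar R) :
  (forall x, D x -> (0 <= f x)%E) -> (forall x, D x -> (f x <= g x)%E) ->
  (\int[mu]_(x in D) f x <= \int[mu]_(x in D) g x)%E.
Proof.
move=> f0 fg; have g0 x : D x -> (0 <= g x)%E by move=> Dx; apply: le_trans (fg x Dx); exact: f0.
rewrite !ge0_integralE//; apply: ereal_sup_le => _ [h hf <-]; exists h => // x.
apply: le_trans (hf x) _; rewrite /patch; case: ifPn => // /set_mem; exact: fg.
Qed.

Lemma bounded_cvg0 d (T : measurableType d) (R : realType)
    (mu : {measure set T -> \bar R}) (H : set T) (f : nat -> T -> R) :
  measurable H -> (mu H < +oo)%E -> (forall n, measurable_fun H (f n)) ->
  (forall n x, H x -> 0 <= f n x <= 1) ->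
  {ae mu, forall x, H x -> forall e : R, 0 < e ->
    exists N, forall n, (N <= n)%N -> f n x <= e} ->
  forall e : R, 0 < e -> exists N, forall n, (N <= n)%N ->
    (\int[mu]_(x in H) (f n x)%:E <= e%:E)%E.
Proof.
move=> mH fH mf f01 fae e e0.
have [] := @dominated_convergence _ _ _ mu H mH (fun n x => (f n x)%:E) (cst 0%E) (cst 1%E).
- by move=> n; apply/measurable_EFinP.
- exact: measurable_cst.
- move: fae => [N [mN N0 Nf]]; exists N; split=> // x nx; apply: Nf => /= hx; apply: nx => Hx.
  apply: cvg_EFin; first exact: nearW.
  apply/cvgrPdist_lt => t t0.
  have [n0 n0P] := hx Hx _ (divr_gt0 t0 (ltr0Sn R 1)).
  exists n0 => // n /= n0n; rewrite sub0r normrN ger0_norm.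
    by apply: le_lt_trans (n0P _ n0n) _; rewrite ltr_pdivrMr// ltr_pMr// ltr1n.
  by have /andP[] := f01 n x Hx.
- apply/integrableP; split; first exact: measurable_cst.
  under eq_integral do rewrite abse1.
  by rewrite integral_cst// mul1e.
- apply: aeW => x n Hx /=; have /andP[? ?] := f01 n x Hx.
  by rewrite lee_fin ger0_norm.
move=> _ _; rewrite integral0 => /(_ [set x | (x < e%:E)%E]) [].
  apply: open_nbhs_nbhs; split; first exact: open_ereal_lt_ereal.
  by rewrite /= lte_fin.
by move=> N _ NP; exists N => n /NP /ltW.
Qed.

(** * Hitting a small cube *)

Section limits.
Context {R : realType} {d : nat} (d0 : (0 < d)%N).
Local Notation V := 'rV[R]_d.
Local Notation gset := (gset R d).
Context {F : set (set gset)} (hF : suitable F).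
Local Notation GF := (g_sigma_algebraType F).
Context (mu : {measure set GF -> \bar R}).
Hypotheses (mu_translation : translation_invariant mu)
  (mu_scale : semi_scale_invariant mu) (h1 : locally_finite_hits mu)
  (h2 : mu pos_boundary = 0%E).
Implicit Types (x y : V) (s r : R) (D : set GF) (G : gset).

Lemma ae_null_frontier (H : set GF) (Q : GF -> Prop) :
  (forall G, H G -> Leb (frontier (sval G)) = 0%E -> Q G) ->
  {ae mu, forall G, H G -> Q G}.
Proof.
move=> HQ; exists pos_boundary; split; [exact: (suitable_pos_boundary hF)|exact: h2|].
move=> G /= nG; rewrite /pos_boundary /= lt0e Leb_ge0 andbT; apply/eqP => LG.
by apply: nG => HG; exact: HQ.
Qed.

Lemma gset_coord G x y i : sval G x -> sval G y -> `|y ord0 i - x ord0 i| <= 1.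
Proof.
move=> Gx Gy; rewrite -lee_fin; apply: le_trans (ltW (svalP G)).
apply: le_trans (le_diam Gy Gx); rewrite lee_fin.
by have := coord_le_enorm (y - x) i; rewrite !mxE.
Qed.

Lemma compact_frontier G : compact (frontier (sval G)).
Proof.
have [G0|/set0P[x Gx]] := eqVneq (sval G) set0.
  rewrite G0 (_ : frontier set0 = set0); first exact: compact0.
  by rewrite /frontier closure0 set0D.
apply: bounded_closed_compact.
  apply: (@bounded_coord _ _ _ (enorm x + 2)) => y /(frontier_enorm _ _ d0) h i.
  have [[z Gz yz] _] := h 1 ltr01.
  have h1' := gset_coord i Gx Gz.
  have h2' := coord_le_enorm (y - z) i; have h3' := coord_le_enorm x i.
  rewrite !mxE in h2'.
  move: h1' h2' h3'; rewrite !ler_norml => /andP[? ?] /andP[? ?] /andP[? ?].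
  by apply/andP; split; lra.
rewrite /frontier setDE; apply: closedI; first exact: closed_closure.
by apply: open_closedC; exact: open_interior.
Qed.

Lemma few_boundary_cubes G (e : R) : Leb (frontier (sval G)) = 0%E -> 0 < e ->
  exists N, forall M, (N <= M)%N -> (0 < M)%N ->
  let S := [set u | cube (lat M u) M%:R^-1 `&` frontier (sval G) !=set0] in
  finite_set S /\ (ncard S)%:R < e * M%:R ^+ d.
Proof.
by move=> LG e0; apply: compact_lat_hits; [exact: compact_frontier|rewrite LG lte_fin].
Qed.

Lemma cube_pos_volume G M u : (0 < M)%N -> cube (lat M u) M%:R^-1 `<=` sval G ->
  pos_volume G.
Proof.
move=> M0 uG.
have h v : [set u] v -> cube (lat M v) M%:R^-1 `<=` sval G by move=> ->.
apply: lt_le_trans (lat_inner d0 M0 (finite_set1 u) h).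
rewrite lte_fin divr_gt0 ?exprn_gt0 ?ltr0n//.
by apply: (@ncard_gt0 _ _ u) => //; exact: finite_set1.
Qed.

Definition ivec M (f : {ffun 'I_d -> 'I_M}) : 'rV[int]_d := \row_i (f i : nat)%:Z.

Lemma ivec_inj M : injective (@ivec M).
Proof.
move=> f g /rowP h; apply/ffunP => i; apply: val_inj; have := h i; rewrite !mxE.
by move=> [].
Qed.

(** The unit cube is cut into M^d cubes. By invariance the excess [hit_mass] - [mass] is the same
    for each, hence equals the integral of the proportion of cubes that G hits without being in
    [full] of their corner. Such a cube meets the frontier of G, as otherwise G would contain the
    cube, hence its corner, and have positive volume. The frontier is null for almost every G, so
    the proportion tends to 0. *)
Lemma hit_mass_cvg (e : R) : 0 < e -> exists N, forall M, (N <= M)%N -> (0 < M)%N ->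
  hit_mass mu M%:R^-1 <= mass mu + e.
Proof.
move=> e0.
pose H : set GF := hit 0 1 0.
have [mH fH] : finite_mass mu H by exact: (hit_finite hF h1).
pose Z M (f : {ffun 'I_d -> 'I_M}) : set GF :=
  hit (lat M (ivec f)) M%:R^-1 0 `\` full (lat M (ivec f)) 0.
have fullhit M x : (full x 0 : set GF) `<=` hit x M%:R^-1 0.
  by move=> G [Gx hG _]; split=> //; exists x; split=> //; apply: cube_base; rewrite invr_ge0.
have fZ M f : finite_mass mu (@Z M f).
  apply: finite_massD; last exact: (hit_finite hF h1).
  exact: (full_finite hF h1 _ _).1.
have muZ M f : (0 < M)%N -> mu (@Z M f) = (hit_mass mu M%:R^-1 - mass mu)%:E.
  move=> M0; have [m1 f1] := full_finite hF h1 (lat M (ivec f)) 0.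
  have [m2 f2] := hit_finite hF h1 (lat M (ivec f)) M%:R^-1 0.
  rewrite measureD// setIidr; last exact: fullhit.
  rewrite EFinB /hit_mass /mass !fineK ?ge0_fin_numE//.
  - rewrite -(full_scale hF mu_translation mu_scale h1 (lat M (ivec f)) 0).
    rewrite -(hit_scale hF mu_translation mu_scale h1 (lat M (ivec f)) _ 0).
    by rewrite /expsize expr0 mul1r.
  - exact: (full_finite hF h1 _ _).2.
  - exact: (hit_finite hF h1 _ _ _).2.
have ZH M f : (0 < M)%N -> @Z M f `<=` H.
  move=> M0 G [[[y [Gy uy]] hG] _]; split=> //; exists y; split=> // i.
  have := (lat_cubeP _ _ M0).1 uy i; rewrite !mxE => /andP[y1 y2].
  have MR : 0 < M%:R :> R by rewrite ltr0n.
  rewrite add0r -(ler_pM2l MR) mulr0 -[X in _ && X](ler_pM2l MR) mulr1.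
  rewrite (le_trans _ y1)/=; last by rewrite ler0z.
  apply: le_trans y2 _; rewrite -[X in _ + X]/((1 : int)%:~R) -rmorphD/=.
  by rewrite -pmulrn ler_nat addn1 ltn_ord.
pose g M (G : GF) : R := M%:R ^- d * \sum_f \1_(@Z M f) G.
have gE M G : g M G = M%:R ^- d * #|[pred f | `[< @Z M f G >]]|%:R.
  congr (_ * _); rewrite -sum1_card natr_sum [RHS]big_mkcond/=; apply: eq_bigr => f _.
  rewrite indicE inE; case: asboolP => h; first by rewrite mem_set.
  by rewrite memNset.
have mg M : measurable_fun H (g M).
  apply: measurable_funM; first exact: measurable_cst.
  by apply: measurable_sum => f; apply: measurable_indic; exact: (fZ M f).1.
have intg M : (0 < M)%N ->
    (\int[mu]_(G in H) (g M G)%:E)%E = (hit_mass mu M%:R^-1 - mass mu)%:E.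
  move=> M0; have MR : 0 < M%:R :> R by rewrite ltr0n.
  under eq_integral do rewrite /g EFinM -sumEFin.
  rewrite ge0_integralZl_EFin; last 4 first.
  - exact: mH.
  - by move=> G _; apply: sume_ge0 => f _; rewrite lee_fin.
  - apply: emeasurable_sum => f; apply/measurable_EFinP.
    by apply: measurable_indic; exact: (fZ M f).1.
  - by rewrite invr_ge0 exprn_ge0.
  rewrite ge0_integral_sum//; last first.
    move=> f; apply/measurable_EFinP.
    by apply: measurable_indic; exact: (fZ M f).1.
  rewrite (eq_bigr (fun _ => (hit_mass mu M%:R^-1 - mass mu)%:E)); last first.
    move=> f _; rewrite integral_indic//; last exact: (fZ M f).1.
    by rewrite setIidl ?muZ//; exact: ZH.
  rewrite sumEFin sumr_const card_ffun !card_ord -EFinM; congr EFin.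
  by rewrite -[X in _ * X]mulr_natr natrX mulrCA mulVf ?mulr1// expf_neq0// gt_eqF.
have g01 M G : (0 < M)%N -> 0 <= g M G <= 1.
  move=> M0; have MR : 0 < M%:R ^+ d :> R by rewrite exprn_gt0// ltr0n.
  rewrite gE; apply/andP; split; first by rewrite mulr_ge0// invr_ge0 ltW.
  rewrite ler_pdivrMl// mulr1 -natrX ler_nat.
  by have := max_card [pred f | `[< @Z M f G >]]; rewrite card_ffun !card_ord.
have [|N NP] := @bounded_cvg0 _ _ _ mu H (fun n => g n.+1) mH fH (fun n => mg n.+1)
    (fun n G _ => g01 n.+1 G isT) _ _ e0; last first.
  exists N.+1 => -[|M]// NM _; rewrite addrC -lerBlDr -lee_fin -intg//.
  exact: NP.
apply: ae_null_frontier => G _ LG t t0.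
have [N NP] := few_boundary_cubes LG t0; exists N => M NM.
have [fS cS] := NP M.+1 (leq_trans NM (leqnSn M)) isT.
rewrite gE ler_pdivrMl ?exprn_gt0// mulrC; apply: le_trans (ltW cS).
rewrite ler_nat; apply: (ncard_ge fS (@ivec_inj M.+1)) => f /= /asboolP[[[y [Gy uy]] hG] nf].
apply: (cube_frontier d0); first by exists y.
move=> uG; apply: nf; split=> //; last exact: cube_pos_volume uG.
by apply: uG; apply: cube_base; rewrite invr_ge0.
Qed.

End limits.

(** * Mass transport *)

Lemma ncard_sum (R : realType) (T : choiceType) (W S : set T) : finite_set W -> S `<=` W ->
  (ncard S)%:R = \sum_(u <- fset_set W) \1_S u :> R.
Proof.
move=> fW SW; have fS := sub_finite_set SW fW.
rewrite (eq_bigr (fun u => if u \in S then 1 else 0 : R)); last first.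
  by move=> u _; rewrite indicE; case: (u \in S).
rewrite -big_mkcond/= -[in RHS](natr_sum _ _ _ (fun=> 1%N)) sum1_count -size_filter.
congr _%:R; apply/perm_size/uniq_perm; rewrite ?filter_uniq ?fset_uniq// => u.
rewrite mem_filter !in_fset_set//; apply/idP/andP => [uS|[]//].
by split=> //; move/set_mem: uS => /SW /mem_set.
Qed.

Section transport.
Context {R : realType} {d : nat} (d0 : (0 < d)%N).
Local Notation V := 'rV[R]_d.
Local Notation gset := (gset R d).
Local Notation Zd := 'rV[int]_d.
Context {F : set (set gset)} (hF : suitable F).
Local Notation GF := (g_sigma_algebraType F).
Context (mu : {measure set GF -> \bar R}).
Hypotheses (mu_translation : translation_invariant mu)
  (mu_scale : semi_scale_invariant mu) (h1 : locally_finite_hits mu)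
  (h2 : mu pos_boundary = 0%E).
Local Notation fullF := (@full R d F).
Local Notation rimF := (@rim R d F).
Implicit Types (x y : V) (s r : R) (D : set GF) (G : gset).

(** The lattice substitute for M^d times the volume of [A]. *)
Definition cnt M (A : set V) : nat := ncard [set u : Zd | A (lat M u)].

Lemma finite_lat_gset M G : (0 < M)%N ->
  finite_set [set u : Zd | cube (lat M u) M%:R^-1 `&` sval G !=set0].
Proof.
move=> M0; have [G0|/set0P[x Gx]] := eqVneq (sval G) set0.
  rewrite (_ : [set _ | _] = set0)//.
  by apply/seteqP; split=> // u; rewrite /= G0 setI0 => -[].
apply: (@finite_lat_hits _ _ M (enorm x + 1)) => // y Gy i.
have := gset_coord i Gx Gy; have := coord_le_enorm x i.
rewrite !ler_norml => /andP[? ?] /andP[? ?]; apply/andP; split; lra.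
Qed.

Lemma cnt_sub_hits M (A : set V) :
  [set u : Zd | A (lat M u)] `<=` [set u : Zd | cube (lat M u) M%:R^-1 `&` A !=set0].
Proof. by move=> u Au; exists (lat M u); split=> //; apply: cube_base; rewrite invr_ge0. Qed.

Lemma finite_cnt M G (A : set V) : (0 < M)%N -> A `<=` sval G ->
  finite_set [set u : Zd | A (lat M u)].
Proof.
move=> M0 AG; apply: sub_finite_set (finite_lat_gset G M0).
by apply: subset_trans (@cnt_sub_hits M _) => u /AG.
Qed.

Lemma latD M (u v : Zd) : lat M (u + v) = lat M u + lat M v :> V.
Proof. by apply/rowP => i; rewrite !mxE rmorphD/= mulrDl. Qed.

Lemma lat0 M : lat M 0 = 0 :> V.
Proof. by apply/rowP => i; rewrite !mxE mul0r. Qed.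

Lemma latN M (u : Zd) : lat M (- u) = - lat M u :> V.
Proof. by apply/rowP => i; rewrite !mxE rmorphN/= mulNr. Qed.

Lemma cnt_translate M G (u : Zd) : (0 < M)%N ->
  cnt M (aff (lat M u) 1 @` sval G) = cnt M (sval G).
Proof.
move=> M0; rewrite /cnt; have fG := finite_cnt M0 (@subset_refl _ (sval G)).
rewrite -(ncard_image fG (@addrI _ u)); congr ncard; apply/seteqP; split=> v /=.
  move=> [x Gx xv]; exists (v - u); last by rewrite addrC subrK.
  rewrite latD latN -xv /aff scale1r addrAC subrr add0r//.
by move=> [w Gw <-]; exists (lat M w) => //; rewrite latD /aff scale1r.
Qed.

Lemma tau_subproof x G : (diam (aff x 1 @` sval G) < 1)%E.
Proof. by rewrite diam_aff// mul1e; exact: (svalP G). Qed.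

Definition tau x (G : GF) : GF := exist (fun A => (diam A < 1)%E) _ (tau_subproof x G).

Lemma tau_preimage x D : tau x @^-1` D = translate (- x) D.
Proof.
apply/seteqP; split=> [G DG|G [L DL e]] /=.
  exists (tau x G) => //=; apply/seteqP; split=> [y Gy|_ [_ [y Gy <-] <-]].
    by exists (aff x 1 y); [exists y|rewrite /aff scale1r addKr].
  by rewrite /aff scale1r addKr.
suff -> : tau x G = L by [].
apply: eq_sig_hprop => [A p q|/=]; first exact: Prop_irrelevance.
rewrite e; apply/seteqP; split=> [_ [_ [y Ly <-] <-]|y Ly].
  by rewrite /aff scale1r addNKr.
by exists (- x + y); [exists y|rewrite /aff scale1r addNKr].
Qed.

Lemma measurable_tau x : measurable_fun setT (tau x).
Proof. by move=> _ D mD; rewrite setTI tau_preimage; exact: (suitable_translate hF). Qed.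

Lemma integral_tau x D (f : GF -> \bar R) : measurable D -> measurable_fun D f ->
  (forall G, D G -> (0 <= f G)%E) ->
  (\int[mu]_(G in D) f G = \int[mu]_(G in tau x @^-1` D) f (tau x G))%E.
Proof.
move=> mD mf f0.
rewrite -(ge0_integral_pushforward (measurable_tau x))//; last by move=> G /set_mem /f0.
apply: eq_measure_integral => [|mt A mA _]; first exact: measurable_tau.
transitivity (mu (tau x @^-1` A)); last by [].
rewrite tau_preimage; apply/esym; exact: mu_translation.
Qed.

Lemma diam_tau x G : diam (sval (tau x G)) = diam (sval G).
Proof. by rewrite /= diam_aff// mul1e. Qed.

Lemma pos_volume_tau x G : pos_volume (tau x G) <-> pos_volume G.
Proof. by have := @pos_volume_aff R d x 1 G (tau x G) ltr01 erefl; tauto. Qed.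

Lemma aff1K x y : aff x 1 (y - x) = y.
Proof. by rewrite /aff scale1r addrC subrK. Qed.

Lemma tau_full x y G : fullF y 0 (tau x G) <-> fullF (y - x) 0 G.
Proof.
have e : sval (tau x G) y <-> sval G (y - x).
  by have := image_aff_aff x (sval G) (y - x) (oner_neq0 R); rewrite aff1K /= => ->.
split=> -[a b c]; split.
- exact/e.
- by rewrite -(diam_tau x).
- exact/(pos_volume_tau x).
- exact/e.
- by rewrite diam_tau.
- exact/pos_volume_tau.
Qed.

Lemma tau_rim x y r G : rimF y r 0 (tau x G) <-> rimF (y - x) r 0 G.
Proof.
have e : inner_nbhd r (sval (tau x G)) y <-> inner_nbhd r (sval G) (y - x).
  by have := inner_nbhd_aff d0 r (sval G) x (y - x) ltr01; rewrite aff1K mul1r.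
split=> -[a b c]; split.
- exact/e.
- by rewrite -(diam_tau x).
- exact/(pos_volume_tau x).
- exact/e.
- by rewrite diam_tau.
- exact/pos_volume_tau.
Qed.

(** Contains every lattice vector joining two points of a set of diameter less than 1
    ([lat_window]), which makes the sums over the lattice finite. *)
Definition window M : set Zd :=
  [set u : Zd | forall i, - (M%:R : R) - 1 < (u ord0 i)%:~R < (M%:R : R) + 1].

Lemma finite_window M : finite_set (window M).
Proof.
have [] // := @int_box R d (fun _ => - M%:R - 1) (fun _ => M%:R + 1).
by move=> i; have : 0 <= M%:R :> R by []; lra.
Qed.

Lemma lat_window M G u : (0 < M)%N -> sval G 0 -> sval G (lat M u) \/ sval G (- lat M u) ->
  window M u.
Proof.
move=> M0 G0 Gu i; have MR : 0 < M%:R :> R by rewrite ltr0n.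
have : `|lat M u ord0 i| <= 1 :> R.
  by case: Gu => /(gset_coord i G0); rewrite !mxE subr0 ?normrN.
rewrite mxE normrM normfV ler_pdivrMr ?normr_gt0 ?gt_eqF// mul1r [X in _ <= X]ger0_norm//.
by rewrite ler_norml => /andP[? ?]; apply/andP; split; lra.
Qed.

Lemma cnt_full M G : (0 < M)%N -> fullF 0 0 G ->
  (cnt M (sval G))%:R = \sum_(u <- fset_set (window M)) \1_(fullF (lat M u) 0) G :> R.
Proof.
move=> M0 [G0 hG pG]; rewrite /cnt (@ncard_sum R _ (window M)); first last.
- by move=> u Gu; apply: (lat_window M0 G0); left.
- exact: finite_window.
apply: eq_bigr => u _; rewrite !indicE; congr (_ (_ : bool))%:R.
by apply/idP/idP => /set_mem; [move=> Gu; apply: mem_set; split|move=> [Gu _ _]; apply: mem_set].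
Qed.

Lemma cnt_gt0 M G : (0 < M)%N -> sval G 0 -> (0 < cnt M (sval G))%N.
Proof.
move=> M0 G0; apply: (@ncard_gt0 _ _ 0); last by rewrite /= lat0.
exact: (finite_cnt M0 (@subset_refl _ _)).
Qed.

Definition winv M (G : GF) : R := (cnt M (sval G))%:R^-1.

Lemma winv_ge0 M G : 0 <= winv M G.
Proof. by rewrite invr_ge0. Qed.

Lemma measurable_winv M : (0 < M)%N -> measurable_fun (fullF 0 0) (winv M).
Proof.
(* On [full 0 0] the count is a finite sum of indicators, and the inverse is the measurable power
   -1. *)
move=> M0; apply: (@eq_measurable_fun _ _ _ _ _ (fun G : GF =>
  (\sum_(u <- fset_set (window M)) \1_(fullF (lat M u) 0) G) `^ (-1))).
  move=> G /set_mem fG; rewrite powR_inv1 ?sumr_ge0//.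
  by rewrite /winv cnt_full.
apply: (measurableT_comp (measurable_powR (-1))).
apply: measurable_sum => u; apply: measurable_indic.
exact: (full_finite hF h1 (lat M u) 0).1.
Qed.

Lemma integral_indic_winv M (E : set GF) : (0 < M)%N -> measurable E -> E `<=` fullF 0 0 ->
  (\int[mu]_(G in fullF 0 0) (\1_E G * winv M G)%:E = \int[mu]_(G in E) (winv M G)%:E)%E.
Proof.
move=> M0 mE EX; rewrite -[in RHS](setIidr EX) integral_mkcondr.
apply: eq_integral => G _; rewrite /patch indicE.
by case: (G \in E); rewrite ?mul1r ?mul0r.
Qed.

(** A set with the origin in its rim spreads its unit of mass evenly over its lattice points u.
    Translating by -u carries the pair (0, u) to (-u, 0) and preserves the number of lattice points;
    what the origin receives in total is the number of lattice points in the rim divided by the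
    number in the set. *)
Lemma mass_transport M r : (0 < M)%N -> 0 < r ->
  mu (rimF 0 r 0) = (\int[mu]_(G in fullF 0 0)
    ((cnt M (inner_nbhd r (sval G)))%:R / (cnt M (sval G))%:R)%:E)%E.
Proof.
move=> M0 r0.
have [mX fX] := full_finite hF h1 0 0.
have mR x : measurable (rimF x r 0) by exact: (rim_finite d0 hF h1 x 0 r0).1.
have mF x : measurable (fullF x 0) by exact: (full_finite hF h1 x 0).1.
have RX x : (rimF x r 0) `<=` fullF x 0 by move=> G [[Gx _] hG pG].
pose E u : set GF := rimF 0 r 0 `&` fullF (lat M u) 0.
pose E' u : set GF := rimF (- lat M u) r 0 `&` fullF 0 0.
have mE u : measurable (E u) by exact: measurableI.
have mE' u : measurable (E' u) by exact: measurableI.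
have mI (A : set GF) : measurable A ->
    measurable_fun (fullF 0 0) (fun G => (\1_A G * winv M G)%:E).
  move=> mA; apply/measurable_EFinP; apply: measurable_funM; first exact: measurable_indic.
  exact: measurable_winv.
have EE' u : (\int[mu]_(G in fullF 0 0) (\1_(E u) G * winv M G)%:E =
    \int[mu]_(G in fullF 0 0) (\1_(E' u) G * winv M G)%:E)%E.
  rewrite !integral_indic_winv//; first last.
  - by move=> G [/RX].
  - by move=> G [].
  rewrite (integral_tau (lat M u)) //; first last.
  - by move=> G _; rewrite lee_fin winv_ge0.
  - apply/measurable_EFinP; apply: measurable_funS (measurable_winv M0) => //.
    by move=> G [/RX].
  have -> : tau (lat M u) @^-1` E u = E' u.
    apply/seteqP; split=> G /=.
      by move=> [/tau_rim + /tau_full]; rewrite sub0r subrr.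
    by move=> [GR GF']; split; [apply/tau_rim|apply/tau_full]; rewrite ?sub0r ?subrr.
  by apply: eq_integral => G _; rewrite /winv /= cnt_translate.
transitivity (\int[mu]_(G in fullF 0 0) (\1_(rimF 0 r 0) G)%:E)%E.
  by rewrite integral_indic// setIidl//; exact: RX.
transitivity (\int[mu]_(G in fullF 0 0)
    \sum_(u <- fset_set (window M)) (\1_(E u) G * winv M G)%:E)%E.
  apply: eq_integral => G /set_mem XG; rewrite sumEFin -mulr_suml; congr EFin.
  have [GR|GR] := pselect (rimF 0 r 0 G).
    rewrite indicE mem_set// (eq_bigr (fun u => \1_(fullF (lat M u) 0) G)).
      rewrite -cnt_full// /winv mulfV// pnatr_eq0 -lt0n cnt_gt0//.
      by case: XG.
    by move=> u _; rewrite /E indicI/= [X in X * _]indicE mem_set// mul1r.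
  rewrite indicE memNset// big1 ?mul0r// => u _.
  by rewrite indicE memNset// => -[].
rewrite ge0_integral_sum//; first last.
- by move=> u G _; rewrite lee_fin mulr_ge0// winv_ge0.
- by move=> u; exact: mI.
under eq_bigr do rewrite EE'.
rewrite -ge0_integral_sum//; first last.
- by move=> u G _; rewrite lee_fin mulr_ge0// winv_ge0.
- by move=> u; exact: mI.
apply: eq_integral => G /set_mem XG; rewrite sumEFin -mulr_suml; congr (_ * _)%:E.
have fI : finite_set [set u : Zd | inner_nbhd r (sval G) (lat M u)].
  by apply: (@finite_cnt M G _ M0) => x [].
rewrite /cnt -(ncard_image fI (@oppr_inj _)).
rewrite (_ : -%R @` _ = [set u : Zd | inner_nbhd r (sval G) (- lat M u)]); last first.
  apply/seteqP; split=> [_ [u Gu <-]|u Gu] /=; first by rewrite latN opprK.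
  by exists (- u); rewrite ?opprK//= latN.
rewrite (@ncard_sum R _ (window M)); first last.
- by move=> u [Gu _]; apply: (lat_window M0 _ (or_intror Gu)); case: XG.
- exact: finite_window.
apply: eq_bigr => u _; rewrite !indicE; congr (_ (_ : bool))%:R.
apply/idP/idP => /set_mem; first by move=> [[Gu _ _] _]; apply: mem_set.
by move=> Gu; apply: mem_set; split=> //; case: XG.
Qed.

End transport.

(** * From lattice counts to volume ratios *)

Section rim_bound.
Context {R : realType} {d : nat} (d0 : (0 < d)%N).
Local Notation V := 'rV[R]_d.
Local Notation gset := (gset R d).
Local Notation Zd := 'rV[int]_d.
Context {F : set (set gset)} (hF : suitable F).
Local Notation GF := (g_sigma_algebraType F).
Context (mu : {measure set GF -> \bar R}).
Hypotheses (mu_translation : translation_invariant mu)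
  (mu_scale : semi_scale_invariant mu) (h1 : locally_finite_hits mu)
  (h2 : mu pos_boundary = 0%E).
Local Notation fullF := (@full R d F).
Local Notation rimF := (@rim R d F).
Implicit Types (x y : V) (s r : R) (D : set GF) (G : gset).

Lemma Leb_gset_fin G : Leb (sval G) \is a fin_num.
Proof.
rewrite ge0_fin_numE ?Leb_ge0//.
have := @lat_outer R d d0 1 (sval G) isT (finite_lat_gset G (ltn0Sn 0)).
by move=> /le_lt_trans; apply; rewrite ltry.
Qed.

Lemma Leb_inner_le r G : (Leb (inner_nbhd r (sval G)) <= Leb (sval G))%E.
Proof. by apply: le_Leb => x []. Qed.

Lemma Leb_inner_fin r G : Leb (inner_nbhd r (sval G)) \is a fin_num.
Proof.
have := Leb_gset_fin G; rewrite !ge0_fin_numE ?Leb_ge0//.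
by apply: le_lt_trans; exact: Leb_inner_le.
Qed.

Definition vol G : R := fine (Leb (sval G)).
Definition inner_vol r G : R := fine (Leb (inner_nbhd r (sval G))).
Definition ratio r G : R := inner_vol r G / vol G.

Lemma inner_vol_ge0 r G : 0 <= inner_vol r G.
Proof. by rewrite fine_ge0// Leb_ge0. Qed.

Lemma vol_ge0 G : 0 <= vol G.
Proof. by rewrite fine_ge0// Leb_ge0. Qed.

Lemma inner_vol_le r G : inner_vol r G <= vol G.
Proof. by apply: fine_le; [exact: Leb_inner_fin|exact: Leb_gset_fin|exact: Leb_inner_le]. Qed.

Lemma vol_gt0 G : pos_volume G -> 0 < vol G.
Proof. by move=> h; apply: fine_gt0; rewrite h -ge0_fin_numE ?Leb_ge0 ?Leb_gset_fin. Qed.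

Lemma ratio_ge0 r G : 0 <= ratio r G.
Proof. by rewrite divr_ge0 ?inner_vol_ge0 ?vol_ge0. Qed.

(** Counts and volumes agree up to the cubes that meet the frontier, which are few. A lattice point
    of the inner r-neighbourhood whose cube misses the frontier has its whole cube in the inner
    2r-neighbourhood once d / M <= r. Doubling the radius avoids any question about the boundary of
    the neighbourhood itself. *)
Lemma cnt_ratio_limit r G (t : R) : sval G 0 -> pos_volume G ->
  Leb (frontier (sval G)) = 0%E -> 0 < r -> 0 < t ->
  exists N, forall M, (N <= M)%N -> (0 < M)%N ->
    (cnt M (inner_nbhd r (sval G)))%:R / (cnt M (sval G))%:R <= ratio (2 * r) G + t.
Proof.
move=> G0 pG LG r0 t0.
have L0 := vol_gt0 pG; set L := vol G in L0.
have t2 : 0 < 2 + t by lra.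
(* Chosen so that (q L + e) / (L - e) <= q + t for every q in [0, 1]. *)
pose e := t * L / (2 + t).
have e0 : 0 < e by rewrite divr_gt0 ?mulr_gt0.
have et : e * (2 + t) = t * L by rewrite /e divfK// gt_eqF.
have eL : e < L by rewrite ltr_pdivrMr// mulrC ltr_pM2l//; lra.
have [N NP] := few_boundary_cubes d0 LG e0.
exists (maxn N (`|Num.ceil (d%:R / r)|%N)) => M; rewrite geq_max => /andP[NM rM] M0.
have [fS cS] := NP M NM M0; set S := [set u | _] in fS cS.
have MR : 0 < M%:R :> R by rewrite ltr0n.
have Md : 0 < M%:R ^+ d :> R by rewrite exprn_gt0.
have dM : d%:R * M%:R^-1 <= r.
  rewrite ler_pdivrMr// -ler_pdivrMl// mulrC.
  apply: le_trans (ceil_ge _) _; apply: (@le_trans _ _ (`|Num.ceil (d%:R / r)|%N)%:R).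
    by rewrite natr_absz ler_int ler_norm.
  by rewrite ler_nat.
have M1 : 0 <= M%:R^-1 :> R by rewrite invr_ge0 ltW.
pose U := [set u : Zd | cube (lat M u) M%:R^-1 `<=` inner_nbhd (2 * r) (sval G)].
have fU : finite_set U.
  apply: (sub_finite_set _ (@finite_cnt R d M G (sval G) M0 (@subset_refl _ _))) => u Uu.
  by have [] := Uu _ (cube_base _ M1).
have cU : (ncard U)%:R <= inner_vol (2 * r) G * M%:R ^+ d.
  have := @lat_inner R d d0 M U (inner_nbhd (2 * r) (sval G)) M0 fU (fun u h => h).
  by rewrite -(fineK (Leb_inner_fin (2 * r) G)) lee_fin ler_pdivrMr.
have n1 : (cnt M (inner_nbhd r (sval G)))%:R <= (e + inner_vol (2 * r) G) * M%:R ^+ d.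
  rewrite mulrDl; apply: (@le_trans _ _ ((ncard S)%:R + (ncard U)%:R)); last first.
    by apply: lerD => //; exact: ltW.
  rewrite -natrD ler_nat; apply: leq_trans (ncardU fS fU).
  apply: ncard_sub; first by rewrite finite_setU.
  move=> u /= ur; have [Su|nSu] := pselect (S u); [by left|right].
  have Gu : sval G (lat M u) by case: ur.
  have uG : cube (lat M u) M%:R^-1 `<=` sval G.
    apply: contrapT => h; apply: nSu; apply: cube_frontier => //.
    by exists (lat M u); split=> //; exact: cube_base.
  move=> y uy; apply/inner_nbhdP; split; first exact: uG.
  have [_ [z Az uz]] := (inner_nbhdP _ _ _).1 ur; exists z => //.
  apply: le_lt_trans (ler_enormB y (lat M u) z) _.
  have := cube_enorm d0 M1 uy (cube_base _ M1); lra.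
have n2 : (L - e) * M%:R ^+ d <= (cnt M (sval G))%:R.
  rewrite mulrBl lerBlDr.
  apply: (@le_trans _ _ ((cnt M (sval G))%:R + (ncard S)%:R)); last first.
    by rewrite lerD2l ltW.
  have := @lat_outer R d d0 M (sval G) M0 (finite_lat_gset G M0).
  rewrite -(fineK (Leb_gset_fin G)) lee_fin ler_pdivlMr// => /le_trans; apply.
  have fG := @finite_cnt R d M G (sval G) M0 (@subset_refl _ _).
  rewrite -natrD ler_nat; apply: leq_trans (ncardU fG fS).
  apply: ncard_sub; first by rewrite finite_setU.
  move=> u /= uG; have [Su|nSu] := pselect (S u); [by right|left].
  apply: contrapT => h; apply: nSu; apply: cube_frontier => // h'.
  by apply: h; apply: h'; exact: cube_base.
have n2' : 0 < (cnt M (sval G))%:R :> R.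
  by apply: lt_le_trans n2; rewrite mulr_gt0// subr_gt0.
rewrite ler_pdivrMr//; apply: le_trans n1 _.
have I0 := inner_vol_ge0 (2 * r) G; have IL := inner_vol_le (2 * r) G.
have q0 : 0 <= ratio (2 * r) G + t by rewrite addr_ge0 ?ratio_ge0// ltW.
apply: le_trans (ler_wpM2l q0 n2); rewrite mulrA ler_pM2r//.
set q := ratio (2 * r) G in q0 *.
have qE : inner_vol (2 * r) G = q * L by rewrite /q /ratio divfK// gt_eqF.
have q1 : q <= 1 by rewrite /q /ratio ler_pdivrMr// mul1r.
have q00 : 0 <= q by rewrite ratio_ge0.
rewrite qE; nra.
Qed.

Lemma measurable_inner_vol r : 0 < r -> measurable_fun [set: GF] (fun G : GF => inner_vol r G).
Proof.
move=> r0; apply: (measurableT_comp _ (suitable_Leb_inner hF r0)).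
exact: fine_measurable.
Qed.

Lemma measurable_ratio r : 0 < r -> measurable_fun [set: GF] (fun G : GF => ratio r G).
Proof.
move=> r0; apply: measurable_funM; first exact: measurable_inner_vol.
apply: (@eq_measurable_fun _ _ _ _ _ (fun G : GF => vol G `^ (-1))).
  by move=> G _; rewrite powR_inv1// vol_ge0.
apply: (measurableT_comp (measurable_powR (-1))).
apply: (measurableT_comp _ (suitable_Leb hF)).
exact: fine_measurable.
Qed.

Lemma cnt_ratio_le1 M r G : (0 < M)%N ->
  0 <= ((cnt M (inner_nbhd r (sval G)))%:R / (cnt M (sval G))%:R : R) <= 1.
Proof.
move=> M0; rewrite divr_ge0//=.
have h : (cnt M (inner_nbhd r (sval G)) <= cnt M (sval G))%N.
  by apply: ncard_sub => [|u []]; first exact: (@finite_cnt R d M G).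
have [->|n0] := eqVneq (cnt M (sval G)) 0%N; first by rewrite invr0 mulr0.
by rewrite ler_pdivrMr ?ltr0n ?lt0n// mul1r ler_nat.
Qed.

Lemma rim_mass_le r : 0 < r ->
  ((rim_mass mu r)%:E <= \int[mu]_(G in fullF 0 0) (ratio (2 * r) G)%:E)%E.
Proof.
move=> r0; apply/lee_addgt0Pr => e e0.
have r20 : 0 < 2 * r by rewrite mulr_gt0.
have [mX fX] := full_finite hF h1 0 0.
pose cr M (G : GF) : R := (cnt M (inner_nbhd r (sval G)))%:R / (cnt M (sval G))%:R.
(* [cnt_ratio_limit] bounds the count ratio only from above, so it is the positive part of the
   excess that tends to 0. *)
pose f n (G : GF) : R := Num.max (cr n.+1 G - ratio (2 * r) G) 0.
have mcr n : measurable_fun (fullF 0 0) (cr n.+1).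
  suff mc : measurable_fun (fullF 0 0)
      (fun G : GF => (cnt n.+1 (inner_nbhd r (sval G)))%:R : R).
    exact: (measurable_funM mc (measurable_winv hF h1 (ltn0Sn n))).
  apply: (@eq_measurable_fun _ _ _ _ _ (fun G : GF =>
      \sum_(u <- fset_set (@window R d n.+1)) \1_(rimF (lat n.+1 u) r 0) G : R)).
    move=> G /set_mem XG; rewrite /cnt (@ncard_sum R _ (@window R d n.+1)); first last.
    - by move=> u [Gu _]; apply: (@lat_window R d n.+1 G) => //; [case: XG|left].
    - exact: finite_window.
    apply: eq_bigr => u _; rewrite !indicE; congr (_ (_ : bool))%:R.
    apply/idP/idP => /set_mem; first by case=> Gu _ _; exact: mem_set.
    by move=> Gu; apply: mem_set; case: XG => ? ? ?; split.
  apply: measurable_sum => u; apply: measurable_indic.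
  exact: (rim_finite d0 hF h1 _ 0 r0).1.
have mf n : measurable_fun (fullF 0 0) (f n).
  apply: measurable_maxr; last exact: measurable_cst.
  apply: measurable_funB => //.
  by apply: measurable_funTS; exact: measurable_ratio.
have f01 n G : fullF 0 0 G -> 0 <= f n G <= 1.
  move=> _; rewrite /f le_max lexx orbT ge_max ler01 andbT/=.
  have /andP[_ h] := @cnt_ratio_le1 n.+1 r G isT; have := ratio_ge0 (2 * r) G.
  by rewrite -/(cr n.+1 G) in h; lra.
have [|N NP] := @bounded_cvg0 _ _ _ mu (fullF 0 0) f mX fX mf f01 _ e e0.
  apply: (ae_null_frontier hF h2) => G [G0 _ pG] LG t t0.
  have [N NP] := cnt_ratio_limit G0 pG LG r0 t0.
  exists N => n Nn; rewrite /f ge_max (ltW t0) andbT lerBlDl.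
  exact: NP (leq_trans Nn (leqnSn n)) isT.
rewrite /rim_mass fineK ?ge0_fin_numE//; last exact: (rim_finite d0 hF h1 0 0 r0).2.
rewrite (mass_transport d0 hF mu_translation h1 (ltn0Sn N) r0).
apply: (@le_trans _ _ (\int[mu]_(G in fullF 0 0) ((ratio (2 * r) G)%:E + (f N G)%:E))%E).
  apply: le_ge0_integral => G XG; first by rewrite lee_fin divr_ge0.
  rewrite -EFinD lee_fin /f -lerBlDl le_max; apply/orP; left.
  by rewrite /cr lexx.
rewrite ge0_integralD//; last 4 first.
- by move=> G _; rewrite lee_fin ratio_ge0.
- by apply/measurable_EFinP; apply: measurable_funTS; exact: measurable_ratio.
- by move=> G XG; rewrite lee_fin; have /andP[] := f01 N G XG.
- by apply/measurable_EFinP; exact: mf.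
by apply: leeD2l; exact: NP.
Qed.

End rim_bound.

(** * Summability of the rims *)

Section summability.
Context {R : realType} {d : nat} (d0 : (0 < d)%N).
Local Notation V := 'rV[R]_d.
Local Notation gset := (gset R d).
Local Notation Zd := 'rV[int]_d.
Context {F : set (set gset)} (hF : suitable F).
Local Notation GF := (g_sigma_algebraType F).
Context (mu : {measure set GF -> \bar R}).
Hypotheses (mu_translation : translation_invariant mu)
  (mu_scale : semi_scale_invariant mu) (h1 : locally_finite_hits mu)
  (h2 : mu pos_boundary = 0%E) (h3 : (0 < mu pos_volume)%E)
  (h4 : (boundary_integral mu < +oo)%E).
Local Notation fullF := (@full R d F).
Local Notation rimF := (@rim R d F).
Local Notation expsize := (@expsize R).
Implicit Types (x y : V) (s r : R) (D : set GF) (G : gset).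

Lemma expsizeS n : expsize n.+1 = expsize n / 2.
Proof. by rewrite /expsize exprSr. Qed.

Lemma expsize_anti m n : (m <= n)%N -> expsize n <= expsize m.
Proof. by move=> mn; rewrite /expsize ler_wiXn2l// invf_le1// ler1n. Qed.

Lemma expsize_small (e : R) : 0 < e -> exists n, expsize n < e.
Proof.
move=> e0; exists (`|Num.ceil e^-1|)%N; rewrite /expsize exprVn.
rewrite -[X in _ < X]invrK ltf_pV2 ?posrE ?invr_gt0 ?exprn_gt0//.
apply: (@le_lt_trans _ _ (`|Num.ceil e^-1|%N)%:R).
  by rewrite natr_absz (le_trans (ceil_ge _))// ler_int ler_norm.
by rewrite -natrX ltr_nat ltn_expl.
Qed.

Lemma exists_shell (t : R) : 0 < t < 1 -> exists n, expsize n.+1 <= t < expsize n.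
Proof.
move=> /andP[t0 t1].
have ex : exists n, expsize n <= t by have [n /ltW] := expsize_small t0; exists n.
case: (ex_minnP ex) => -[|n] nt nmin.
  by move: nt; rewrite /expsize expr0 leNgt t1.
exists n; rewrite nt/= ltNge; apply/negP => /nmin.
by rewrite ltnn.
Qed.

Lemma inner_vol_mono r s G : r <= s -> inner_vol r G <= inner_vol s G.
Proof.
move=> rs; apply: fine_le; [exact: Leb_inner_fin|exact: Leb_inner_fin|].
apply: le_Leb => x /inner_nbhdP[Gx [y Ay xy]]; apply/inner_nbhdP; split=> //.
by exists y => //; exact: lt_le_trans rs.
Qed.

Lemma ratio_mono r s G : r <= s -> ratio r G <= ratio s G.
Proof. by move=> rs; rewrite ler_wpM2r ?invr_ge0 ?vol_ge0// inner_vol_mono. Qed.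

(** On []2^-(n+1), 2^-n[], an interval of length 2^-(n+1), the factor 1 / r is at least 2^n and the
    ratio, monotone in r, at least its value at the left end. *)
Lemma lower_sum_ratio k G :
  (\sum_(n < k) (ratio (expsize n.+1) G / 2)%:E <=
   \int[lebesgue_measure]_(r in `]0%R, 1%R[) (r^-1 * ratio r G)%:E)%E.
Proof.
pose I n : set R := `]expsize n.+1, expsize n[%classic.
pose h n (r : R) := 2 ^+ n * ratio (expsize n.+1) G * \1_(I n) r.
have h0 n r : 0 <= h n r.
  by rewrite /h indicE; apply: mulr_ge0 => //; apply: mulr_ge0; [rewrite exprn_ge0|exact: ratio_ge0].
have mI n : measurable (I n) by exact: measurable_itv.
have mh n : measurable_fun (`]0%R, 1%R[%classic : set R) (fun r => (h n r)%:E).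
  apply/measurable_EFinP; apply: measurable_funM; first exact: measurable_cst.
  exact: measurable_indic.
apply: (@le_trans _ _ (\int[lebesgue_measure]_(r in `]0%R, 1%R[) \sum_(n < k) (h n r)%:E)%E).
  rewrite ge0_integral_sum//; first last.
  - by move=> n r _; rewrite lee_fin.
  - by move=> n; exact: mh.
  apply: lee_sum => n _; rewrite /h.
  under eq_integral do rewrite EFinM.
  rewrite ge0_integralZl_EFin//; first last.
  - by rewrite mulr_ge0// ratio_ge0.
  - by apply/measurable_EFinP; apply: measurable_indic; exact: mI.
  rewrite integral_indic//; last exact: mI.
  rewrite setIidl; last first.
    move=> r /=; rewrite !in_itv/= => /andP[r1 r2].
    rewrite (lt_trans _ r1) ?expsize_gt0//=.
    by apply: lt_le_trans r2 _; exact: expsize_le1.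
  have e0 := @expsize_gt0 R n.
  have E : lebesgue_measure (I n) = (expsize n - expsize n.+1)%:E.
    by rewrite /I lebesgue_measure_itv/= lte_fin ifT//; rewrite expsizeS; lra.
  apply: (@le_trans _ _ ((2 ^+ n * ratio (expsize n.+1) G)%:E * lebesgue_measure (I n))%E);
    last exact: lexx.
  rewrite E -EFinM lee_fin expsizeS.
  have -> : expsize n - expsize n / 2 = expsize n / 2 by lra.
  have e1 : 2 ^+ n * expsize n = 1 by rewrite /expsize -exprMn mulfV// expr1n.
  rewrite [leRHS](_ : _ = (2 ^+ n * expsize n) * ratio (expsize n / 2) G / 2); last by ring.
  by rewrite e1 mul1r.
apply: le_ge0_integral => r.
  by move=> _; apply: sume_ge0 => n _; rewrite lee_fin.
rewrite /= in_itv/= => /andP[r0 r1]; rewrite sumEFin lee_fin.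
have rhs0 : 0 <= r^-1 * ratio r G by rewrite mulr_ge0 ?ratio_ge0// invr_ge0 ltW.
have [[m mk rm]|nI] := pselect (exists2 m : 'I_k, True & I m r); last first.
  rewrite big1// => n _; rewrite /h indicE memNset ?mulr0// => nr.
  by apply: nI; exists n.
rewrite (bigD1 m)//= big1 ?addr0; last first.
  move=> n nm; rewrite /h indicE memNset ?mulr0// => nr.
  move: rm nr nm; rewrite /I /= !in_itv/= => /andP[m1 m2] /andP[n1 n2].
  rewrite -val_eqE/= neq_ltn => /orP[] lt.
    by have := lt_trans m2 (le_lt_trans (expsize_anti lt) n1); rewrite ltxx.
  by have := lt_trans n2 (le_lt_trans (expsize_anti lt) m1); rewrite ltxx.
rewrite /h indicE mem_set// mulr1.
move: rm; rewrite /I /= in_itv/= => /andP[m1 m2].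
apply: ler_pM => //; first exact: ratio_ge0; last exact/ratio_mono/ltW.
rewrite -[X in X <= _]invrK lef_pV2 ?posrE// ?invr_gt0 ?exprn_gt0//.
by rewrite -exprVn ltW.
Qed.

Lemma full_A1 : fullF 0 0 = (A1 : set GF) `&` pos_volume.
Proof.
rewrite /full /A1 /expsize expr0 expr1.
by apply/seteqP; split=> [G [? ? ?]|G [[? ?] ?]].
Qed.

Lemma boundary_integral_ge k :
  (\sum_(n < k) \int[mu]_(G in fullF 0 0) (ratio (expsize n.+1) G / 2)%:E
    <= boundary_integral mu)%E.
Proof.
have mpv := measurable_pos_volume hF.
have [mX fX] := full_finite hF h1 0 0.
pose inn (G : GF) : \bar R :=
  (\int[lebesgue_measure]_(r in `]0%R, 1%R[) (r^-1 * ratio r G)%:E)%E.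
have inn0 G : (0 <= inn G)%E.
  apply: integral_ge0 => r /=; rewrite in_itv/= => /andP[r0 _].
  by rewrite lee_fin mulr_ge0 ?ratio_ge0// invr_ge0 ltW.
have mr n : measurable_fun (fullF 0 0) (fun G => (ratio (expsize n.+1) G / 2)%:E).
  apply/measurable_EFinP; apply: measurable_funM; last exact: measurable_cst.
  by apply: measurable_funTS; apply: measurable_ratio => //; exact: expsize_gt0.
(* [mu_p] is by conversion the restriction of [mu] to [pos_volume], and thus a measure. *)
pose mup := mrestr mu mpv.
have -> : boundary_integral mu = (\int[mup]_(G in A1) inn G)%E by [].
apply: (@le_trans _ _ (\int[mup]_(G in fullF 0 0) inn G)%E); last first.
  rewrite integral_mkcond [leRHS]integral_mkcond; apply: le_ge0_integral => G _.
    by rewrite /patch; case: ifPn.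
  rewrite /patch; case: ifPn => [/set_mem|_]; last by case: ifPn.
  by rewrite full_A1 => -[AG _]; rewrite mem_set.
have -> : (\int[mup]_(G in fullF 0 0) inn G = \int[mu]_(G in fullF 0 0) inn G)%E.
  apply: eq_measure_integral => A mA AX.
  transitivity (mu (A `&` pos_volume)); first by [].
  rewrite setIidl//.
  by apply: subset_trans AX _; rewrite full_A1; exact: subIsetr.
rewrite -ge0_integral_sum//; last first.
  by move=> n G _; rewrite lee_fin divr_ge0// ratio_ge0.
apply: le_ge0_integral => G _; last exact: lower_sum_ratio.
by apply: sume_ge0 => n _; rewrite lee_fin divr_ge0// ratio_ge0.
Qed.

Lemma rim_mass_ge0 r : 0 <= rim_mass mu r.
Proof. by rewrite fine_ge0. Qed.

Lemma rim_mass_le_mass r : 0 < r -> rim_mass mu r <= mass mu.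
Proof.
move=> r0; have [mr fr] := rim_finite d0 hF h1 0 0 r0; have [mf ff] := full_finite hF h1 0 0.
apply: fine_le; rewrite ?ge0_fin_numE//.
by apply: le_measure; [exact/mem_set|exact/mem_set|move=> G [[? _] ? ?]; split].
Qed.

Lemma mass_ge0 : 0 <= mass mu.
Proof. by rewrite fine_ge0. Qed.

(** The index [n.+2] against [n.+1] absorbs the doubled radius of [rim_mass_le]; the factor 2 undoes
    the half in [lower_sum_ratio]. *)
Lemma rim_sum_small k :
  \sum_(n < k) rim_mass mu (expsize n.+2) <= 2 * fine (boundary_integral mu).
Proof.
have B0 : (0 <= boundary_integral mu)%E.
  by have := boundary_integral_ge 0; rewrite big_ord0.
have mr n : measurable_fun (fullF 0 0) (fun G => (ratio (expsize n.+1) G)%:E).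
  apply/measurable_EFinP.
  by apply: measurable_funTS; apply: measurable_ratio => //; exact: expsize_gt0.
have [mX fX] := full_finite hF h1 0 0.
rewrite -lee_fin EFinM fineK ?ge0_fin_numE// -sumEFin.
apply: (@le_trans _ _ (2%:E * \sum_(n < k)
    \int[mu]_(G in fullF 0 0) (ratio (expsize n.+1) G / 2)%:E)%E); last first.
  by apply: lee_wpmul2l; rewrite ?lee_fin// boundary_integral_ge.
rewrite ge0_sume_distrr; last first.
  by move=> n _; apply: integral_ge0 => G _; rewrite lee_fin divr_ge0// ratio_ge0.
apply: lee_sum => n _.
rewrite -ge0_integralZl_EFin//; first last.
- apply/measurable_EFinP; apply: measurable_funM; last exact: measurable_cst.
  by apply/measurable_EFinP; exact: mr.
- by move=> G _; rewrite lee_fin divr_ge0// ratio_ge0.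
have := rim_mass_le d0 hF mu_translation h1 h2 (@expsize_gt0 R n.+2).
move=> /le_trans; apply; rewrite le_eqVlt; apply/orP; left; apply/eqP.
apply: eq_integral => G _; rewrite -EFinM; congr EFin.
have -> : 2 * expsize n.+2 = expsize n.+1 by rewrite [expsize n.+2]expsizeS; lra.
by lra.
Qed.

(** A factor 2^p on the radii shifts the index by p; the first p + 2 terms are bounded by [mass]. *)
Lemma rim_sum p : exists C : R, forall n,
  \sum_(i < n) rim_mass mu (2 ^+ p * expsize i) <= C.
Proof.
exists ((p + 2)%:R * mass mu + 2 * fine (boundary_integral mu)) => n.
apply: (@le_trans _ _ (\sum_(i < p + 2 + n) rim_mass mu (2 ^+ p * expsize i))).
  rewrite addnC big_split_ord/= lerDl; apply: sumr_ge0 => i _; exact: rim_mass_ge0.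
rewrite big_split_ord/=; apply: lerD.
  apply: (@le_trans _ _ (\sum_(i < p + 2) mass mu)).
    by apply: ler_sum => i _; apply: rim_mass_le_mass; rewrite mulr_gt0 ?exprn_gt0// expsize_gt0.
  by rewrite sumr_const card_ord mulr_natl lexx.
apply: le_trans (rim_sum_small n).
rewrite le_eqVlt; apply/orP; left; apply/eqP; apply: eq_bigr => i _; congr rim_mass.
rewrite /expsize -addnA exprD mulrA -exprMn mulfV// expr1n mul1r.
by rewrite -addn2 addnC.
Qed.

Lemma rim_mass_small p (e : R) : 0 < e -> exists n, rim_mass mu (2 ^+ p * expsize n) < e.
Proof.
move=> e0; apply: contrapT => h.
have h' n : e <= rim_mass mu (2 ^+ p * expsize n).
  by rewrite leNgt; apply/negP => hn; apply: h; exists n.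
have [C CP] := rim_sum p.
have := CP (`|Num.ceil (C / e)|).+1%N; apply/negP; rewrite -ltNge.
apply: (@lt_le_trans _ _ (\sum_(i < (`|Num.ceil (C / e)|).+1) e)); last first.
  by apply: ler_sum => i _; exact: h'.
rewrite sumr_const card_ord -mulr_natl -ltr_pdivrMr//.
apply: (@le_lt_trans _ _ (`|Num.ceil (C / e)|%N)%:R); last by rewrite ltr_nat.
by rewrite natr_absz (le_trans (ceil_ge _))// ler_int ler_norm.
Qed.

(** A set with empty interior is contained in its frontier, which is null here. *)
Lemma pos_volume_interior G : pos_volume G -> Leb (frontier (sval G)) = 0%E ->
  exists x (e : R), 0 < e /\ forall y, enorm (x - y) < e -> sval G y.
Proof.
move=> pG LG; have [I0|/set0P[x]] := eqVneq (interior (sval G)) set0.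
  have : (Leb (sval G) <= Leb (frontier (sval G)))%E.
    by apply: le_Leb => x Gx; rewrite /frontier I0 setD0; exact: subset_closure.
  by rewrite LG leNgt pG.
by move=> /(nbhs_enorm _ _ d0)[e e0 h]; exists x, e.
Qed.

Lemma pos_volume_lattice G : pos_volume G -> Leb (frontier (sval G)) = 0%E ->
  exists M (u : Zd) n, fullF (lat M u) n G.
Proof.
move=> pG LG; have [x [e [e0 h]]] := pos_volume_interior pG LG.
have [M Me] : exists M : nat, (0 < M)%N /\ d%:R * M%:R^-1 < e.
  exists (`|Num.ceil (d%:R / e)|).+1%N; split=> //.
  rewrite ltr_pdivrMr ?ltr0n// mulrC -ltr_pdivrMr//.
  apply: (@le_lt_trans _ _ (`|Num.ceil (d%:R / e)|%N)%:R); last by rewrite ltr_nat.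
  by rewrite natr_absz (le_trans (ceil_ge _))// ler_int ler_norm.
have [M0 dM] := Me; have MR : 0 < M%:R :> R by rewrite ltr0n.
pose u : Zd := \row_i Num.floor (M%:R * x ord0 i).
have ux : cube (lat M u) M%:R^-1 x.
  apply/lat_cubeP => // i; rewrite mxE; have /andP[-> /ltW] := floor_itv (M%:R * x ord0 i).
  by rewrite rmorphD.
have M1 : 0 <= M%:R^-1 :> R by rewrite invr_ge0 ltW.
have Gu : sval G (lat M u).
  by apply: h; apply: le_lt_trans (cube_enorm d0 M1 ux (cube_base _ M1)) dM.
have Gx : sval G x by apply: h; rewrite subrr enorm0.
(* A ball has two distinct points as d > 0, so the diameter is positive and lies in some dyadic
   range. *)
have dG : (0 < diam (sval G))%E.
  pose i0 : 'I_d := Ordinal d0.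
  pose y : V := x + (e / 2 / d%:R) *: const_mx 1.
  have ed : 0 < e / 2 / d%:R by rewrite !divr_gt0// ltr0n.
  have Gy : sval G y.
    apply: h; rewrite /y opprD addrA subrr sub0r enormN.
    apply: (@le_lt_trans _ _ (d%:R * (e / 2 / d%:R))).
      apply: enorm_le_coord => //; first exact: ltW.
      by move=> i; rewrite !mxE mulr1 gtr0_norm.
    rewrite mulrC divfK ?pnatr_eq0 -?lt0n//; lra.
  apply: lt_le_trans (le_diam Gx Gy); rewrite lte_fin.
  apply: lt_le_trans (coord_le_enorm _ i0).
  by rewrite normr_gt0 !mxE opprD addrA subrr sub0r oppr_eq0 mulr1 gt_eqF.
have fd : diam (sval G) \is a fin_num.
  by rewrite ge0_fin_numE ?diam_ge0// (lt_trans (svalP G))// ltry.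
have [|n hn] := @exists_shell (fine (diam (sval G))).
  by rewrite -!lte_fin fineK// dG; exact: (svalP G).
exists M, u, n; split=> //.
by move: hn; rewrite -lee_fin -lte_fin fineK.
Qed.

(** Apart from the sets whose frontier is not null, [pos_volume] is covered by the countably many
    families [full] at lattice points. By invariance these all have the mass [mass mu]. *)
Lemma mass_gt0 : 0 < mass mu.
Proof.
rewrite lt_neqAle mass_ge0 andbT; apply/eqP => m0.
pose A (k : nat) : set GF := match choice.unpickle k : option (nat * Zd * nat) with
  | Some (M, u, n) => fullF (lat M u) n | None => set0 end.
have A0 k : mu.-negligible (A k).
  rewrite /A; case: (choice.unpickle k) => [[[M u] n]|]; last exact: negligible_set0.
  have [mf ff] := full_finite hF h1 (lat M u) n.
  apply/negligibleP => //; transitivity (mu (fullF 0 0)).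
    exact: (full_scale hF mu_translation mu_scale h1).
  have [_ f0] := full_finite hF h1 0 0.
  by apply/eqP; rewrite -fine_eq0 ?ge0_fin_numE// -/(mass mu) -m0.
have : mu.-negligible (pos_volume : set GF).
  apply: (@negligibleS _ _ _ mu (pos_boundary `|` \bigcup_k A k)); last first.
    apply: negligibleU; last exact: negligible_bigcup.
    by apply/negligibleP; [exact: (suitable_pos_boundary hF)|exact: h2].
  move=> G pG; have [LG|LG] := eqVneq (Leb (frontier (sval G))) 0%E; last first.
    by left; rewrite /pos_boundary /= lt0e LG Leb_ge0.
  right; have [M [u [n fG]]] := pos_volume_lattice pG LG.
  by exists (choice.pickle (M, u, n)) => //; rewrite /A choice.pickleK.
move=> /(negligibleP _ (measurable_pos_volume hF)) h.
by move: h3; rewrite h ltxx.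
Qed.

End summability.

(** * Branching *)

(** A weak form of the second order Bonferroni inequality. *)
Lemma pow_onem_le (R : realType) (q : R) n : 0 <= q <= 1 ->
  (1 - q) ^+ n <= 1 - n%:R * q + (n%:R * q) ^+ 2.
Proof.
move=> /andP[q0 q1]; elim: n => [|n IH]; first by rewrite expr0 mul0r subr0 expr0n addr0.
rewrite exprSr; have q10 : 0 <= 1 - q by rewrite subr_ge0.
apply: le_trans (ler_wpM2r q10 IH) _; rewrite -natr1.
have n0 : 0 <= n%:R :> R by [].
set a : R := n%:R in n0 *; have := mulr_ge0 n0 q0.
have : 0 <= a ^+ 2 * q ^+ 3 by rewrite mulr_ge0 ?exprn_ge0.
have : 0 <= a * q ^+ 2 by rewrite mulr_ge0 ?exprn_ge0.
have : 0 <= q ^+ 2 by rewrite exprn_ge0.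
rewrite !expr2 exprS expr2; nra.
Qed.

(** The step of König's lemma: one of finitely many children works for every depth. *)
Lemma finite_pigeonhole (I : finType) (Q : I -> nat -> Prop) :
  (forall i n n', (n <= n')%N -> Q i n' -> Q i n) ->
  (forall n, exists i, Q i n) -> exists i, forall n, Q i n.
Proof.
move=> anti ex; apply: contrapT => /forallNP h.
have /choice[f fP] i : exists n, ~ Q i n by apply/existsNP; exact: h.
have [i Qi] := ex (\max_i f i)%N; apply: (fP i).
by apply: anti Qi; exact: leq_bigmax.
Qed.

Section branching.
Context {R : realType} {d : nat} {F : set (set (gset R d))}.
Local Notation GF := (g_sigma_algebraType F).
Context {dO : measure_display} {Omega : measurableType dO}.
Context (P : probability Omega R) (Phi : Omega -> configuration (R := R) (d := d)).
Context (nu : {measure set GF -> \bar R}).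
Hypothesis pp : poisson_process P Phi nu.
Implicit Types (A B : set GF).

(* The events [E i] are independent of each other and of all the [g i], about
   whose joint law nothing is known: adding one index at a time, the union gains
   at least a fraction [q] of what it lacks to reach [p]. *)
Lemma union_lower (I : eqType) (s : seq I) (g E : I -> set Omega) A (B : I -> set GF)
    (p q : R) :
  uniq s -> 0 <= q <= 1 ->
  (forall i, A `&` B i = set0) -> (forall i j, i != j -> B i `&` B j = set0) ->
  (forall i, sigma_void Phi nu A (g i)) -> (forall i, sigma_void Phi nu (B i) (E i)) ->
  (forall i, p <= prob P (g i)) -> (forall i, q <= prob P (E i)) ->
  p * (1 - (1 - q) ^+ size s) <= prob P (\big[setU/set0]_(i <- s) (g i `&` E i)).
Proof.
move=> + /andP[q0 q1] AB BB gA EB pg qE; elim: s => [|i s IH]/=.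
  by rewrite expr0 subrr mulr0 prob_ge0.
move=> /andP[ins us]; rewrite big_cons; have {}IH := IH us.
set U := \big[setU/set0]_(j <- s) _ in IH *.
have gm j : measurable (g j) by exact: (sigma_void_measurable pp (gA j)).
have Em j : measurable (E j) by exact: (sigma_void_measurable pp (EB j)).
pose C := A `|` [set G | exists2 j, j \in s & B j G].
have CU : sigma_void Phi nu C U.
  rewrite /U big_seq; apply: sigma_void_bigU => j js; apply: sigma_voidI.
    by apply: sigma_voidS (gA j) => G; left.
  by apply: sigma_voidS (EB j) => G BG; right; exists j.
have mU : measurable U by exact: (sigma_void_measurable pp CU).
have mgE : measurable (g i `&` E i) by exact: measurableI.
have CB : C `&` B i = set0.
  apply/seteqP; split=> // G [[AG| [j js BjG]] BiG].
    by rewrite -(AB i).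
  have ij : j != i by apply: contraNneq ins => <-.
  by rewrite -(BB _ _ ij).
have Cg : sigma_void Phi nu C (g i `&` ~` U).
  apply: sigma_voidI; first by apply: sigma_voidS (gA i) => G; left.
  exact: sigma_voidC.
have ind : indep P (g i `&` ~` U) (E i) by exact: (indep_sigma_void pp CB).
rewrite setUC probUl//.
have -> : (g i `&` E i) `\` U = (g i `&` ~` U) `&` E i.
  by rewrite setDE -!setIA [E i `&` _]setIC.
rewrite ind -setDE probD//.
have h1 : prob P (g i `&` U) <= prob P U by apply: le_prob => //; exact: measurableI.
have h2 := pg i; have h3 := qE i; have h4 := prob_le1 P (Em i).
have h5 := prob_ge0 P (E i).
have h6 : 0 <= prob P (g i) - prob P (g i `&` U).
  by rewrite subr_ge0; apply: le_prob => //; exact: measurableI.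
set u := prob P U in IH h1 *; set e := prob P (E i) in h3 h4 h5 *.
set x := prob P (g i) - _ in h6 *.
have xpu : p - u <= x by rewrite /x; lra.
have ue : u + (p - u) * q <= u + x * e.
  rewrite lerD2l; have [pu|pu] := leP p u.
    apply: (@le_trans _ _ 0); last exact: mulr_ge0.
    by rewrite mulr_le0_ge0// subr_le0.
  by apply: ler_pM => //; rewrite subr_ge0 ltW.
apply: le_trans ue.
have := ler_wpM2r (_ : 0 <= 1 - q) IH; rewrite subr_ge0 => /(_ q1).
by rewrite exprSr; lra.
Qed.

Lemma pair_lower (g1 g2 E1 E2 : set Omega) A (B1 B2 : set GF) :
  A `&` B1 = set0 -> A `&` B2 = set0 -> B1 `&` B2 = set0 ->
  sigma_void Phi nu A g1 -> sigma_void Phi nu A g2 ->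
  sigma_void Phi nu B1 E1 -> sigma_void Phi nu B2 E2 ->
  prob P ((g1 `&` E1) `&` (g2 `&` E2)) = prob P (g1 `&` g2) * (prob P E1 * prob P E2).
Proof.
move=> AB1 AB2 BB g1A g2A E1B E2B.
have AB : A `&` (B1 `|` B2) = set0 by rewrite setIUr AB1 AB2 setU0.
rewrite setIACA (indep_sigma_void pp AB).
- by rewrite (indep_sigma_void pp BB E1B E2B).
- exact: sigma_voidI.
- apply: sigma_voidI.
    by apply: sigma_voidS E1B => G; left.
  by apply: sigma_voidS E2B => G; right.
Qed.

End branching.

Lemma big_setUP (I : finType) (W : Type) (Q : pred I) (E : I -> set W) (w : W) :
  (\big[setU/set0]_(i | Q i) E i) w <-> exists2 i, Q i & E i w.
Proof.
rewrite -bigcup_seq_cond; split=> [[i /= /andP[_ Qi] Ei]|[i Qi Ei]]; first by exists i.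
by exists i => //=; rewrite mem_index_enum.
Qed.

(** The mean number n p of good children is at least 2, and n q <= 1/4 costs at most a quarter of
    it: a factor 2 * 3/4 = 3/2 per generation. *)
Lemma branching_gain (R : realType) (p q n x : R) : 0 < p -> 0 < q -> 2 <= n * p ->
  n * q <= 4^-1 -> x <= 1 - n * q + (n * q) ^+ 2 -> 3 / 2 * q <= p * (1 - x).
Proof.
move=> p0 q0 np nq hx.
have n0 : 0 < n by rewrite -(pmulr_lgt0 _ p0); apply: lt_le_trans np.
have nq0 : 0 < n * q by rewrite mulr_gt0.
apply: (@le_trans _ _ (p * (n * q * (3 / 4)))).
  have : 2 * q <= n * p * q by rewrite ler_pM2r.
  by move=> ?; lra.
rewrite ler_pM2l//; rewrite expr2 in hx; nra.
Qed.

(** * The tree of surviving cubes *)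

Section survival.
Context {R : realType} {d : nat}.
Local Notation V := 'rV[R]_d.
Local Notation gset := (gset R d).
Context {F : set (set gset)} (hF : suitable F).
Local Notation GF := (g_sigma_algebraType F).
Context (mu : {measure set GF -> \bar R}).
Hypotheses (mu_translation : translation_invariant mu)
  (mu_scale : semi_scale_invariant mu) (h1 : locally_finite_hits mu).
Context {dO : measure_display} {Omega : measurableType dO}.
Context (P : probability Omega R) (Phi : Omega -> configuration (R := R) (d := d)).
Context (lambda : R) (lambda_gt0 : 0 < lambda) (nu : {measure set GF -> \bar R}).
Hypotheses (nuE : forall D : set GF, nu D = (lambda%:E * mu D)%E)
  (pp : poisson_process P Phi nu).
Local Notation expsize := (@expsize R).
Local Notation hitrF := (@hitr R d F).
Local Notation sigmaV := (@sigma_void R d F dO Omega Phi nu).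
Local Notation voidF := (@void R d F dO Omega Phi).
Implicit Types (x y : V) (s r : R) (D : set GF).

Lemma finite_mass_nu D : finite_mass mu D -> finite_mass nu D.
Proof.
move=> [mD fD]; split=> //; rewrite nuE lte_mul_pinfty// ?lee_fin ?ltW//.
Qed.

Lemma prob_void_mu D : finite_mass mu D -> prob P (void Phi D) = expR (- (lambda * fine (mu D))).
Proof.
move=> fD; rewrite (prob_void pp (finite_mass_nu fD)) nuE fineM//.
by rewrite ge0_fin_numE//; exact: fD.2.
Qed.

Lemma prob_void_ge D (t : R) : finite_mass mu D -> fine (mu D) <= t ->
  expR (- (lambda * t)) <= prob P (void Phi D).
Proof. by move=> fD Dt; rewrite prob_void_mu// ler_expR lerN2 ler_pM2l. Qed.

(** Bounds the mass of the sets from m consecutive dyadic ranges that hit a cube whose side is the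
    smallest diameter in question; for the j-th range the side is 2^-(m-j) in units of the upper end
    of the diameters. *)
Definition hits_sum m : R := \sum_(j < m) hit_mass mu (expsize (m - j)).

Lemma hitr_cube_finite x s a b : 0 < a -> 0 < b -> finite_mass mu (hitrF (cube x s) a b).
Proof. by move=> a0 b0; apply: hitr_finite => //; [exact: closed_cube|exact: cube_bounded]. Qed.

Lemma hitr_mass_le x a m :
  fine (mu (hitrF (cube x (expsize (a + m))) (expsize (a + m)) (expsize a))) <= hits_sum m.
Proof.
have fH := hitr_cube_finite x (expsize (a + m)) (@expsize_gt0 R (a + m)) (@expsize_gt0 R a).
pose H j : set GF := hit x (expsize (a + m)) (a + j).
have fHj j : finite_mass mu (H j) by exact: (hit_finite hF h1).
rewrite -lee_fin fineK; last by rewrite ge0_fin_numE//; exact: fH.2.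
apply: (@le_trans _ _ (mu (\big[setU/set0]_(j < m) H j))).
  apply: le_measure.
  - by apply/mem_set; exact: fH.1.
  - by apply/mem_set/bigsetU_measurable => j _; exact: (fHj j).1.
  move=> G [hG /andP[da db]].
  have fd : diam (sval G) \is a fin_num.
    by rewrite ge0_fin_numE ?diam_ge0// (lt_trans (svalP G))// ltry.
  move: da db; rewrite -(fineK fd) lee_fin lte_fin => da db.
  have [|n /andP[n1 n2]] := @exists_shell R (fine (diam (sval G))).
    rewrite (lt_le_trans (@expsize_gt0 R (a + m)) da)/= -lte_fin fineK//; exact: (svalP G).
  have an : (a <= n)%N.
    rewrite leqNgt; apply/negP => na.
    by have := lt_le_trans db (le_trans (expsize_anti na) n1); rewrite ltxx.
  have nm : (n - a < m)%N.
    rewrite ltn_subLR// ltnNge; apply/negP => na.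
    by have := lt_le_trans n2 (le_trans (expsize_anti na) da); rewrite ltxx.
  rewrite -bigcup_mkord; exists (n - a)%N => //; split=> //.
  by rewrite subnKC// -(fineK fd) lee_fin lte_fin n1.
apply: (@le_trans _ _ (\sum_(j < m) mu (H j))).
  by apply: Boole_inequality => j *; exact: (fHj j).1.
rewrite /hits_sum -sumEFin; apply: lee_sum => j _.
rewrite /hit_mass fineK; last by rewrite ge0_fin_numE//; exact: (hit_finite hF h1 _ _ _).2.
rewrite /H -(hit_scale hF mu_translation mu_scale h1 x _ (a + j)).
by rewrite /expsize -exprD -addnA subnKC// ltnW.
Qed.

Context (m : nat) (T : nat).
Definition side l : R := expsize (m * l).
Local Notation index := {ffun 'I_d -> 'I_(2 ^ m.-1)}.

(* Children of a cube are separated by gaps of their own side, which is an upper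
   bound for the diameters of all sets considered further down the tree. *)
Definition child l x (z : index) : V := x + (2 * side l.+1) *: \row_i (z i)%:R.

(** Here x is the corner of a cube of level [l.+1], and the diameters lie between its side and the
    side of its parent. *)
Definition shell_hits l x : set GF := hitrF (cube x (side l.+1)) (side l.+1) (side l).

Definition good l x : set Omega := voidF (shell_hits l x).

(** Survival to depth n below the cube of level l at x. The counter k is the number of generations
    before the next one that needs two surviving children; it is then reset to T. At finite depth
    the event is a finite combination of void events. *)
Fixpoint tree (k l n : nat) (x : V) : set Omega :=
  match n with
  | 0 => setT
  | n.+1 =>
    let E k' z := good l (child l x z) `&` tree k' l.+1 n (child l x z) in
    match k with
    | 0 => \big[setU/set0]_(zz : index * index | zz.1 != zz.2) (E T zz.1 `&` E T zz.2)
    | k'.+1 => \big[setU/set0]_(z : index) E k' z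
    end
  end.

(** What the tree below x depends on ([tree_sigma]). The zones of two children are disjoint, since
    their sets are smaller than the gap; [ring_zone] is the part that decides which children are
    good. *)
Definition zone l x : set GF :=
  [set G | sval G `&` cube x (side l) !=set0 /\ (diam (sval G) < (side l)%:E)%E].

Definition ring_zone l x : set GF :=
  [set G | sval G `&` cube x (side l) !=set0 /\
    ((side l.+1)%:E <= diam (sval G) < (side l)%:E)%E].

Lemma side_gt0 l : 0 < side l. Proof. exact: expsize_gt0. Qed.

Hypothesis m_gt0 : (0 < m)%N.

Lemma side_children l : side l = 2 * side l.+1 * (2 ^ m.-1)%:R.
Proof.
rewrite /side /expsize mulnS -{2}(prednK m_gt0) addSn exprS exprD natrX.
have : (2^-1 : R) ^+ m.-1 * 2 ^+ m.-1 = 1 by rewrite -exprMn mulVf// expr1n.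
set a : R := 2^-1 ^+ m.-1; set b : R := 2 ^+ m.-1; set c := _ ^+ (m * l) => ab.
by rewrite [2 * _]mulrA mulfV// mul1r [a * c]mulrC -mulrA ab mulr1.
Qed.

Lemma side_anti l : side l.+1 <= side l.
Proof. by apply: expsize_anti; rewrite leq_mul2l leqnSn orbT. Qed.

Lemma child_cube l x z : cube (child l x z) (side l.+1) `<=` cube x (side l).
Proof.
move=> y yz i; have := yz i; rewrite !mxE (side_children l).
have s0 := side_gt0 l.+1; set s := side l.+1 in s0 *.
have : (z i).+1%:R <= (2 ^ m.-1)%:R :> R by rewrite ler_nat.
rewrite -natr1; have : 0 <= (z i)%:R :> R by [].
set a := (z i)%:R; set b := (2 ^ m.-1)%:R => a0 ab /andP[y1 y2].
have h1' : s * (a + 1) <= s * b by rewrite ler_pM2l.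
have h2' : 0 <= s * a by rewrite mulr_ge0// ltW.
by apply/andP; split; lra.
Qed.

Lemma children_apart l x z z' y y' : z != z' ->
  cube (child l x z) (side l.+1) y -> cube (child l x z') (side l.+1) y' ->
  side l.+1 <= enorm (y - y').
Proof.
move=> zz' yz yz'; have [i zi] : exists i, z i != z' i.
  apply: contrapT => /forallNP h; move/eqP: zz'; apply; apply/ffunP => i.
  by apply/eqP; apply: contra_notT (h i).
apply: le_trans (coord_le_enorm _ i); have := yz i; have := yz' i; rewrite !mxE.
have s0 := side_gt0 l.+1; set s := side l.+1 in s0 *.
have {}zi : (z i < z' i)%N || (z' i < z i)%N by rewrite -neq_ltn.
have : ((z i)%:R + 1 <= (z' i)%:R :> R) \/ ((z' i)%:R + 1 <= (z i)%:R :> R).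
  by case/orP: zi => zi; [left|right]; rewrite natr1 ler_nat.
set a := (z i)%:R; set b := (z' i)%:R => ab /andP[? ?] /andP[? ?]; rewrite ler_normr.
case: ab => ab; apply/orP; [right|left].
  by have : s * (a + 1) <= s * b by [rewrite ler_pM2l]; lra.
by have : s * (b + 1) <= s * a by [rewrite ler_pM2l]; lra.
Qed.

Lemma zone_children_disjoint l x z z' : z != z' ->
  zone l.+1 (child l x z) `&` zone l.+1 (child l x z') = set0.
Proof.
move=> zz'; apply/seteqP; split=> // G [[[y [Gy yz]] dG] [[y' [Gy' yz']] _]].
have := le_lt_trans (le_diam Gy Gy') dG.
by rewrite lte_fin ltNge (children_apart zz' yz yz').
Qed.

Lemma ring_zone_child_disjoint l x z :
  ring_zone l x `&` zone l.+1 (child l x z) = set0.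
Proof.
apply/seteqP; split=> // G [[_ /andP[a _]] [_ b]].
by have := le_lt_trans a b; rewrite ltxx.
Qed.

Lemma shell_hits_finite l x : finite_mass mu (shell_hits l x).
Proof. by apply: hitr_cube_finite; exact: side_gt0. Qed.

Lemma good_sigma l x z : sigmaV (ring_zone l x) (good l (child l x z)).
Proof.
apply: sigma_void_void; first exact/finite_mass_nu/shell_hits_finite.
move=> G [[y [Gy yz]] hG]; split=> //; exists y; split=> //.
exact: child_cube yz.
Qed.

Lemma ring_zone_sub l x : ring_zone l x `<=` zone l x.
Proof. by move=> G [hG /andP[_ ?]]; split. Qed.

Lemma zone_child_sub l x z : zone l.+1 (child l x z) `<=` zone l x.
Proof.
move=> G [[y [Gy yz]] dG]; split.
  by exists y; split=> //; exact: child_cube yz.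
by apply: lt_le_trans dG _; rewrite lee_fin side_anti.
Qed.

Lemma tree_sigma k l n x : sigmaV (zone l x) (tree k l n x).
Proof.
elim: n k l x => [|n IH] k l x /=; first exact: sigma_voidT.
have gt k' z : sigmaV (zone l x) (good l (child l x z) `&` tree k' l.+1 n (child l x z)).
  apply: sigma_voidI.
    by apply: (@sigma_voidS _ _ _ _ _ _ _ (ring_zone l x)); [exact: ring_zone_sub|exact: good_sigma].
  by apply: (@sigma_voidS _ _ _ _ _ _ _ (zone l.+1 (child l x z))); [exact: zone_child_sub|exact: IH].
case: k => [|k]; apply: sigma_void_bigU => z _ //.
exact: sigma_voidI.
Qed.

Lemma tree_measurable k l n x : measurable (tree k l n x).
Proof. exact: (sigma_void_measurable pp (@tree_sigma k l n x)). Qed.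

Let p : R := expR (- (lambda * hits_sum m)).

Lemma good_prob l x : p <= prob P (good l x).
Proof.
apply: prob_void_ge; first exact: shell_hits_finite.
have := hitr_mass_le x (m * l) m.
by rewrite /shell_hits /side mulnS [(m + _)%N]addnC.
Qed.

Lemma good2_prob l x y : p ^+ 2 <= prob P (good l x `&` good l y).
Proof.
rewrite /good -voidU /p expr2 -expRD -opprD -mulrDr.
have fx := shell_hits_finite l x; have fy := shell_hits_finite l y.
apply: prob_void_ge; first exact: finite_massU.
have hx := hitr_mass_le x (m * l) m; have hy := hitr_mass_le y (m * l) m.
have fU := finite_massU fx fy.
apply: (@le_trans _ _ (fine (mu (shell_hits l x)) + fine (mu (shell_hits l y)))); last first.
  by apply: lerD; [move: hx|move: hy]; rewrite /shell_hits /side mulnS [(m + _)%N]addnC.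
rewrite -fineD ?ge0_fin_numE//; [|exact: fx.2|exact: fy.2].
apply: fine_le; rewrite ?ge0_fin_numE//; first exact: fU.2.
- by apply: lte_add_pinfty; [exact: fx.2|exact: fy.2].
- exact: adde_ge0.
- exact: (measureU2 mu fx.1 fy.1).
Qed.

Context (N : nat) (N_card : #|{: index}| = N).
(** The cap [rho] keeps N q <= 1/4 for [branching_gain]. A generation with two required children has
    probability at least [kappa]: p^2 for the two good children, rho^2 for their trees. T
    generations of growth 3/2 then lead from [kappa] back to [rho]. *)
Let rho : R := (4 * N%:R)^-1.
Let kappa : R := p ^+ 2 * rho ^+ 2.
Hypotheses (N_gt1 : (1 < N)%N) (Np : 2 <= N%:R * p) (rho_kappa : rho <= kappa * (3 / 2) ^+ T).

Let p_gt0 : 0 < p. Proof. exact: expR_gt0. Qed.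

Let p_le1 : p <= 1.
Proof.
rewrite expR_le1 oppr_le0; apply: mulr_ge0; first exact: ltW.
apply: sumr_ge0 => j _.
by rewrite fine_ge0.
Qed.

Let rho_gt0 : 0 < rho.
Proof. by rewrite invr_gt0 mulr_gt0// ltr0n ltnW. Qed.

Let rhoN : N%:R * rho = 4^-1.
Proof. by rewrite /rho invfM mulrCA mulfV ?mulr1// pnatr_eq0 -lt0n ltnW. Qed.

Let rho_le1 : rho <= 1.
Proof.
have : 1 <= N%:R :> R by rewrite ler1n ltnW.
by have := rhoN; have := rho_gt0 => ? ? ?; nra.
Qed.

(** Independent of the depth and of the level: this is what the induction on the depth preserves. *)
Definition tree_bound k : R := Num.min rho (kappa * (3 / 2) ^+ k).

Let kappa_gt0 : 0 < kappa.
Proof. by rewrite mulr_gt0// exprn_gt0. Qed.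

Let kappa_le_rho : kappa <= rho.
Proof.
have p2 : p ^+ 2 <= 1 by apply: exprn_ile1 => //; exact: ltW.
have r2 : rho ^+ 2 <= rho by rewrite expr2; apply: ler_piMr => //; exact: ltW.
apply: le_trans r2; rewrite /kappa; apply: ler_piMl => //.
by apply: exprn_ge0; exact: ltW.
Qed.

Lemma tree_bound_gt0 k : 0 < tree_bound k.
Proof. by rewrite lt_min rho_gt0/= mulr_gt0// exprn_gt0. Qed.

Lemma tree_prob k l n x : tree_bound k <= prob P (tree k l n x).
Proof.
have tb1 j : tree_bound j <= 1 by rewrite (le_trans _ rho_le1)// ge_min lexx.
have tr j : tree_bound j <= rho by rewrite ge_min lexx.
elim: n k l x => [|n IH] k l x; first by rewrite /= probT.
have AB z : ring_zone l x `&` zone l.+1 (child l x z) = set0 by exact: ring_zone_child_disjoint.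
have BB z z' : z != z' -> zone l.+1 (child l x z) `&` zone l.+1 (child l x z') = set0.
  exact: zone_children_disjoint.
have gA z := @good_sigma l x z.
have EB k' z := @tree_sigma k' l.+1 n (child l x z).
have mg z : measurable (good l (child l x z)) by exact: (sigma_void_measurable pp (gA z)).
case: k => [|k].
  have [z1 [z2 z12]] : exists z1 z2 : index, z1 != z2.
    have [z1 [z2 [_ _ z12]]] := card_gt1P (eq_ind_r (fun n => 1 < n)%N N_gt1 N_card).
    by exists z1, z2.
  pose E0 z := good l (child l x z) `&` tree T l.+1 n (child l x z).
  (* Two fixed children already give the required bound. *)
  apply: (@le_trans _ _ (prob P (E0 z1 `&` E0 z2))); last first.
    apply: le_prob.
    - by apply: measurableI; apply: measurableI => //; exact: tree_measurable.
    - exact: tree_measurable.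
    by move=> w Ew; apply/big_setUP; exists (z1, z2).
  rewrite (pair_lower pp (AB z1) (AB z2) (BB _ _ z12) (gA z1) (gA z2) (EB T z1) (EB T z2)).
  have tT : tree_bound T = rho by rewrite /tree_bound min_l.
  rewrite /tree_bound expr0 mulr1 min_r//.
  have r0 := ltW rho_gt0; have p0 := ltW p_gt0.
  apply: ler_pM; [exact: exprn_ge0|exact: exprn_ge0|exact: good2_prob|].
  by rewrite expr2; apply: ler_pM => //; rewrite -tT; exact: IH.
have gp z : p <= prob P (good l (child l x z)) by exact: good_prob.
have EP z : tree_bound k <= prob P (tree k l.+1 n (child l x z)) by exact: IH.
have q01 : 0 <= tree_bound k <= 1 by rewrite tb1 (ltW (tree_bound_gt0 k)).
have := union_lower pp (enum_uniq index) q01 AB BB gA (EB k) gp EP.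
rewrite -cardE N_card big_enum /= => /(le_trans _); apply.
have h := pow_onem_le N q01; have qr := tr k; have q0 := tree_bound_gt0 k.
have h32 : tree_bound k.+1 <= 3 / 2 * tree_bound k.
  rewrite /tree_bound exprSr [kappa * (_ * _)]mulrA minr_pMr; last by rewrite divr_ge0.
  rewrite le_min; apply/andP; split; rewrite ge_min; apply/orP.
    left; apply: (ler_peMl (ltW rho_gt0)).
    by rewrite ler_pdivlMr// mul1r ler_nat.
  by right; rewrite [leLHS]mulrC lexx.
apply: le_trans h32 _; apply: (branching_gain p_gt0 q0 Np _ h).
by rewrite -rhoN ler_pM2l// ltr0n ltnW.
Qed.

Lemma treeS_sub k l n x : tree k l n.+1 x `<=` tree k l n x.
Proof.
elim: n k l x => [|n IH] k l x; first by [].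
have IH' k' z : good l (child l x z) `&` tree k' l.+1 n.+1 (child l x z) `<=`
    good l (child l x z) `&` tree k' l.+1 n (child l x z).
  by apply: setIS; exact: IH.
(* Unfolds a single level, so that the subtrees keep the depth [n.+1] of the induction
   hypothesis. *)
rewrite -[tree k l n.+2 x]/(let E k' z := good l (child l x z) `&`
    tree k' l.+1 n.+1 (child l x z) in
  match k with
  | 0 => \big[setU/set0]_(zz : index * index | zz.1 != zz.2) (E T zz.1 `&` E T zz.2)
  | k'.+1 => \big[setU/set0]_(z : index) E k' z
  end).
rewrite [tree k l n.+1 x]/=.
case: k => [|k] /=.
  move=> w /big_setUP[zz zz12 [E1 E2]]; apply/big_setUP; exists zz => //.
  by split; exact: IH'.
by move=> w /big_setUP[z _ Ez]; apply/big_setUP; exists z => //; exact: IH'.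
Qed.

Definition surv k l x : set Omega := [set w | forall n, tree k l n x w].

Lemma tree_sub k l n n' x : (n <= n')%N -> tree k l n' x `<=` tree k l n x.
Proof.
move=> /subnK <-; elim: (n' - n)%N => // j IH w.
by rewrite addSn => /treeS_sub; exact: IH.
Qed.

Lemma surv_next k l x w : surv k.+1 l x w ->
  exists z, good l (child l x z) w /\ surv k l.+1 (child l x z) w.
Proof.
move=> sw.
have [|n|z zP] := @finite_pigeonhole index (fun z n =>
    (good l (child l x z) `&` tree k l.+1 n (child l x z)) w).
- by move=> z n n' nn' [gz tz]; split=> //; exact: tree_sub tz.
- by have /big_setUP[z _ Ez] := sw n.+1; exists z.
by exists z; split=> [|n]; [exact: (zP 0%N).1|exact: (zP n).2].
Qed.

Lemma surv_split l x w : surv 0 l x w -> exists z z', [/\ z != z',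
  good l (child l x z) w /\ surv T l.+1 (child l x z) w &
  good l (child l x z') w /\ surv T l.+1 (child l x z') w].
Proof.
move=> sw.
have [|n|[z z'] zP] := @finite_pigeonhole (index * index)%type (fun zz n => zz.1 != zz.2 /\
    ((good l (child l x zz.1) `&` tree T l.+1 n (child l x zz.1)) `&`
     (good l (child l x zz.2) `&` tree T l.+1 n (child l x zz.2))) w).
- move=> zz n n' nn' [zz12 [[g1 t1] [g2 t2]]]; split=> //.
  by split; split=> //; [exact: tree_sub t1|exact: tree_sub t2].
- by have /big_setUP[zz zz12 Ez] := sw n.+1; exists zz.
exists z, z'; split; first by have [] := zP 0%N.
  by split=> [|n]; [have [_ [[]]] := zP 0%N|have [_ [[]]] := zP n].
by split=> [|n]; [have [_ [_ []]] := zP 0%N|have [_ [_ []]] := zP n].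
Qed.

(** The goodness accumulated along a line from level a down to the cube of level b at x. *)
Definition clear a b x : set Omega := [set w | forall n G, Phi w n = Some G ->
  sval G `&` cube x (side b) !=set0 -> ~ ((side b)%:E <= diam (sval G) < (side a)%:E)%E].

Lemma clear_good l x w : good l x w -> clear l l.+1 x w.
Proof. by move=> gw n G E hG dG; apply: (gw _ _ E). Qed.

Lemma clear_trans a b c x y w : cube y (side c) `<=` cube x (side b) ->
  clear a b x w -> clear b c y w -> clear a c y w.
Proof.
move=> yx ab bc n G E hG /andP[dc da].
have [db|db] := leP (side b)%:E (diam (sval G)); last first.
  by apply: (bc _ _ E hG); rewrite dc.
apply: (ab _ _ E); last by rewrite db.
by case: hG => t [Gt yt]; exists t; split=> //; exact: yx.
Qed.

Lemma surv_descend k l x w : surv k l x w -> exists y,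
  [/\ surv 0 (l + k) y w, cube y (side (l + k)) `<=` cube x (side l) & clear l (l + k) y w].
Proof.
elim: k l x => [|k IH] l x sw.
  exists x; rewrite addn0; split=> // n G _ _ /andP[a b].
  by have := le_lt_trans a b; rewrite ltxx.
have [z [gz sz]] := surv_next sw; have [y [sy yz cy]] := IH _ _ sz.
exists y; rewrite addnS -addSn; split=> //.
  by apply: subset_trans yz _; exact: child_cube.
exact: clear_trans yz (clear_good gz) cy.
Qed.

(** The two surviving children are disjoint cubes, so one of them misses t; follow it down to the
    next splitting generation. *)
Lemma surv_avoid l x w (t : V) : surv 0 l x w -> exists y,
  [/\ surv 0 (l + T.+1) y w, cube y (side (l + T.+1)) `<=` cube x (side l),
      clear l (l + T.+1) y w & ~ cube y (side (l + T.+1)) t].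
Proof.
move=> sw; have [z1 [z2 [z12 [g1 s1] [g2 s2]]]] := surv_split sw.
have [z [gz sz tz]] : exists z, [/\ good l (child l x z) w,
    surv T l.+1 (child l x z) w & ~ cube (child l x z) (side l.+1) t].
  have [t1|t1] := pselect (cube (child l x z1) (side l.+1) t); last by exists z1.
  exists z2; split=> // t2; have := children_apart z12 t1 t2.
  by rewrite subrr enorm0 leNgt side_gt0.
have [y [sy yz cy]] := surv_descend sz.
exists y; rewrite addnS -addSn; split=> //.
- by apply: subset_trans yz _; exact: child_cube.
- exact: clear_trans yz (clear_good gz) cy.
- by move=> /yz.
Qed.

Lemma nested_cubes (x : nat -> V) (s : nat -> R) :
  (forall j, 0 <= s j) ->
  (forall j, cube (x j.+1) (s j.+1) `<=` cube (x j) (s j)) ->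
  exists y, forall j, cube (x j) (s j) y.
Proof.
move=> s0 xx.
have sub i j : cube (x (i + j)%N) (s (i + j)%N) `<=` cube (x i) (s i).
  elim: j => [|j IH]; first by rewrite addn0.
  by rewrite addnS; exact: subset_trans (xx _) IH.
have xj i j : cube (x i) (s i) (x (i + j)%N) by apply: sub; exact: cube_base.
have ub i j k : x j ord0 k <= x i ord0 k + s i.
  have [ij|ji] := leqP i j.
    by have /andP[] := xj i (j - i)%N k; rewrite subnKC.
  have /andP[h _] := xj j (i - j)%N k; rewrite (subnKC (ltnW ji)) in h.
  by apply: le_trans h _; rewrite lerDl.
exists (\row_k sup [set x j ord0 k | j in setT]) => j k; rewrite mxE; apply/andP; split.
  apply: ub_le_sup; last by exists j.
  by exists (x 0%N ord0 k + s 0%N) => _ [i _ <-]; exact: ub.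
by apply: ge_sup; [exists (x 0%N ord0 k); exists 0%N|move=> _ [i _ <-]; exact: ub].
Qed.

(** The cubes chosen at successive splittings shrink to a point y. A set of positive diameter
    containing y contradicts [clear] at the first splitting whose side is at most its diameter. A
    set of diameter 0 has some rank n in the enumeration, and the n-th choice has avoided its only
    point. *)
Lemma surv_fractal w : surv 0 0 0 w -> fractal (Phi w) !=set0.
Proof.
move=> sw.
(* The only point of the n-th set if it has diameter 0 and is nonempty; in the other cases avoiding
   this point does no harm. *)
pose pt n : V := if Phi w n is Some G then xget 0 (sval G) else 0.
have /choice[next nextP] (jx : nat * V) : exists y,
    surv 0 (jx.1 * T.+1) jx.2 w ->
    [/\ surv 0 (jx.1.+1 * T.+1) y w,
      cube y (side (jx.1.+1 * T.+1)) `<=` cube jx.2 (side (jx.1 * T.+1)),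
      clear (jx.1 * T.+1) (jx.1.+1 * T.+1) y w &
      ~ cube y (side (jx.1.+1 * T.+1)) (pt jx.1)].
  case: jx => j x /=.
  have [sx|nsx] := pselect (surv 0 (j * T.+1) x w); last by exists x.
  have [y] := surv_avoid (pt j) sx; rewrite [(j * _ + _)%N]addnC -mulSn => h.
  by exists y.
pose x := fix x j : V := if j is j'.+1 then next (j', x j') else 0.
have xs j : surv 0 (j * T.+1) (x j) w.
  by elim: j => [|j IH] //; have [] := nextP (j, x j) IH.
have xP j := nextP (j, x j) (xs j).
have [y yx] := @nested_cubes x (fun j => side (j * T.+1))
  (fun j => ltW (side_gt0 _)) (fun j => let: And4 _ h _ _ := xP j in h).
exists y => -[n [G [E Gy]]].
have [dG|dG] := eqVneq (diam (sval G)) 0%E.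
  have [_ _ _] := xP n; apply; rewrite /= /pt E.
  have Gt : sval G (xget 0 (sval G)) by apply: (xgetPex 0); exists y.
  have : enorm (y - xget 0 (sval G)) <= 0 by have := le_diam Gy Gt; rewrite dG lee_fin.
  move=> e0; suff <- : y = xget 0 (sval G) by exact: yx n.+1.
  apply/rowP => i; apply/eqP; rewrite -subr_eq0 -normr_le0.
  have := coord_le_enorm (y - xget 0 (sval G)) i; rewrite !mxE.
  by move=> /le_trans; apply.
have fd : diam (sval G) \is a fin_num.
  by rewrite ge0_fin_numE ?diam_ge0// (lt_trans (svalP G))// ltry.
have d_gt0 : 0 < fine (diam (sval G)).
  by rewrite -lte_fin fineK// lt0e dG diam_ge0.
have ex : exists j, side (j * T.+1) <= fine (diam (sval G)).
  have [j hj] := expsize_small d_gt0; exists j; apply: le_trans (ltW hj).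
  by apply: expsize_anti; rewrite mulnCA leq_pmulr// muln_gt0 m_gt0.
(* The initial cube has side 1, which exceeds every diameter, so the first such index is
   positive. *)
case: (ex_minnP ex) => -[|j] jd jmin.
  have := svalP G; rewrite ltNge => /negP; apply.
  by move: jd; rewrite mul0n /side muln0 /expsize expr0 -lee_fin fineK.
have [_ _ cl _] := xP j; apply: (cl _ _ E); first by exists y; split=> //; exact: yx j.+1.
rewrite -(fineK fd) lee_fin jd/= lte_fin ltNge; apply/negP => /jmin.
by rewrite ltnn.
Qed.

(** The lower bound is uniform in the depth, so by continuity from above it holds for survival at
    all depths, which excludes emptiness. *)
Lemma survival : prob P (empty_event Phi) < 1 \/ ~ measurable (empty_event Phi).
Proof.
have [me|] := pselect (measurable (empty_event Phi)); [left|by right].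
pose S := \bigcap_n tree 0 0 n 0.
have mS : measurable S by apply: bigcapT_measurable => n; exact: tree_measurable.
have Sge : tree_bound 0 <= prob P S.
  have cv : P (tree 0 0 n 0) @[n --> \oo] --> P S.
    apply: nonincreasing_cvg_mu => //.
    - by rewrite -ge0_fin_numE// fin_num_measure//; exact: tree_measurable.
    - by move=> n; exact: tree_measurable.
    - by apply/nonincreasing_seqP => n; apply/subsetPset; exact: treeS_sub.
  rewrite -lee_fin -probE//; apply: cvge_ge cv; apply: nearW => n.
  by rewrite probE; [rewrite lee_fin; exact: tree_prob|exact: tree_measurable].
have SE : S `<=` ~` empty_event Phi.
  move=> w Sw ew; have [y fy] := @surv_fractal w (fun n => Sw n I).
  by move: fy; rewrite ew.
have : prob P S <= prob P (~` empty_event Phi).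
  by apply: le_prob => //; exact: measurableC.
by rewrite probC//; have := tree_bound_gt0 0; lra.
Qed.

End survival.

Lemma pow_three_halves (R : realType) n : 1 + n%:R / 2 <= (3 / 2 : R) ^+ n.
Proof.
elim: n => [|n IH]; first by rewrite mul0r addr0 expr0.
rewrite exprSr -natr1; have : 0 <= n%:R :> R by [].
by move=> n0; nra.
Qed.

Lemma archi_nat (R : realType) (x : R) : exists n, forall k, (n <= k)%N -> x <= k%:R.
Proof.
exists `|Num.ceil x|%N => k nk; apply: (@le_trans _ _ (`|Num.ceil x|%N)%:R).
  by rewrite natr_absz (le_trans (ceil_ge _))// ler_int ler_norm.
by rewrite ler_nat.
Qed.

(** * Below the threshold *)

Section subcritical.
Context {R : realType} {d : nat} (d0 : (0 < d)%N).
Local Notation V := 'rV[R]_d.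
Local Notation gset := (gset R d).
Context {F : set (set gset)} (hF : suitable F).
Local Notation GF := (g_sigma_algebraType F).
Context (mu : {measure set GF -> \bar R}).
Hypotheses (mu_translation : translation_invariant mu)
  (mu_scale : semi_scale_invariant mu) (h1 : locally_finite_hits mu)
  (h2 : mu pos_boundary = 0%E).
Context {dO : measure_display} {Omega : measurableType dO}.
Context (P : probability Omega R) (Phi : Omega -> configuration (R := R) (d := d)).
Context (lambda : R) (lambda_gt0 : 0 < lambda) (nu : {measure set GF -> \bar R}).
Hypotheses (nuE : forall D : set GF, nu D = (lambda%:E * mu D)%E)
  (pp : poisson_process P Phi nu).
Local Notation expsize := (@expsize R).

Lemma hit_mass_expsize (e : R) : 0 < e -> exists N, forall i, (N <= i)%N ->
  hit_mass mu (expsize i) <= mass mu + e.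
Proof.
move=> e0; have [N NP] := hit_mass_cvg d0 hF mu_translation mu_scale h1 h2 e0.
exists N => i Ni; rewrite /expsize exprVn -natrX; apply: NP; last by rewrite expn_gt0.
by apply: leq_trans Ni _; apply: ltnW; exact: ltn_expl.
Qed.

Lemma children_count m : #|{ffun 'I_d -> 'I_(2 ^ m.-1)}| = (2 ^ (m.-1 * d))%N.
Proof. by rewrite card_ffun !card_ord expnM. Qed.

(** Each of the last k dyadic ranges contributes d ln 2 to the logarithm of the number of children
    and at most d ln 2 - [gam] to the exponent of survival. The N ranges where [hit_mass] is not yet
    close to [mass], and the factor 2^d lost to the gaps between children, are bounded costs that k
    [gam] outweighs. *)
Lemma many_children : lambda * mass mu < d%:R * ln 2 ->
  exists m, (1 < m)%N /\
    2 <= #|{ffun 'I_d -> 'I_(2 ^ m.-1)}|%:R * expR (- (lambda * hits_sum mu m)).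
Proof.
move=> lm; pose e := (d%:R * ln 2 / lambda - mass mu) / 2.
have e0 : 0 < e.
  by rewrite divr_gt0// subr_gt0 ltr_pdivlMr// mulrC.
have [N NP] := hit_mass_expsize e0.
pose C := \sum_(i < N) hit_mass mu (expsize i.+1).
pose gam := (d%:R * ln 2 - lambda * mass mu) / 2.
have gam0 : 0 < gam by rewrite divr_gt0// subr_gt0.
have [K KP] := archi_nat ((ln 2 + d%:R * ln 2 + lambda * C) / gam).
pose k := (K + 2)%N; pose m := (N + k)%N.
have kb : ln 2 + d%:R * ln 2 + lambda * C <= k%:R * gam.
  by rewrite -ler_pdivrMr//; apply: KP; rewrite leq_addr.
exists m; split; first by rewrite /m /k; lia.
have sumE : hits_sum mu m <= C + k%:R * (mass mu + e).
  rewrite /hits_sum (reindex_inj rev_ord_inj)/=.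
  rewrite (eq_bigr (fun i : 'I_m => hit_mass mu (expsize i.+1))); last first.
    by move=> i _; congr (hit_mass _ (expsize _)); have := ltn_ord i; lia.
  rewrite big_split_ord/= lerD2l.
  apply: (@le_trans _ _ (\sum_(i < k) (mass mu + e))).
    by apply: ler_sum => i _; apply: NP; lia.
  by rewrite sumr_const card_ord mulr_natl lexx.
rewrite children_count natrX -[in leLHS](@lnK _ 2) ?posrE//.
rewrite -[in X in X ^+ _](@lnK _ 2) ?posrE// -expRM_natl -expRD ler_expR.
have l2 : 0 < ln 2 :> R by rewrite ln_gt0// ltr1n.
have lS : lambda * hits_sum mu m <= lambda * (C + k%:R * (mass mu + e)).
  by rewrite ler_pM2l.
have le : lambda * (mass mu + e) = d%:R * ln 2 - gam.
  by rewrite /e /gam; field; rewrite gt_eqF.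
have mk : (k%:R - 1) * (d%:R * ln 2) <= (m.-1 * d)%:R * ln 2 :> R.
  rewrite mulrA ler_pM2r// natrM ler_wpM2r//.
  by rewrite lerBlDr natr1 ler_nat /m /k; lia.
have : lambda * (C + k%:R * (mass mu + e)) = lambda * C + k%:R * (lambda * (mass mu + e)).
  by ring.
rewrite le => e2; rewrite e2 in lS; lra.
Qed.

Lemma subcritical : measurable (empty_event Phi) -> lambda * mass mu < d%:R * ln 2 ->
  prob P (empty_event Phi) < 1.
Proof.
move=> me /many_children[m [m1 mN]].
set N := #|_| in mN; pose p := expR (- (lambda * hits_sum mu m)).
have N1 : (1 < N)%N.
  by rewrite /N children_count -{1}(expn0 2) ltn_exp2l// muln_gt0 d0 andbT; lia.
pose rho : R := (4 * N%:R)^-1; pose kappa : R := p ^+ 2 * rho ^+ 2.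
have rho0 : 0 < rho by rewrite invr_gt0 mulr_gt0// ltr0n ltnW.
have kappa0 : 0 < kappa by rewrite mulr_gt0// exprn_gt0// expR_gt0.
(* Any T with T / 2 >= [rho] / [kappa] will do, by Bernoulli's inequality. *)
have [T TP] : exists T, rho <= kappa * (3 / 2) ^+ T.
  have [T TP] := archi_nat (2 * (rho / kappa)); exists T.
  rewrite mulrC -ler_pdivrMr//; apply: le_trans (pow_three_halves R T).
  by have := TP _ (leqnn T); lra.
have [//|] := survival hF mu_translation mu_scale h1 lambda_gt0 nuE pp (ltnW m1) erefl N1 mN TP.
by [].
Qed.

End subcritical.

(** * Covering at the critical intensity *)

Section finite_unions.
Context d {T : measurableType d} {R : realType} (P : probability T R).

Lemma prob_bigU (I : choiceType) (s : seq I) (E : I -> set T) :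
  uniq s -> (forall i, measurable (E i)) -> (forall i j, i != j -> E i `&` E j = set0) ->
  prob P (\big[setU/set0]_(i <- s) E i) = \sum_(i <- s) prob P (E i).
Proof.
move=> + mE EE; elim: s => [|i s IH].
  by rewrite !big_nil /prob measure0.
move=> /andP[ins us]; rewrite !big_cons -IH// probU//.
  by apply: bigsetU_measurable => j _.
apply/seteqP; split=> // w [Ei]; rewrite -bigcup_seq => -[j /= js Ej].
have ij : i != j by apply: contraNneq ins => ->.
by have : (E i `&` E j) w by []; rewrite EE.
Qed.

Lemma prob_bigU_le (I : Type) (s : seq I) (E : I -> set T) :
  (forall i, measurable (E i)) ->
  prob P (\big[setU/set0]_(i <- s) E i) <= \sum_(i <- s) prob P (E i).
Proof.
move=> mE; elim: s => [|i s IH]; first by rewrite !big_nil /prob measure0.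
rewrite !big_cons; apply: le_trans (prob_setU_le P _ _) _ => //.
  by apply: bigsetU_measurable => j _.
by rewrite lerD2l.
Qed.

Lemma markov_count (I : finType) (E : I -> set T) (J : nat) (A : set T) :
  (forall i, measurable (E i)) -> measurable A ->
  (forall w, A w -> (J <= #|[pred i | `[< E i w >]]|)%N) ->
  J%:R * prob P A <= \sum_i prob P (E i).
Proof.
move=> mE mA AJ.
have mI i : measurable_fun setT (fun w => (\1_(E i) w)%:E : \bar R).
  by apply/measurable_EFinP; apply: measurable_indic.
have e1 : (\int[P]_w \sum_i (\1_(E i) w)%:E = (\sum_i prob P (E i))%:E)%E.
  rewrite ge0_integral_sum//.
  rewrite -sumEFin; apply: eq_bigr => i _; rewrite integral_indic// setIT.
  by apply: probE.
have e2 : (\int[P]_w (J%:R%:E * (\1_A w)%:E) = (J%:R * prob P A)%:E)%E.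
  rewrite ge0_integralZl_EFin//; last by apply/measurable_EFinP; apply: measurable_indic.
  by rewrite integral_indic// setIT EFinM; congr (_ * _)%E; apply: probE.
rewrite -lee_fin -e1 -e2; apply: le_ge0_integral => w _; first by rewrite mule_ge0.
rewrite sumEFin -EFinM lee_fin.
have -> : \sum_i \1_(E i) w = #|[pred i | `[< E i w >]]|%:R :> R.
  rewrite -sum1_card natr_sum [RHS]big_mkcond/=; apply: eq_bigr => i _.
  rewrite indicE inE; case: asboolP => h; first by rewrite mem_set.
  by rewrite memNset.
rewrite indicE; case: (boolP (w \in A)) => [/set_mem Aw|_]; last by rewrite mulr0.
by rewrite mulr1 ler_nat AJ.
Qed.

End finite_unions.

(** * Cubes contained in no single set *)

Section critical.
Context {R : realType} {d : nat} (d0 : (0 < d)%N).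
Local Notation V := 'rV[R]_d.
Local Notation gset := (gset R d).
Context {F : set (set gset)} (hF : suitable F).
Local Notation GF := (g_sigma_algebraType F).
Context (mu : {measure set GF -> \bar R}).
Hypotheses (mu_translation : translation_invariant mu)
  (mu_scale : semi_scale_invariant mu) (h1 : locally_finite_hits mu)
  (h2 : mu pos_boundary = 0%E) (h3 : (0 < mu pos_volume)%E)
  (h4 : (boundary_integral mu < +oo)%E).
Context {dO : measure_display} {Omega : measurableType dO}.
Context (P : probability Omega R) (Phi : Omega -> configuration (R := R) (d := d)).
Context (lambda : R) (lambda_gt0 : 0 < lambda) (nu : {measure set GF -> \bar R}).
Hypotheses (nuE : forall D : set GF, nu D = (lambda%:E * mu D)%E)
  (pp : poisson_process P Phi nu) (critical : lambda * mass mu = d%:R * ln 2).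
Local Notation expsize := (@expsize R).
Local Notation coreF := (@core R d F).
Local Notation sigmaV := (@sigma_void R d F dO Omega Phi nu).
Local Notation voidF := (@void R d F dO Omega Phi).
Implicit Types (x y : V) (s r : R) (D : set GF).

(* [2 ^+ d >= d], so a cube of side [expsize n] lies in the ball of radius [rad n]
   about its corner. *)
Definition rad n : R := 2 ^+ d * expsize n.

Lemma rad_gt0 n : 0 < rad n.
Proof. by rewrite mulr_gt0 ?exprn_gt0// expsize_gt0. Qed.

Lemma dim_lt_pow : d%:R < 2 ^+ d :> R.
Proof. by rewrite -natrX ltr_nat ltn_expl. Qed.

Lemma core_rad_mass x a j : mu (coreF x (rad (j + a)) j) = (mass mu - rim_mass mu (rad a))%:E.
Proof.
have [_ f] := core_finite d0 hF h1 0 0 (rad_gt0 a).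
have -> : rad (j + a) = expsize j * rad a by rewrite /rad /expsize exprD; ring.
rewrite (core_scale d0 hF mu_translation mu_scale h1 x j (rad_gt0 a)).
rewrite -[LHS]fineK ?ge0_fin_numE//.
by rewrite (core_mass d0 hF h1 (rad_gt0 a)).
Qed.

Context (x0 : V).
Local Notation index n := {ffun 'I_d -> 'I_(2 ^ n)}.

Definition corner n (z : index n) : V := x0 + expsize n *: \row_i (z i)%:R.

(** Sets of diameter in [2^-n, 1[ containing a ball about the corner that includes the cube. Asking
    for the ball makes each range a [core], whose measurability and mass are known. *)
Definition covers n (z : index n) : set GF :=
  \big[setU/set0]_(j < n) coreF (corner z) (rad n) j.

Definition uncovered n (z : index n) : set Omega := voidF (covers z).

Lemma covers_finite n (z : index n) : finite_mass mu (covers z).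
Proof.
rewrite /covers; elim/big_ind: _ => [|A B|j _]; [exact: finite_mass0|exact: finite_massU|].
exact: core_finite (rad_gt0 n).
Qed.

Lemma core_disjoint x r i j : i != j -> coreF x r i `&` coreF x r j = set0.
Proof.
wlog ij : i j / (i < j)%N => [hw|_].
  by rewrite neq_ltn => /orP[]lt; [|rewrite setIC]; apply: hw; rewrite // ?(ltn_eqF lt) ?neq_ltn ?lt.
apply/seteqP; split=> // G [[_ /andP[a _] _] [_ /andP[_ b] _]].
have := lt_le_trans b (le_trans (_ : _ <= (expsize i.+1)%:E)%E a).
by rewrite ltxx lee_fin expsize_anti// => /(_ isT).
Qed.

Lemma covers_mass n (z : index n) :
  fine (mu (covers z)) = \sum_(j < n) (mass mu - rim_mass mu (rad (n - j))).
Proof.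
have mc j : measurable (coreF (corner z) (rad n) j).
  exact: (core_finite d0 hF h1 _ j (rad_gt0 n)).1.
have := measure_bigsetU_ord mu predT (fun j : 'I_n => mc j) _.
rewrite /covers => ->; last first.
  apply/trivIsetP => i j _ _ ij; apply: core_disjoint.
  by apply: contraNneq ij => /val_inj ->.
rewrite (eq_bigr (fun j : 'I_n => (mass mu - rim_mass mu (rad (n - j)))%:E)).
  by rewrite sumEFin.
move=> j _; rewrite -(core_rad_mass (corner z) (n - j) j) subnKC//.
exact: ltnW.
Qed.

(** At the critical intensity exp(- lambda n c) is exactly 2^(-d n); the remaining factor is the
    exponential of lambda times a bounded sum of rim masses. *)
Lemma uncovered_prob : exists C : R, forall n (z : index n),
  prob P (uncovered z) <= expR C / (2 ^ (d * n))%:R.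
Proof.
have [C CP] := rim_sum d0 hF mu_translation h1 h2 h4 d.
exists (lambda * C) => n z; rewrite /uncovered.
rewrite (prob_void_mu lambda_gt0 nuE pp (covers_finite z)) covers_mass big_split/= sumr_const card_ord.
have -> : (2 ^ (d * n))%:R = expR (lambda * (n%:R * mass mu)) :> R.
  rewrite mulrCA critical expRM_natl mulnC expnM natrX natrX.
  by rewrite expRM_natl lnK ?posrE// -!natrX -expnM mulnC expnM.
rewrite -expRN -expRD ler_expR mulrDr opprD -[mass mu *+ n]mulr_natl addrC lerD2r.
rewrite -mulrN ler_pM2l//.
rewrite -sumrN (eq_bigr (fun j : 'I_n => rim_mass mu (rad (n - j)))); last first.
  by move=> j _; rewrite opprK.
(* The radii have indices n - j, from 1 to n: the bound for n + 1 terms is used and the term of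
   index 0 dropped. *)
apply: le_trans (CP n.+1); rewrite big_ord_recl/=.
rewrite (reindex_inj rev_ord_inj)/=.
rewrite (eq_bigr (fun j : 'I_n => rim_mass mu (2 ^+ d * expsize (bump 0 j)))).
  by rewrite lerDr; exact: rim_mass_ge0.
move=> j _; congr (rim_mass _ (_ * expsize _)); rewrite /bump /=.
by have := ltn_ord j; lia.
Qed.

(** Takes finitely many values, so that conditioning on it is a finite partition. *)
Definition unc_set n (w : Omega) : {set index n} := [set z | `[< uncovered z w >]]%SET.

Lemma uncovered_measurable n (z : index n) : measurable (uncovered z).
Proof. by apply: (measurable_void pp); exact: (covers_finite z).1. Qed.

Definition big_zone n : set GF := [set G | ((expsize n)%:E <= diam (sval G))%E].
Definition small_zone n : set GF := [set G | (diam (sval G) < (expsize n)%:E)%E].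

Lemma covers_big_zone n (z : index n) : covers z `<=` big_zone n.
Proof.
move=> G; rewrite /covers -bigcup_mkord => -[j /= jn [_ /andP[h _] _]].
by apply: le_trans h; rewrite lee_fin; exact: expsize_anti.
Qed.

Lemma unc_set_sigma n (S : {set index n}) :
  sigmaV (big_zone n) [set w | unc_set n w = S].
Proof.
rewrite (_ : [set w | _] = \big[setI/setT]_(z : index n)
    (if z \in S then uncovered z else ~` uncovered z)).
  have uz z : sigmaV (big_zone n) (@uncovered n z).
    apply: sigma_void_void; first exact: (finite_mass_nu lambda_gt0 nuE (covers_finite z)).
    exact: covers_big_zone.
  apply: sigma_void_bigI => z _; case: ifP => _; [exact: uz|apply: sigma_voidC; exact: uz].
rewrite -bigcap_seq; apply/seteqP; split=> w /=.
  move=> <- z _; rewrite inE; case: asboolP => //.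
move=> h; apply/setP => z; rewrite inE.
have := h z; rewrite /= mem_index_enum => /(_ isT).
by case: ifP => _; case: asboolP.
Qed.

Lemma unc_set_measurable n (S : {set index n}) : measurable [set w | unc_set n w = S].
Proof. exact: (sigma_void_measurable pp (@unc_set_sigma n S)). Qed.

Definition dead n : set Omega := [set w | unc_set n w = finset.set0].

Lemma deadP n w : dead n w <-> forall z : index n, ~ uncovered z w.
Proof.
split=> [h z uz|h].
  have : z \in unc_set n w by rewrite inE; exact/asboolP.
  by rewrite h inE.
by apply/setP => z; rewrite !inE; apply/asboolP; exact: h.
Qed.

Lemma uncoveredPn n (z : index n) w : ~ uncovered z w ->
  exists k G j, [/\ Phi w k = Some G, (j < n)%N & coreF (corner z) (rad n) j G].
Proof.
move=> /existsNP[k /existsNP[G /not_implyP[E /contrapT]]].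
by rewrite /covers -bigcup_mkord => -[j jn cG]; exists k, G, j.
Qed.

Lemma parent_subproof n m (z : index (n + m)) i : (z i %/ 2 ^ m < 2 ^ n)%N.
Proof. by rewrite ltn_divLR ?expn_gt0// -expnD. Qed.

Definition parent n m (z : index (n + m)) : index n :=
  [ffun i => Ordinal (@parent_subproof n m z i)].

(** Each coordinate differs by at most 2^-n - 2^-(n+m), and d <= 2^d. The bound has the form that
    [deep_shift] asks for, so a covered cube has covered subcubes. *)
Lemma parent_dist n m (z : index (n + m)) :
  enorm (corner (parent z) - corner z) <= rad n - rad (n + m).
Proof.
have s0 := @expsize_gt0 R (n + m).
have sE : expsize n = expsize (n + m) * (2 ^ m)%:R.
  by rewrite /expsize exprD natrX -mulrA -exprMn mulVf// expr1n mulr1.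
have m1 : 1 <= (2 ^ m)%:R :> R by rewrite ler1n expn_gt0.
apply: (@le_trans _ _ (d%:R * (expsize (n + m) * ((2 ^ m)%:R - 1)))).
  apply: enorm_le_coord => //; first by rewrite mulr_ge0 ?subr_ge0// ltW.
  move=> i; rewrite !mxE ffunE /= {1}sE.
  have rE : (z i)%:R = (z i %/ 2 ^ m)%:R * (2 ^ m)%:R + (z i %% 2 ^ m)%:R :> R.
    by rewrite -natrM -natrD -divn_eq.
  have r1 : (z i %% 2 ^ m)%:R + 1 <= (2 ^ m)%:R :> R by rewrite natr1 ler_nat ltn_mod expn_gt0.
  rewrite rE; have : 0 <= (z i %% 2 ^ m)%:R :> R by [].
  move: r1; set q := (_ %/ _)%:R; set r := (_ %% _)%:R; set b := (2 ^ m)%:R => r1 r0.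
  rewrite (_ : _ - _ = - (expsize (n + m) * r)); last by ring.
  by rewrite normrN ger0_norm ?mulr_ge0 ?ler_pM2l//; [lra|exact: ltW].
rewrite /rad sE; have -> : 2 ^+ d * (expsize (n + m) * (2 ^ m)%:R) - 2 ^+ d * expsize (n + m) =
  2 ^+ d * (expsize (n + m) * ((2 ^ m)%:R - 1)) by ring.
apply: ler_wpM2r; last exact/ltW/dim_lt_pow.
by rewrite mulr_ge0 ?subr_ge0// ltW.
Qed.

Lemma covered_child n m (z : index (n + m)) w :
  ~ uncovered (parent z) w -> ~ uncovered z w.
Proof.
move=> /uncoveredPn[k [G [j [E jn [dG hG pG]]]]] uz.
apply: (uz _ _ E); rewrite /covers -bigcup_mkord; exists j => /=.
  by apply: leq_trans jn _; exact: leq_addr.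
by split=> //; apply: (deep_shift d0 (rad_gt0 _) dG); exact: parent_dist.
Qed.

Lemma dead_mono n m : dead n `<=` dead (n + m).
Proof. by move=> w /deadP h; apply/deadP => z; exact: covered_child. Qed.

Lemma children_card n m (S : {set index n}) :
  (#|[pred z : index (n + m) | parent z \in S]| <= #|S| * 2 ^ (m * d))%N.
Proof.
have rP (z : index (n + m)) i : (z i %% 2 ^ m < 2 ^ m)%N by rewrite ltn_mod expn_gt0.
pose f (z : index (n + m)) := (parent z, [ffun i => Ordinal (rP z i)] : index m).
have fi : injective f.
  move=> z z' [] /ffunP pz /ffunP rz; apply/ffunP => i; apply: val_inj => /=.
  rewrite (divn_eq (z i) (2 ^ m)) (divn_eq (z' i) (2 ^ m)).
  have := pz i; have := rz i; rewrite !ffunE => /(congr1 val) /= -> /(congr1 val) /= ->.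
  by [].
rewrite -(card_imset _ fi) /=.
have -> : (#|S| * 2 ^ (m * d) = #|finset.setX S [set: index m]%SET|)%N.
  by rewrite cardsX cardsT card_ffun !card_ord expnM.
apply: subset_leq_card; apply/fintype.subsetP => _ /imsetP[z zS ->].
by rewrite !inE andbT; exact: zS.
Qed.

(** All subcubes, m levels down, of the cubes in [S] are covered by sets of the single range
    [2^-(n+1), 2^-n[. Going m levels down makes the required balls small against these diameters, so
    that [rim_mass] at [rad m] is below [mass]. *)
Definition rescue n m (S : {set index n}) : set Omega :=
  \big[setI/setT]_(z <- enum [pred z : index (n + m) | parent z \in S])
    ~` voidF (coreF (corner z) (rad (n + m)) n).

(** There are at most J 2^(d m) subcubes, and [harris] bounds the probability of covering all of
    them by the product. The bound does not depend on n. *)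
Lemma rescue_prob n m (S : {set index n}) (J : nat) : (#|S| <= J)%N ->
  (1 - expR (- (lambda * (mass mu - rim_mass mu (rad m))))) ^+ (J * 2 ^ (m * d)) <=
    prob P (rescue m S).
Proof.
move=> SJ; set th := expR _.
have th0 : 0 < th by exact: expR_gt0.
have th1 : th <= 1.
  rewrite expR_le1 oppr_le0; apply: mulr_ge0; first exact: ltW.
  by rewrite subr_ge0; exact: (rim_mass_le_mass d0 hF h1 (rad_gt0 m)).
have fc (z : index (n + m)) : finite_mass nu (coreF (corner z) (rad (n + m)) n).
  apply: (finite_mass_nu lambda_gt0 nuE); exact: (core_finite d0 hF h1 _ _ (rad_gt0 _)).
apply: le_trans (harris pp _ fc).
rewrite (eq_bigr (fun _ => 1 - th)); last first.
  move=> z _; rewrite (prob_void_mu lambda_gt0 nuE pp) ?core_rad_mass//.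
  exact: (core_finite d0 hF h1 _ _ (rad_gt0 _)).
rewrite big_const_seq count_predT -Monoid.iteropE -cardE.
apply: ler_wiXn2l; rewrite ?subr_ge0 ?gerBl ?(ltW th0)//.
apply: leq_trans (children_card m S) _; rewrite leq_mul2r SJ orbT//.
Qed.

Lemma rescue_sigma n m (S : {set index n}) : sigmaV (small_zone n) (rescue m S).
Proof.
apply: sigma_void_bigI => z _; apply: sigma_voidC; apply: sigma_void_void.
  apply: (finite_mass_nu lambda_gt0 nuE); exact: (core_finite d0 hF h1 _ _ (rad_gt0 _)).
by move=> G [_ /andP[_ h] _].
Qed.

Lemma rescue_dead n m (S : {set index n}) w : (0 < m)%N ->
  unc_set n w = S -> rescue m S w -> dead (n + m) w.
Proof.
move=> m0 uS rS; apply/deadP => z; have [zS|zS] := boolP (parent z \in S).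
  have : (~` voidF (coreF (corner z) (rad (n + m)) n)) w.
    move: rS; rewrite /rescue -bigcap_seq; apply.
    by rewrite /= mem_enum.
  move=> nv uz; apply: nv => k G E cG; apply: (uz _ _ E).
  rewrite /covers -bigcup_mkord; exists n => //=.
  by rewrite -[X in (X < _)%N]addn0 ltn_add2l.
apply: covered_child => up; move/negP: zS; apply; rewrite -uS inE.
exact/asboolP.
Qed.

(** Split by the value of [unc_set n], which depends on the sets of diameter at least 2^-n, while
    each rescue depends on smaller ones. *)
Lemma rescue_step n m (Q : pred {set index n}) (J : nat) : (0 < m)%N ->
  (forall S, Q S -> (#|S| <= J)%N) ->
  (1 - expR (- (lambda * (mass mu - rim_mass mu (rad m))))) ^+ (J * 2 ^ (m * d)) *
    prob P [set w | Q (unc_set n w)] <=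
  prob P ([set w | Q (unc_set n w)] `&` dead (n + m)).
Proof.
move=> m0 QJ; set del := _ ^+ _.
pose ev (S : {set index n}) : set Omega := [set w | unc_set n w = S].
have mev S : measurable (ev S) by exact: unc_set_measurable.
have mr (S : {set index n}) : measurable (rescue m S).
  exact: (sigma_void_measurable pp (@rescue_sigma n m S)).
have QE : [set w | Q (unc_set n w)] = \big[setU/set0]_(S <- enum Q) ev S.
  rewrite -bigcup_seq; apply/seteqP; split=> [w Qw|w [S /= SQ eS]].
    by exists (unc_set n w) => //=; rewrite mem_enum.
  by rewrite /= eS; move: SQ; rewrite mem_enum.
have mQ : measurable [set w | Q (unc_set n w)].
  by rewrite QE; apply: bigsetU_measurable => S _.
have indQ S : prob P (ev S `&` rescue m S) = prob P (ev S) * prob P (rescue m S).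
  have bs : big_zone n `&` small_zone n = set0.
    apply/seteqP; split=> // G [a b]; have := le_lt_trans a b.
    by rewrite ltxx.
  exact: (indep_sigma_void pp bs (@unc_set_sigma n S) (@rescue_sigma n m S)).
apply: (@le_trans _ _ (prob P (\big[setU/set0]_(S <- enum Q) (ev S `&` rescue m S)))); last first.
  apply: le_prob.
  - by apply: bigsetU_measurable => S _; exact: measurableI.
  - by apply: measurableI => //; exact: unc_set_measurable.
  move=> w; rewrite -bigcup_seq => -[S /= SQ [eS rS]]; split.
    by rewrite /= eS; move: SQ; rewrite mem_enum.
  exact: rescue_dead eS rS.
rewrite prob_bigU; last 3 first.
- exact: enum_uniq.
- by move=> S; exact: measurableI.
- move=> S S' SS'; apply/seteqP; split=> // w [[e1 _] [e2 _]].
  by move/eqP: SS'; apply; rewrite -e1 -e2.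
apply: (@le_trans _ _ (\sum_(S <- enum Q) del * prob P (ev S))).
  rewrite -mulr_sumr; apply: ler_wpM2l.
    rewrite exprn_ge0// subr_ge0 expR_le1 oppr_le0; apply: mulr_ge0; first exact: ltW.
    by rewrite subr_ge0; exact: (rim_mass_le_mass d0 hF h1 (rad_gt0 m)).
  by rewrite QE; exact: prob_bigU_le.
rewrite [leLHS]big_seq [leRHS]big_seq; apply: ler_sum => S; rewrite mem_enum => QS.
rewrite indQ mulrC; apply: ler_wpM2l; first exact: prob_ge0.
by apply: rescue_prob; exact: QJ.
Qed.

Lemma rim_mass_mono r s : 0 < r -> r <= s -> rim_mass mu r <= rim_mass mu s.
Proof.
move=> r0 rs; have s0 := lt_le_trans r0 rs.
have [mr fr] := rim_finite d0 hF h1 0 0 r0; have [ms fs] := rim_finite d0 hF h1 0 0 s0.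
apply: fine_le; rewrite ?ge0_fin_numE//.
apply: le_measure; [exact/mem_set|exact/mem_set|move=> G [+ hG pG]].
move=> /inner_nbhdP[Gx [y Ay xy]]; split=> //; apply/inner_nbhdP; split=> //.
by exists y => //; exact: lt_le_trans rs.
Qed.

Lemma many_uncovered : exists C : R, forall n (J : nat),
  J%:R * prob P [set w | (J <= #|unc_set n w|)%N] <= C.
Proof.
have [C CP] := uncovered_prob; exists (expR C) => n J.
have mA : measurable [set w | (J <= #|unc_set n w|)%N].
  rewrite (_ : [set w | _] = \big[setU/set0]_(S <- enum [pred S : {set index n} | (J <= #|S|)%N])
      [set w | unc_set n w = S]).
    by apply: bigsetU_measurable => S _; exact: unc_set_measurable.
  rewrite -bigcup_seq; apply/seteqP; split=> [w Jw|w [S /= + eS]].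
    by exists (unc_set n w) => //=; rewrite mem_enum.
  by rewrite mem_enum eS.
apply: (@le_trans _ _ (\sum_(z : index n) prob P (uncovered z))).
  have mU := @uncovered_measurable n.
  apply: (@markov_count _ _ _ P (index n) (@uncovered n) J _ mU mA) => w /= /leq_trans; apply; apply: subset_leq_card; apply/fintype.subsetP => z.
  by rewrite !inE.
apply: le_trans (ler_sum _ (fun z _ => CP n z)) _.
rewrite sumr_const card_ffun !card_ord -expnM [(n * d)%N]mulnC -[leLHS]mulr_natr.
by rewrite divfK// pnatr_eq0 -lt0n expn_gt0.
Qed.

(** The events [E k], where a small positive number of uncovered cubes at level k m becomes none at
    the next multiple of m, are disjoint, so their probabilities have sum at most 1. Each is at
    least a fixed fraction of the probability of [A (k * m)], which is therefore small for some k.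
    Outside [A (k * m)] either all is covered or there are many uncovered cubes, which Markov's
    inequality makes unlikely. *)
Lemma dead_likely (e : R) : 0 < e -> exists n, prob P (~` dead n) <= e.
Proof.
move=> e0; have mass0 := mass_gt0 d0 hF mu_translation mu_scale h1 h2 h3.
have [m0 hm0] := rim_mass_small d0 hF mu_translation h1 h2 h4 d mass0.
pose m := m0.+1.
have hm : rim_mass mu (rad m) < mass mu.
  apply: le_lt_trans hm0; apply: rim_mass_mono; first exact: rad_gt0.
  by rewrite ler_pM2l ?exprn_gt0// expsize_anti.
have [C CP] := many_uncovered.
(* Makes the Markov bound C / (J + 1) at most e / 2. *)
have [J JP] := archi_nat (2 * C / e).
pose Q n := [pred S : {set index n} | (0 < #|S| <= J.+1)%N].
pose A n := [set w | Q n (unc_set n w)].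
pose th := expR (- (lambda * (mass mu - rim_mass mu (rad m)))).
have th1 : th < 1 by rewrite expR_lt1 oppr_lt0 mulr_gt0// subr_gt0.
pose del := (1 - th) ^+ (J.+1 * 2 ^ (m * d)).
have del0 : 0 < del by rewrite exprn_gt0// subr_gt0.
have mD n : measurable (dead n) by exact: unc_set_measurable.
have mset n (q : pred {set index n}) : measurable [set w | q (unc_set n w)].
  rewrite (_ : [set w | _] = \big[setU/set0]_(S <- enum q) [set w | unc_set n w = S]).
    by apply: bigsetU_measurable => S _; exact: unc_set_measurable.
  rewrite -bigcup_seq; apply/seteqP; split=> [w Jw|w [S /= + eS]].
    by exists (unc_set n w) => //=; rewrite mem_enum.
  by rewrite mem_enum eS.
have mA n : measurable (A n) by exact: mset.
pose E k := A (k * m)%N `&` dead (k * m + m).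
have mE k : measurable (E k) by exact: measurableI.
have step k : del * prob P (A (k * m)%N) <= prob P (E k).
  by apply: (@rescue_step _ m (Q (k * m)%N) J.+1) => // S /andP[].
have nA n : A n `&` dead n = set0.
  apply/seteqP; split=> // w [/andP[+ _]]; rewrite /dead /= => + u0.
  by rewrite u0 cards0.
have EE k k' : k != k' -> E k `&` E k' = set0.
  wlog kk' : k k' / (k < k')%N => [hw|_].
    rewrite neq_ltn => /orP[]lt; first by apply: hw; rewrite // ltn_eqF.
    by rewrite setIC; apply: hw; rewrite // ltn_eqF.
  apply/seteqP; split=> // w [[_ dk] [Ak' _]].
  rewrite -(nA (k' * m)%N); split=> //.
  have -> : (k' * m = k * m + m + (k' - k.+1) * m)%N.
    by rewrite -mulSnr -mulnDl subnKC.
  exact: dead_mono dk.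
have sum1 K : \sum_(k <- iota 0 K) prob P (E k) <= 1.
  rewrite -prob_bigU ?iota_uniq//; apply: prob_le1.
  by apply: bigsetU_measurable => k _.
have [k kP] : exists k, prob P (A (k * m)%N) <= e / 2.
  apply: contrapT => /forallNP h.
  have [K KP] := archi_nat (2 / (del * e)).
  have : K.+1%:R * (del * (e / 2)) <= 1.
    apply: le_trans (sum1 K.+1).
    apply: (@le_trans _ _ (\sum_(k <- iota 0 K.+1) del * (e / 2))).
      by rewrite big_const_seq count_predT size_iota iter_addr_0 mulr_natl lexx.
    apply: ler_sum => k _; apply: le_trans (step k).
    by rewrite ler_pM2l// leNgt; apply/negP => /ltW; exact: h.
  have := KP K (leqnn K); rewrite -[K.+1%:R]natr1 ler_pdivrMr ?mulr_gt0//.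
  have : 0 < del * e by rewrite mulr_gt0.
  move: (K%:R : R) (del * e) (mulrA del e 2^-1) => x y ->; lra.
exists (k * m)%N.
pose B := [set w | (J.+1 <= #|unc_set (k * m) w|)%N].
have mB : measurable B by exact: (mset (k * m)%N [pred S : {set index (k * m)} | (J.+1 <= #|S|)%N]).
have sub : ~` dead (k * m) `<=` A (k * m)%N `|` B.
  move=> w nd; have [JS|JS] := leqP J.+1 #|unc_set (k * m) w|; first by right.
  left; rewrite /A /= (ltnW JS) andbT card_gt0; apply/eqP => u0; exact: nd.
apply: le_trans (le_prob _ _ _ sub) _; first exact: measurableC.
  exact: measurableU.
apply: le_trans (prob_setU_le P (mA _) mB) _.
suff : prob P B <= e / 2 by lra.
have J0 : 0 < J.+1%:R :> R by rewrite ltr0n.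
have := CP (k * m)%N J.+1; rewrite -/B mulrC -ler_pdivlMr// => /le_trans; apply.
rewrite ler_pdivrMr//; have := JP _ (leqnSn J); rewrite ler_pdivrMr//.
by lra.
Qed.

Lemma dead_covers n w y : dead n w ->
  (forall i, x0 ord0 i <= y ord0 i < x0 ord0 i + 1) -> ~ fractal (Phi w) y.
Proof.
move=> /deadP dw xy; apply; have s0 := @expsize_gt0 R n.
pose t i : R := 2 ^+ n * (y ord0 i - x0 ord0 i).
have st i : expsize n * t i = y ord0 i - x0 ord0 i.
  by rewrite /t mulrA /expsize -exprMn mulVf// expr1n mul1r.
have t0 i : 0 <= t i.
  by rewrite mulr_ge0 ?exprn_ge0// subr_ge0; have /andP[] := xy i.
have tlt i : (Num.truncn (t i) < 2 ^ n)%N.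
  rewrite -(ltr_nat R); have /andP[h _] := truncn_itv (t0 i); apply: le_lt_trans h _.
  rewrite natrX /t gtr_pMr ?exprn_gt0//; have /andP[_ h] := xy i; lra.
pose z : index n := [ffun i => Ordinal (tlt i)].
have [k [G [j [E jn [dG _ _]]]]] := uncoveredPn (dw z).
exists k, G; split=> //; apply: (deep_ball d0 dG).
apply: (@le_lt_trans _ _ (d%:R * expsize n)); last by rewrite ltr_pM2r// dim_lt_pow.
apply: enorm_le_coord => //; first exact: ltW.
move=> i; rewrite !mxE ffunE /=.
have := truncn_itv (t0 i); rewrite -natr1; have := st i.
move: (Num.truncn (t i))%:R => q e /andP[q1 q2].
have -> : x0 ord0 i + expsize n * q - y ord0 i = - (expsize n * (t i - q)).
  by rewrite mulrBr e; ring.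
rewrite normrN ger0_norm; last by rewrite mulr_ge0 ?subr_ge0// ltW.
by rewrite ler_piMr ?(ltW s0)//; lra.
Qed.

End critical.

(** * From unit cubes to the whole space *)

Section critical_empty.
Context {R : realType} {d : nat} (d0 : (0 < d)%N).
Local Notation V := 'rV[R]_d.
Context {F : set (set (gset R d))} (hF : suitable F).
Local Notation GF := (g_sigma_algebraType F).
Context (mu : {measure set GF -> \bar R}).
Hypotheses (mu_translation : translation_invariant mu)
  (mu_scale : semi_scale_invariant mu) (h1 : locally_finite_hits mu)
  (h2 : mu pos_boundary = 0%E) (h3 : (0 < mu pos_volume)%E)
  (h4 : (boundary_integral mu < +oo)%E).
Context {dO : measure_display} {Omega : measurableType dO}.
Context (P : probability Omega R) (Phi : Omega -> configuration (R := R) (d := d)).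
Context (lambda : R) (lambda_gt0 : 0 < lambda) (nu : {measure set GF -> \bar R}).
Hypotheses (nuE : forall D : set GF, nu D = (lambda%:E * mu D)%E)
  (pp : poisson_process P Phi nu) (critical : lambda * mass mu = d%:R * ln 2).

Lemma critical_empty : {ae P, forall w, fractal (Phi w) = set0}.
Proof.
pose D x n : set Omega := @dead R d F dO Omega Phi x n.
have mD x n : measurable (D x n) by exact: (unc_set_measurable d0 hF h1 lambda_gt0 nuE pp).
(* The space is a countable union of half-open unit cubes with integer corners; each is almost
   surely covered at some level. *)
pose A k : set Omega := match choice.unpickle k : option 'rV[int]_d with
  | Some u => \bigcap_n ~` D (lat 1 u) n | None => set0 end.
have A0 k : P.-negligible (A k).
  rewrite /A; case: (choice.unpickle k) => [u|]; last exact: negligible_set0.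
  have mI : measurable (\bigcap_n ~` D (lat 1 u) n).
    by apply: bigcapT_measurable => n; exact: measurableC.
  apply/negligibleP => //; apply/eqP; rewrite eq_le measure_ge0 andbT.
  apply/lee_addgt0Pr => e e0; rewrite add0e.
  have [n hn] := dead_likely d0 hF mu_translation mu_scale h1 h2 h3 h4 lambda_gt0 nuE pp
    critical (lat 1 u) e0.
  apply: (@le_trans _ _ (P (~` D (lat 1 u) n))).
    apply: le_measure; [exact/mem_set|exact/mem_set/measurableC|exact: bigcap_inf].
  by rewrite probE ?lee_fin//; exact: measurableC.
apply: (@negligibleS _ _ _ P (\bigcup_k A k)); last exact: negligible_bigcup.
move=> w /= nw; apply: contrapT => nA; apply: nw.
apply/seteqP; split=> // y /=.
pose u : 'rV[int]_d := \row_i Num.floor (y ord0 i).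
have [n Dn] : exists n, D (lat 1 u) n w.
  apply: contrapT => /forallNP h; apply: nA; exists (choice.pickle u) => //.
  by rewrite /A choice.pickleK => n _; exact: h.
apply: (dead_covers d0 Dn) => i; rewrite !mxE divr1.
by have /andP[-> ] := floor_itv (y ord0 i); rewrite rmorphD.
Qed.

End critical_empty.

(** * Identification of the critical value *)

Unset Implicit Arguments.
Set Strict Implicit.
Set Printing Implicit Defensive.
Local Open Scope ereal_scope.

Theorem theorem1p2 (R : realType) (d : nat) (hd : (0 < d)%N)
  (F : set (set (gset R d))) (hF : suitable F)
  (mu : {measure set (g_sigma_algebraType F) -> \bar R})
  (mu_infinite : mu setT = +oo)
  (mu_translation : translation_invariant mu)
  (mu_scale : semi_scale_invariant mu)
  (h1 : locally_finite_hits mu)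
  (h2 : mu pos_boundary = 0)
  (h3 : 0 < mu pos_volume)
  (h4 : boundary_integral mu < +oo)
  (dO : measure_display) (Omega : measurableType dO) (P : probability Omega R)
  (Phi : R -> Omega -> configuration)
  (hPhi : forall lambda : R, (0 < lambda)%R ->
     poisson_process P (Phi lambda) (fun D => lambda%:E * mu D))
  (hempty : forall lambda : R, (0 < lambda)%R ->
     measurable (empty_event (Phi lambda))) :
  {ae P, forall w, fractal (Phi (lambda_e P Phi) w) = set0}.
Proof.
have m0 : (0 < mass mu)%R := mass_gt0 hd hF mu_translation mu_scale h1 h2 h3.
have l2 : (0 < ln 2 :> R)%R by rewrite ln_gt0// ltr1n.
pose lc : R := (d%:R * ln 2 / mass mu)%R.
have lc0 : (0 < lc)%R by rewrite divr_gt0// mulr_gt0// ltr0n.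
have scaleE l (l0 : (0 < l)%R) : poisson_process P (Phi l) (mscale (NngNum (ltW l0)) mu).
  exact: hPhi.
have ae_empty : {ae P, forall w, fractal (Phi lc w) = set0}.
  apply: (critical_empty hd hF mu_translation mu_scale h1 h2 h3 h4 lc0 _ (scaleE _ lc0)) => //.
  by rewrite /lc divfK// gt_eqF.
have Plc : P (empty_event (Phi lc)) = 1.
  rewrite -(probability_setT P); apply/eqP; rewrite eq_le; apply/andP; split.
    by apply: le_measure => //; apply/mem_set => //; exact: hempty.
  have mN : measurable (~` empty_event (Phi lc)) by apply: measurableC; exact: hempty.
  have : P (~` empty_event (Phi lc)) = 0.
    by apply/(negligibleP _ mN); exact: ae_empty.
  rewrite probability_setC; last exact: hempty.
  rewrite probability_setT => h; have := hempty _ lc0 => me.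
  by move: h; rewrite (probE P me) -EFinB => -[] /eqP; rewrite subr_eq0 => /eqP <-.
suff -> : lambda_e P Phi = lc by [].
pose S := [set lambda : R | (0 < lambda)%R /\ P (empty_event (Phi lambda)) = 1].
have Slc : S lc by split.
(* Below [lc] emptiness has probability less than 1; as [lc] itself is in [S], it is the least
   element and hence the infimum. *)
have lbS : lbound S lc.
  move=> l [l0 Pl]; rewrite leNgt; apply/negP => llc.
  have := subcritical hd hF mu_translation mu_scale h1 h2 l0 _ (scaleE _ l0) (hempty _ l0) _.
  rewrite /prob Pl ltxx => /(_ (fun=> erefl))/implyP; rewrite implybF => /negP; apply.
  by rewrite -ltr_pdivlMr.
apply/eqP; rewrite eq_le; apply/andP; split.
  by apply: ge_inf => //; exists lc.
by apply: lb_le_inf => //; exists lc.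
Qed.
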